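(* Let $w\in\mathbf{F}$ be a non-power. For every $k\in\mathbb{Z}_{\ge1}$ and $\alpha_1,\ldots,\alpha_k\in\mathbb{Z}_{\ge0}$ which are not all zero, there exists a positive integer $C_{\alpha_1,\ldots,\alpha_k}\in\mathbb{Z}_{\ge1}$ such that, as $N\to\infty$, $$\mathbb{E}_w\left[\xi_1^{\alpha_1}\cdots\xi_k^{\alpha_k}\right]=\mathbb{E}_{\mathrm{unif}}\left[\xi_1^{\alpha_1}\cdots\xi_k^{\alpha_k}\right]+C_{\alpha_1,\ldots,\alpha_k}\cdot\frac{|\mathrm{Crit}(w)|}{N^{\pi(w)-1}}+O\left(\frac{1}{N^{\pi(w)}}\right).$$ Moreover, the constant $C_{\alpha_1,\ldots,\alpha_k}$ is equal to $\left\langle \xi_1^{\alpha_1}\cdots\xi_k^{\alpha_k},\,\xi_1-1\right\rangle$.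
   Context: $\mathbf{F}$ is the free group on $r\ge1$ generators. A word $w\in\mathbf{F}$ is a non-power if it is not of the form $u^m$ with $u\in\mathbf{F}$, $m\ge2$ (in particular $w\neq1$). For a permutation $\sigma$, $\xi_k(\sigma)$ is the number of fixed points of $\sigma^k$. For a function $f$ that gives a class function on $S_N$ for every $N$, $\mathbb{E}_w[f]$ is the function of $N$ whose value is the average of $f(w(\sigma_1,\ldots,\sigma_r))$ over independent uniformly random $\sigma_1,\ldots,\sigma_r\in S_N$, where $w(\sigma_1,\ldots,\sigma_r)$ is obtained by substituting $\sigma_i$ for the $i$-th generator; $\mathbb{E}_{\mathrm{unif}}[f]$ is the average of $f$ over a uniformly random element of $S_N$. For polynomials $f,g$ in the $\xi_i$'s with rational coefficients, the inner product $\langle f,g\rangle_{S_N}=\frac{1}{N!}\sum_{\sigma\in S_N}f(\sigma)\overline{g(\sigma)}$ is constant for all large enough $N$, and $\langle f,g\rangle$ denotes this constant. An element of a free group is primitive if it belongs to some basis (free generating set). The primitivity rank $\pi(w)$ is the minimal rank of a subgroup $H\le\mathbf{F}$ containing $w$ as a non-primitive element of $H$, and $\pi(w)=\infty$ if there is no such subgroup. $\mathrm{Crit}(w)$ is the (finite) set of subgroups $H\le\mathbf{F}$ with $\mathrm{rk}\,H=\pi(w)$, $w\in H$ and $w$ non-primitive in $H$. Convention: $N^{-\infty}$ is interpreted as $0$ (so error terms vanish for large $N$ when $\pi(w)=\infty$). The implied constants may depend on $w$ and the $\alpha_i$. *)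

(* Defs.v *)
From HB Require Import structures.
From mathcomp Require Import all_boot all_order all_algebra perm.
From mathcomp Require Import all_classical all_reals all_analysis.

Set Implicit Arguments.
Unset Strict Implicit.
Unset Printing Implicit Defensive.

Import Order.TTheory GRing.Theory Num.Theory.
Import numFieldNormedType.Exports.

Local Open Scope classical_set_scope.
Local Open Scope ring_scope.

Section FreeGroup.
Variable I : choiceType.
Implicit Types (l : I * bool) (s t : seq (I * bool)).

(* The letter (i, false) stands for the generator i, (i, true) for its
   inverse. *)
Definition linv l : I * bool := (l.1, ~~ l.2).

Definition noncancel : rel (I * bool) := [rel l m | m != linv l].

Definition reduced s : bool := sorted noncancel s.

Definition lcons l s : seq (I * bool) :=
  if s is m :: s' then if m == linv l then s' else l :: s else [:: l].

Definition lcat s t : seq (I * bool) := foldr lcons t s.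

Definition lrev s : seq (I * bool) := rev (map linv s).

Lemma linvK : involutive linv.
Proof. by case=> i b; rewrite /linv /= negbK. Qed.

Lemma reduced_lcons l s : reduced s -> reduced (lcons l s).
Proof.
case: s => [|m s] //= rs; case: ifPn => [_|ml]; first exact: path_sorted rs.
by rewrite /reduced /= -/(noncancel l m) /noncancel /= ml.
Qed.

Lemma reduced_lcat s t : reduced t -> reduced (lcat s t).
Proof. by move=> rt; elim: s => //= l s; apply: reduced_lcons. Qed.

Lemma lconsK l s : reduced s -> lcons l (lcons (linv l) s) = s.
Proof.
case: s => [|m s] //= rs; first by rewrite eqxx.
rewrite linvK; case: eqP => [eml|_] /=; last by rewrite eqxx.
case: s rs => [|m' s] /=; first by rewrite eml.
by rewrite /reduced /= eml => /andP[/negPf-> _].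
Qed.

Lemma lcat_lcons l s t :
  reduced t -> lcat (lcons l s) t = lcons l (lcat s t).
Proof.
move=> rt; case: s => [|m s] //=; case: eqP => // ->.
by rewrite lconsK // reduced_lcat.
Qed.

Lemma lcatA s t u : reduced u -> lcat s (lcat t u) = lcat (lcat s t) u.
Proof. by move=> ru; elim: s => //= l s ->; rewrite lcat_lcons. Qed.

Lemma lcats0 s : reduced s -> lcat s [::] = s.
Proof.
elim: s => //= l s IHs rs; rewrite IHs; last exact: path_sorted rs.
by case: s rs {IHs} => [|m s] //=; rewrite /reduced /= => /andP[/negPf-> _].
Qed.

Lemma lrevK : involutive lrev.
Proof.
by move=> s; rewrite /lrev map_rev revK -map_comp map_id_in // => l _ /=;
  rewrite linvK.
Qed.

Lemma reduced_lrev s : reduced s -> reduced (lrev s).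
Proof.
rewrite /reduced /lrev rev_sorted sorted_map; apply: sub_sorted => l m /=.
by apply: contra => /eqP ->; rewrite linvK.
Qed.

Lemma lcatNs s : lcat (lrev s) s = [::].
Proof.
rewrite /lcat /lrev; elim: s => //= l s IHs.
by rewrite rev_cons -cats1 foldr_cat /= linvK eqxx.
Qed.

Lemma lcatsN s : lcat s (lrev s) = [::].
Proof. by rewrite -{1}(lrevK s) lcatNs. Qed.

Record freeGroup := FreeGroup { fgword :> seq (I * bool); _ : reduced fgword }.

HB.instance Definition _ := [isSub for fgword].
HB.instance Definition _ := [Choice of freeGroup by <:].

Definition fg1 : freeGroup := FreeGroup (isT : reduced [::]).
Definition fgM (u v : freeGroup) : freeGroup :=
  FreeGroup (reduced_lcat (val u) (valP v)).
Definition fgV (u : freeGroup) : freeGroup :=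
  FreeGroup (reduced_lrev (valP u)).

Lemma fgMA : associative fgM.
Proof. by move=> u v t; apply: val_inj; rewrite /= lcatA // (valP t). Qed.

Lemma fg1M : left_id fg1 fgM.
Proof. by move=> u; apply: val_inj. Qed.

Lemma fgM1 : right_id fg1 fgM.
Proof. by move=> u; apply: val_inj; rewrite /= lcats0 // (valP u). Qed.

Lemma fgVM : left_inverse fg1 fgV fgM.
Proof. by move=> u; apply: val_inj; rewrite /= lcatNs. Qed.

Lemma fgMV : right_inverse fg1 fgV fgM.
Proof. by move=> u; apply: val_inj; rewrite /= lcatsN. Qed.

HB.instance Definition _ := isGroup.Build freeGroup fgMA fg1M fgM1 fgVM fgMV.

End FreeGroup.

(* w(x): substitute x i for the generator i. *)
Definition leval (I : choiceType) (G : groupType) (x : I -> G) (l : I * bool) :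
  G := if l.2 then ((x l.1)^-1)%g else x l.1.

Definition weval (I : choiceType) (G : groupType) (x : I -> G)
  (w : freeGroup I) : G := (\prod_(l <- fgword w) leval x l)%g.

Lemma wevalM (I : choiceType) (G : groupType) (x : I -> G) (u v : freeGroup I) :
  weval x (u * v)%g = (weval x u * weval x v)%g.
Proof.
have levalV l : leval x (linv l) = ((leval x l)^-1)%g.
  by case: l => i [] /=; rewrite /leval //= invgK.
rewrite /weval /=; elim: (fgword u) => [|l s IHs] /=.
  by rewrite big_nil mul1g.
rewrite big_cons -mulgA -IHs; case: (lcat s v) => [|m t] /=.
  by rewrite big_seq1 big_nil mulg1.
by case: eqP => [->|_]; rewrite !big_cons // levalV mulVKg.
Qed.

(* Infimum in the set of natural numbers extended with an infinite element,
   which is encoded as None. *)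
Definition nat_inf (P : set nat) : option nat :=
  match pselect (exists n, `[< P n >]) with
  | left exP => Some (ex_minn exP)
  | right _ => None
  end.

Section Subgroups.
Variable G : groupType.
Implicit Types (H : set G) (w : G).

Definition is_subgroup H : Prop := group_closed [in H].

(* The family x is a free generating set of H: the morphism from the free group
   on J to G that it defines is injective, with image H. *)
Definition is_basis (J : choiceType) (x : J -> G) H : Prop :=
  injective (weval x) /\ range (weval x) = H.

Definition rank H : option nat :=
  nat_inf [set n | exists x : 'I_n -> G, is_basis x H].

Definition primitive_in H w : Prop :=
  exists (J : choiceType) (x : J -> G), is_basis x H /\ range x w.

Definition primitivity_rank w : option nat :=
  nat_inf [set n | exists H,
    [/\ is_subgroup H, rank H = Some n, H w & ~ primitive_in H w]].

Definition Crit w : set (set G) :=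
  [set H | [/\ is_subgroup H, rank H = primitivity_rank w, H w
             & ~ primitive_in H w]].

Definition non_power w : Prop :=
  forall (u : G) (m : nat), (2 <= m)%N -> w <> (u ^+ m)%g.

End Subgroups.

Section Expectations.
Variable R : realType.

(* A function on S_N for every N; all functions are real valued, so that no
   complex conjugation appears in the inner product. *)
Definition permfun := forall N : nat, 'S_N -> R.

Implicit Types f g : permfun.

Definition xi (k : nat) : permfun :=
  fun N s => #|[set i : 'I_N | (s ^+ k)%g i == i]|%:R.

(* a i is the exponent of xi (i + 1), as ordinals start from 0. *)
Definition xi_monomial (k : nat) (a : 'I_k -> nat) : permfun :=
  fun N s => \prod_(i < k) xi i.+1 s ^+ a i.

Definition E_word (r : nat) (w : freeGroup 'I_r) f (N : nat) : R :=
  (\sum_(s : {ffun 'I_r -> 'S_N}) f N (weval s w)) /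
    #|{ffun 'I_r -> 'S_N}|%:R.

Definition E_unif f (N : nat) : R := (\sum_(s : 'S_N) f N s) / (N`!)%:R.

Definition inner_SN f g (N : nat) : R :=
  (N`!)%:R^-1 * \sum_(s : 'S_N) f N s * g N s.

(* The eventual value of inner_SN f g, and 0 if this sequence is not eventually
   constant. *)
Definition inner f g : R :=
  xget 0 [set c | \forall N \near \oo, inner_SN f g N = c].

(* N ^ (- p), which is 0 for p infinite. *)
Definition powN (p : option nat) (N : nat) : R :=
  if p is Some n then N%:R ^- n else 0.

End Expectations.

Arguments xi {R} k [N] s.
Arguments xi_monomial {R k} a [N] s.
Arguments powN {R} p N.

(* Main.v *)
(** A monomial in the xi_k's counts, at a permutation s, the maps phi from a
    finite set X to [N] with phi o tau = s o phi, for a permutation tau of X.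
    After conjugation w is cyclically reduced; X copies of the w-cycle, closed up
    by tau, form a graph, and the average over word values becomes a sum over the
    folded quotients M of this graph of products of falling factorials, of order
    N^chi(M).  Each quotient projects to a folded quotient Q of the single w-cycle,
    hence to a subgroup H(Q) of F containing w, and regrouping by Q (Moebius
    inversion) the average is a sum of contributions R(Q).  If w is primitive in
    H(Q) the average over H(Q) is the uniform one, so R(Q) vanishes for Q not
    discrete and is the uniform average for Q discrete; otherwise R(Q) is
    O(N^(1 - rk H(Q))).  For H(Q) critical the quotients M with chi(M) = chi(Q)
    correspond to the tau-invariant equivalence relations on X plus one fixed
    point identified with some point of X, and their number C is also the inner
    product with xi_1 - 1.  That no other M reaches this order is shown by
    identifying the base points of the copies one at a time: the classes merged by
    such a step are bounded linearly, and when chi does not increase strictly, w being a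
    non-power forces an edge used exactly once, which makes w primitive. *)

Require Import Defs.
From HB Require Import structures.
From mathcomp Require Import all_boot all_order all_algebra fingroup perm.
From mathcomp Require Import zify boolp.

Set Implicit Arguments.
Unset Strict Implicit.
Unset Printing Implicit Defensive.

(** * Quotients of finite types and extensions of partial permutations *)

Section Quotient.
Variables (T : finType) (R : rel T).

(** Merging base points [x] and [s] forces a periodic sequence of identifications, one for each
    letter read. They are treated as vectors, modulo the chains that vanish in the quotient; $\chi$
    is then a difference of dimensions, and the moments at which the vectors become dependent among
    vertices and among edges bound its change. If $\chi$ is unchanged, a dependence shorter than the
    period of [x] propagates along the word until its support consists of periods of the word; for a
    non-power these are whole readings, which the minimality of the period of [x] excludes. The
    vectors are therefore independent, and a count of dimensions yields the edge used once. Ranks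
    and freeness come from counting too: labellings of the edges of a folded graph by a finite group
    are determined by their values on generating loops and on tree paths; comparing cardinals bounds
    the number of generators, and equality gives freeness and uniform values. The inversion over $Q$
    works because the falling factorials depend on $Q$ only through the pairs of points it
    identifies, and each pair gains a factor $1/N$ in the expansion. *)

Definition cls (x : T) : {set T} := [set y | R x y].
Definition quo := {A : {set T} | A \in cls @: [set: T]}.
HB.instance Definition _ := Finite.on quo.
Definition pi (x : T) : quo := Sub (cls x) (imset_f cls (in_setT x)).

Lemma pi_surj (q : quo) : exists x, q == pi x.
Proof.
by case: q => A; move=> /[dup] /imsetP[x _ eA] AP; exists x; apply/eqP/val_inj.
Qed.

Definition qrep (q : quo) : T := xchoose (pi_surj q).

Lemma qrepK q : pi (qrep q) = q.
Proof. by rewrite /qrep -(eqP (xchooseP (pi_surj q))). Qed.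

Hypothesis eqR : equivalence_rel R.

Lemma eqr_refl x : R x x. Proof. by case: (eqR x x x). Qed.
Lemma eqr_sym x y : R x y = R y x.
Proof.
apply/idP/idP => Rxy; first by rewrite -(eqR x y x).2 // eqr_refl.
by rewrite -(eqR y x y).2 // eqr_refl.
Qed.
Lemma eqr_trans y x z : R x y -> R y z -> R x z.
Proof. by move=> Rxy; rewrite (eqR x y z).2. Qed.

Lemma piE x y : (pi x == pi y) = R x y.
Proof.
apply/eqP/idP => [/(congr1 val) /setP /(_ y)|Rxy].
  by rewrite !inE eqr_refl.
by apply: val_inj; apply/setP => z; rewrite !inE (eqR x y z).2.
Qed.

Lemma qrepP x : R x (qrep (pi x)).
Proof. by rewrite -piE qrepK. Qed.

End Quotient.

Lemma equivalence_relT (T : finType) (R : rel T) :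
  reflexive R -> symmetric R -> transitive R -> equivalence_rel R.
Proof.
move=> rR sR tR x y z; split=> // Rxy.
by apply/idP/idP; [apply: tR; rewrite sR | apply: tR].
Qed.

Section ExtendPerm.
Variable T : finType.
Implicit Types (D : {set T}) (f : T -> T).

Lemma extend_perm D f : {in D &, injective f} ->
  exists p : {perm T}, {in D, p =1 f}.
Proof.
elim: {D}#|D| {-2}D (erefl #|D|) => [|n IHn] D cD fi.
  by exists 1%g => x; rewrite (cards0_eq cD) inE.
have /card_gt0P[x xD] : 0 < #|D| by rewrite cD.
have [||p pE] := IHn (D :\ x).
- by move: cD; rewrite (cardsD1 x) xD => -[].
- by move=> y z /setD1P[_ yD] /setD1P[_ zD]; apply: fi.
exists (p * tperm (p x) (f x))%g => y yD; rewrite permM.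
have [->|yx] := eqVneq y x; first by rewrite tpermL.
have py : p y = f y by apply: pE; rewrite !inE yx.
rewrite tpermD ?py // -?py; last by rewrite py; apply: contra yx => /eqP/fi->.
by apply: contra yx => /eqP/perm_inj->.
Qed.

(** Translation by one extension [p] identifies the extensions with the permutations supported
    outside [D]. *)
Lemma card_extend_perm D f : {in D &, injective f} ->
  #|[set p : {perm T} | [forall x in D, p x == f x]]| = (#|T| - #|D|)`!.
Proof.
move=> fi; have [p pE] := extend_perm fi.
have -> : #|T| - #|D| = #|~: D| by rewrite -(cardsC D) addKn.
rewrite -card_perm -[RHS](card_imset _ (mulIg p)).
apply: eq_card => q; rewrite inE; apply/forall_inP/imsetP => [qE|[s sP ->] x xD].
  exists (q * p^-1)%g; last by rewrite mulgKV.
  rewrite unfold_in; apply/subsetP => x; rewrite !inE permM => qx.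
  by apply: contra qx => xD; rewrite (eqP (qE _ xD)) -pE // permK.
have sx : s x = x by apply: (out_perm sP); rewrite inE xD.
by rewrite permM sx pE.
Qed.

End ExtendPerm.
(** * Generation and holonomy of labelled graphs *)

Section Generation.
Variable G : groupType.
Local Open Scope group_scope.
Implicit Types (P Q H : G -> Prop) (g h : G).

Inductive gen P : G -> Prop :=
| gen1 : gen P 1
| genM g h : P g -> gen P h -> gen P (g * h)
| genVM g h : P g -> gen P h -> gen P (g^-1 * h).

Definition subgrp H :=
  [/\ H 1, forall g h, H g -> H h -> H (g * h) & forall g, H g -> H g^-1].

Lemma gen_mul P g h : gen P g -> gen P h -> gen P (g * h).
Proof.
by move=> Pg Ph; elim: Pg => [|x y Px _ IH|x y Px _ IH];
  rewrite ?mul1g // -mulgA; [apply: genM | apply: genVM].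
Qed.

Lemma gen_in P g : P g -> gen P g.
Proof. by move=> Pg; rewrite -(mulg1 g); apply: genM => //; apply: gen1. Qed.

Lemma gen_inv P g : gen P g -> gen P g^-1.
Proof.
elim=> [|x y Px _ IH|x y Px _ IH]; first by rewrite invg1; apply: gen1.
  rewrite invMg; apply: gen_mul => //; rewrite -(mulg1 x^-1).
  by apply: genVM => //; apply: gen1.
by rewrite invMg invgK; apply: gen_mul => //; apply: gen_in.
Qed.

Lemma gen_subgrp P : subgrp (gen P).
Proof. by split; [apply: gen1 | apply: gen_mul | apply: gen_inv]. Qed.

Lemma gen_min P H : subgrp H -> (forall g, P g -> H g) ->
  forall g, gen P g -> H g.
Proof.
move=> [H1 HM HV] PH g; elim=> // x y Px _ Hy; apply: HM => //.
  exact: PH.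
by apply: HV; apply: PH.
Qed.

Lemma gen_sub P Q : (forall g, P g -> gen Q g) -> forall g, gen P g -> gen Q g.
Proof. by move=> PQ; apply: gen_min => //; apply: gen_subgrp. Qed.

Definition gens (s : seq G) : G -> Prop := gen (fun g => g \in s).

Lemma gens_cat s t g : gens (s ++ t) g <-> gen (fun h => gens s h \/ gens t h) g.
Proof.
split; apply: gen_sub => h.
  rewrite mem_cat => /orP[hs|ht]; apply: gen_in; [left|right]; exact: gen_in.
by case; apply: gen_sub => {}h hs; apply: gen_in; rewrite mem_cat hs ?orbT.
Qed.

Lemma gens_sub s t : (forall g, g \in s -> gens t g) ->
  forall g, gens s g -> gens t g.
Proof. exact: gen_sub. Qed.

End Generation.

Lemma gens_morph (G G' : groupType) (f : G -> G') (s : seq G) :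
  f 1%g = 1%g -> {morph f : x y / (x * y)%g} ->
  forall h, gens [seq f g | g <- s] h <-> exists2 g, gens s g & h = f g.
Proof.
move=> f1 fM.
have fV g : f g^-1%g = (f g)^-1%g.
  by apply: (mulgI (f g)); rewrite -fM !mulgV.
move=> h; split.
  elim=> [|x y /mapP[g gs ->] _ [g' gs' ->]|x y /mapP[g gs ->] _ [g' gs' ->]].
  - by exists 1%g => //; apply: gen1.
  - by exists (g * g')%g; rewrite ?fM //; apply: genM.
  - by exists (g^-1 * g')%g; rewrite ?fM ?fV //; apply: genVM.
case=> g gg ->; elim: gg => [|x y xs _ IH|x y xs _ IH]; rewrite ?f1 ?fM ?fV.
- exact: gen1.
- by apply: genM => //; apply: map_f.
- by apply: genVM => //; apply: map_f.
Qed.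

Section Graph.
Variables (G : groupType) (V E : finType) (org tgt : E -> V) (lab : E -> G).
Local Open Scope group_scope.
Implicit Types (Es T : {set E}) (A B : {set V}) (u v : V) (phi : V -> G).

Inductive walk Es u : V -> G -> Prop :=
| walk0 : walk Es u u 1
| walkF e g : e \in Es -> walk Es u (org e) g -> walk Es u (tgt e) (g * lab e)
| walkB e g : e \in Es -> walk Es u (tgt e) g ->
    walk Es u (org e) (g * (lab e)^-1).

Lemma walk_trans Es u v v' g h :
  walk Es u v g -> walk Es v v' h -> walk Es u v' (g * h).
Proof.
move=> uv; elim=> [|e x eE _ IH|e x eE _ IH]; first by rewrite mulg1.
  by rewrite mulgA; apply: walkF.
by rewrite mulgA; apply: walkB.
Qed.

Lemma walk_sym Es u v g : walk Es u v g -> walk Es v u g^-1.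
Proof.
elim=> [|e x eE _ IH|e x eE _ IH]; first by rewrite invg1; apply: walk0.
  rewrite invMg; apply: walk_trans IH; rewrite -(mul1g (lab e)^-1).
  by apply: walkB => //; apply: walk0.
rewrite invMg invgK; apply: walk_trans IH; rewrite -(mul1g (lab e)).
by apply: walkF => //; apply: walk0.
Qed.

Lemma walk_sub Es Es' u v g : Es \subset Es' -> walk Es u v g -> walk Es' u v g.
Proof.
move=> /subsetP sE; elim=> [|e x eE _ IH|e x eE _ IH]; first exact: walk0.
  by apply: walkF => //; apply: sE.
by apply: walkB => //; apply: sE.
Qed.

Lemma walk_subgrp Es u : subgrp (walk Es u u).
Proof.
split; [exact: walk0 | move=> g h; exact: walk_trans | move=> g; exact: walk_sym].
Qed.

Lemma walk_cross Es A u v g : walk Es u v g -> u \in A -> v \notin A ->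
  exists2 e, e \in Es & (org e \in A) != (tgt e \in A).
Proof.
move=> uv uA; elim: uv => [|e x eE _ IH vA|e x eE _ IH vA]; first by rewrite uA.
  have [oA|/IH//] := boolP (org e \in A).
  by exists e; rewrite // oA (negPf vA).
have [oA|/IH//] := boolP (tgt e \in A).
by exists e; rewrite // oA (negPf vA).
Qed.

(* The potential [phi] is prescribed on [A0]. *)
Definition tree_spec Es A0 B u phi0 := exists phi T,
  [/\ {in A0, phi =1 phi0}, forall v, v \in B -> walk Es u v (phi v),
    T \subset Es, #|T| + #|A0| = #|B| & forall e, e \in T ->
    phi (org e) * lab e = phi (tgt e) /\ ~~ ((org e \in A0) && (tgt e \in A0))].

(** The tree grows from [A0] one vertex at a time: a walk from [u] to a vertex outside the current
    set crosses its boundary along some edge, and the potential is forced at the new end of that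
    edge. *)
Lemma spanning_tree Es A0 B u phi0 :
  u \in A0 -> (forall v, v \in A0 -> walk Es u v (phi0 v)) ->
  (forall v, reflect (exists g, walk Es u v g) (v \in B)) ->
  tree_spec Es A0 B u phi0.
Proof.
move=> uA0 w0 BP; have A0B : A0 \subset B.
  by apply/subsetP => v vA0; apply/BP; exists (phi0 v); apply: w0.
suff grow n A phi T : #|B| - #|A| = n -> A0 \subset A -> A \subset B ->
    {in A0, phi =1 phi0} -> (forall v, v \in A -> walk Es u v (phi v)) ->
    T \subset Es -> #|T| + #|A0| = #|A| ->
    (forall e, e \in T -> phi (org e) * lab e = phi (tgt e)) ->
    (forall e, e \in T -> (org e \in A) && (tgt e \in A)) ->
    (forall e, e \in T -> ~~ ((org e \in A0) && (tgt e \in A0))) ->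
    tree_spec Es A0 B u phi0.
  apply: (grow _ A0 phi0 set0 erefl); rewrite ?sub0set ?cards0 //;
    by move=> e; rewrite inE.
elim: n A phi T => [|n IHn] A phi T.
  move=> /eqP; rewrite subn_eq0 => BA A0A AB p0 wA TE cT pT TA T0.
  have eAB : A = B by apply/eqP; rewrite eqEcard AB.
  by exists phi, T; split=> // [v||e eT]; rewrite -?eAB //; [apply: wA | split; [apply: pT | apply: T0]].
move=> cA A0A AB p0 wA TE cT pT TA T0.
have /subsetPn[v vB vA] : ~~ (B \subset A).
  by apply: contraPN cA => /subset_leq_card; clear; lia.
have [g uv] := BP _ vB.
have [e eE] := walk_cross uv (subsetP A0A _ uA0) vA.
(* Common to both orientations of the crossing edge [e]: [x] is its new end and [y] the potential
   there. *)
have addv x y : x \notin A -> walk Es u x y -> T :|: [set e] \subset Es ->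
    e \notin T -> (org e \in x |: A) && (tgt e \in x |: A) ->
    (org e == x) || (tgt e == x) ->
    (let phi' z := if z == x then y else phi z in
     phi' (org e) * lab e = phi' (tgt e)) ->
    tree_spec Es A0 B u phi0.
  move=> xA ux sE eT eA ex pe.
  have nA z : z \in A -> z == x = false.
    by move=> zA; apply: contraNF xA => /eqP<-.
  apply: (IHn (x |: A) (fun z => if z == x then y else phi z) (e |: T)).
  - by rewrite cardsU1 xA; move: cA; clear; lia.
  - by apply: subset_trans A0A _; apply: subsetUr.
  - by rewrite subUset AB sub1set andbT; apply/BP; exists y.
  - by move=> z zA0; rewrite nA ?p0 //; apply: (subsetP A0A).
  - move=> z /setU1P[->|zA]; first by rewrite eqxx.
    by rewrite nA //; apply: wA.
  - by rewrite setUC.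
  - by rewrite !cardsU1 xA eT; move: cT; clear; lia.
  - move=> f /setU1P[->//|fT]; have /andP[fo ft] := TA _ fT.
    by rewrite !nA // pT.
  - move=> f /setU1P[->//|/TA/andP[fo ft]]; by rewrite !inE fo ft !orbT.
  - move=> f /setU1P[->|/T0//]; apply: contra xA => /andP[fo ft].
    by case/orP: ex => /eqP<-; apply: (subsetP A0A).
have eT : (org e \in A) != (tgt e \in A) -> e \notin T.
  by apply: contra => /TA/andP[-> ->].
move=> /[dup] ne /eT eT'.
have sE : T :|: [set e] \subset Es by rewrite subUset TE sub1set.
have [oA|oA] := boolP (org e \in A); rewrite ?oA ?(negPf oA) /= in ne.
  have tA : tgt e \notin A by case: (tgt e \in A) ne.
  apply: (addv (tgt e) (phi (org e) * lab e)); rewrite ?eqxx ?orbT ?inE ?oA ?eqxx ?orbT //.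
    by apply: walkF => //; apply: wA.
  by rewrite /= eqxx; case: eqP => // eot; rewrite -eot oA in tA.
have tA : tgt e \in A by case: (tgt e \in A) ne.
apply: (addv (org e) (phi (tgt e) * (lab e)^-1)); rewrite ?eqxx ?inE ?tA ?eqxx ?orbT //.
  by apply: walkB => //; apply: wA.
by rewrite /= eqxx mulgKV; case: eqP => // eot; rewrite -eot tA in oA.
Qed.

Definition chord phi e := phi (org e) * lab e * (phi (tgt e))^-1.

(** The label of a walk telescopes into chords, and the chords of the edges in [T] are trivial. *)
Lemma walk_chords Es T u phi : phi u = 1 ->
  (forall e, e \in T -> phi (org e) * lab e = phi (tgt e)) ->
  forall v g, walk Es u v g ->
    gens [seq chord phi e | e <- enum (Es :\: T)] (g * (phi v)^-1).
Proof.
move=> pu pT v g.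
have chE e : e \in Es -> gens [seq chord phi e | e <- enum (Es :\: T)] (chord phi e).
  move=> eE; have [eT|eT] := boolP (e \in T).
    by rewrite /chord pT // mulgV; apply: gen1.
  by apply: gen_in; apply: map_f; rewrite mem_enum inE eT.
elim=> [|e x eE _ IH|e x eE _ IH]; first by rewrite pu invg1 mulg1; apply: gen1.
  have -> : x * lab e * (phi (tgt e))^-1 =
      x * (phi (org e))^-1 * chord phi e by rewrite /chord !mulgA mulgKV.
  by apply: gen_mul => //; apply: chE.
have -> : x * (lab e)^-1 * (phi (org e))^-1 =
    x * (phi (tgt e))^-1 * (chord phi e)^-1.
  by rewrite /chord !invMg invgK !mulgA mulgKV.
by apply: gen_mul => //; apply: gen_inv; apply: chE.
Qed.

Lemma walk_chord Es B u phi e : (forall v, v \in B -> walk Es u v (phi v)) ->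
  org e \in B -> tgt e \in B -> e \in Es -> walk Es u u (chord phi e).
Proof.
move=> wB oB tB eE; apply: (@walk_trans _ _ (tgt e)).
  by apply: walkF => //; apply: wB.
by apply: walk_sym; apply: wB.
Qed.

(** A spanning tree of the subgraph [E0] is extended to one of the whole graph, so that generators
    of the small group are part of those of the large one. This later splits off the part of a
    Stallings graph covered by a path. *)
Lemma walk_gens_rel (E0 Es : {set E}) B0 u : E0 \subset Es ->
  (forall v, reflect (exists g, walk E0 u v g) (v \in B0)) ->
  (forall e, e \in E0 -> (org e \in B0) && (tgt e \in B0)) ->
  (forall v, exists g, walk Es u v g) ->
  exists y0 y1, [/\ size y0 + #|B0| = #|E0|.+1,
    size y1 + #|V| + #|E0| = #|Es| + #|B0|,
    forall g, walk E0 u u g <-> gens y0 g &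
    forall g, walk Es u u g <-> gens (y0 ++ y1) g].
Proof.
move=> sE B0P E0B conn.
have uB0 : u \in B0 by apply/B0P; exists 1; apply: walk0.
have [|phi0 [T0 [p0 w0 T0E cT0 pT0]]] :=
  @spanning_tree E0 [set u] B0 u (fun=> 1) (set11 u) _ B0P.
  by move=> v /set1P->; apply: walk0.
have pu0 : phi0 u = 1 by rewrite p0 ?set11.
have connT v : reflect (exists g, walk Es u v g) (v \in setT).
  by rewrite inE; apply: ReflectT.
have [|phi [T [p1 w1 TE cT pT]]] := @spanning_tree Es B0 setT u phi0 uB0 _ connT.
  by move=> v /w0; apply: walk_sub.
have pu : phi u = 1 by rewrite p1.
pose y0 := [seq chord phi0 e | e <- enum (E0 :\: T0)].
pose y1 := [seq chord phi e | e <- enum (Es :\: (E0 :|: T))].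
have TE0 : [disjoint T & E0].
  rewrite disjoint_subset; apply/subsetP => e /pT[_].
  by apply: contra => /E0B.
exists y0, y1; split.
- rewrite size_map -cardE; move: cT0; rewrite cards1.
  have := cardsID T0 E0; rewrite (setIidPr T0E); clear; lia.
- rewrite size_map -cardE; move: cT; rewrite cardsT.
  have := cardsID (E0 :|: T) Es; rewrite (setIidPr _) ?subUset ?sE //.
  by have := (leq_card_setU E0 T).2; rewrite disjoint_sym TE0 => /eqP->; clear; lia.
- have pT' e : e \in T0 -> phi0 (org e) * lab e = phi0 (tgt e) by case/pT0.
  move=> g; split=> [wg|]; first by have := walk_chords pu0 pT' wg; rewrite pu0 invg1 mulg1.
  apply: gen_min => [|{}g /mapP[e]]; first exact: walk_subgrp.
  rewrite mem_enum inE => /andP[_ eE] ->; have /andP[eo et] := E0B _ eE.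
  exact: walk_chord w0 _ _ _.
have pT' e : e \in T0 :|: T -> phi (org e) * lab e = phi (tgt e).
  case/setUP => [eT0|/pT[]//]; have /andP[eo et] := E0B _ (subsetP T0E _ eT0).
  by rewrite !p1 //; case: (pT0 _ eT0).
move=> g; split=> [wg|].
  have := walk_chords pu pT' wg; rewrite pu invg1 mulg1.
  apply: gens_sub => {wg}g /mapP[e]; rewrite mem_enum !inE negb_or.
  move=> /andP[/andP[eT0 eT] eE] ->; apply: gen_in; rewrite mem_cat.
  have [eE0|eE0] := boolP (e \in E0); apply/orP; [left | right].
    have /andP[eo et] := E0B _ eE0; apply/mapP; exists e.
      by rewrite mem_enum inE eT0.
    by rewrite /chord !p1.
  by apply: map_f; rewrite mem_enum !inE negb_or eE0 eT.
apply: gen_min => [|{}g]; first exact: walk_subgrp.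
rewrite mem_cat => /orP[] /mapP[e]; rewrite mem_enum !inE.
  move=> /andP[_ eE] ->; have /andP[eo et] := E0B _ eE.
  by apply: walk_sub sE _; apply: walk_chord w0 _ _ _.
by move=> /andP[_ eE] ->; apply: walk_chord w1 _ _ _; rewrite ?inE.
Qed.

Lemma walk_gens Es u : (forall v, exists g, walk Es u v g) ->
  exists y, size y + #|V| = #|Es|.+1 /\ forall g, walk Es u u g <-> gens y g.
Proof.
move=> conn; have [v|e|y0 [y1 [s0 s1 w0 w1]]] :=
    @walk_gens_rel set0 Es [set u] u (sub0set _) _ _ conn.
- apply: (iffP set1P) => [->|[g]]; first by exists 1; apply: walk0.
  by elim=> // e x; rewrite in_set0.
- by rewrite in_set0.
exists (y0 ++ y1); split=> //; move: s0 s1; rewrite size_cat !cards0 !cards1.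
by clear; lia.
Qed.

Lemma walk_potential Es u : (forall v, exists g, walk Es u v g) ->
  exists2 phi, phi u = 1 & forall v, walk Es u v (phi v).
Proof.
move=> conn.
have connT v : reflect (exists g, walk Es u v g) (v \in setT).
  by rewrite inE; apply: ReflectT.
have [|phi [T [p1 w1 TE cT pT]]] :=
    @spanning_tree Es [set u] setT u (fun=> 1) (set11 u) _ connT.
  by move=> v /set1P->; apply: walk0.
by exists phi; [rewrite p1 ?set11 | move=> v; apply: w1; rewrite inE].
Qed.

End Graph.

(** * Words and evaluation in free groups *)

Section FreeGroupTheory.
Variable I : choiceType.
Implicit Types (l : I * bool) (u v w : freeGroup I).

Definition fgl l : freeGroup I := @FreeGroup I [:: l] isT.

Section Weval.
Variables (G : groupType) (x : I -> G).
Local Open Scope group_scope.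

Lemma weval1 : weval x 1 = 1.
Proof. by rewrite /weval big_nil. Qed.

Lemma wevalV u : weval x u^-1 = (weval x u)^-1.
Proof. by apply: (mulgI (weval x u)); rewrite -wevalM !mulgV weval1. Qed.

Lemma weval_fgl l : weval x (fgl l) = leval x l.
Proof. by rewrite /weval big_seq1. Qed.

End Weval.

Local Open Scope group_scope.

Lemma fgl_linv l : fgl (linv l) = (fgl l)^-1.
Proof. exact: val_inj. Qed.

Lemma fgword_inj u v : fgword u = fgword v -> u = v.
Proof. exact: val_inj. Qed.

Lemma fg_prod u : u = \prod_(l <- fgword u) fgl l.
Proof.
case: u => s rs; rewrite /=; elim: s rs => [|l s IHs] rs.
  by rewrite big_nil; apply: fgword_inj.
have rs' : reduced s by apply: path_sorted rs.
rewrite big_cons -(IHs rs'); apply: fgword_inj => /=.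
by case: s rs {IHs rs'} => [|m s] //= /andP[/negPf-> _].
Qed.

Lemma reduced_nth s l0 j : reduced s -> j.+1 < size s ->
  nth l0 s j.+1 != linv (nth l0 s j).
Proof. by move=> /(sortedP l0)/(_ j); apply. Qed.

End FreeGroupTheory.

Lemma gens_weval (k : nat) (G : groupType) (x : 'I_k -> G) (g : G) :
  gens (codom x) g <-> exists u : freeGroup 'I_k, g = weval x u.
Proof.
split.
  elim=> [|h h' /codomP[i ->] _ [u ->]|h h' /codomP[i ->] _ [u ->]].
  - by exists 1%g; rewrite weval1.
  - by exists (fgl (i, false) * u)%g; rewrite wevalM weval_fgl.
  - by exists (fgl (i, true) * u)%g; rewrite wevalM weval_fgl.
case=> u ->; rewrite /weval; elim: (fgword u) => [|[i b] s IHs].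
  by rewrite big_nil; apply: gen1.
rewrite big_cons; apply: gen_mul IHs; have : gens (codom x) (x i).
  by apply: gen_in; apply: codom_f.
by case: b => //; rewrite /leval /=; apply: gen_inv.
Qed.

Lemma weval_weval (I J : choiceType) (G : groupType) (x : I -> G)
    (y : J -> freeGroup I) (u : freeGroup J) :
  weval x (weval y u) = weval (fun j => weval x (y j)) u.
Proof.
rewrite /(weval y) /(weval _ u); elim: (fgword u) => [|l s IHs].
  by rewrite !big_nil weval1.
rewrite !big_cons wevalM IHs; congr (_ * _)%g.
by case: l => i []; rewrite /leval //= wevalV.
Qed.

(** * Holonomy of labellings of a folded graph by a finite group *)

Section Holonomy.
Variables (I : choiceType) (V E : finType) (org tgt : E -> V) (gn : E -> I).
Hypothesis fold_org : injective (fun e => (gn e, org e)).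
Hypothesis fold_tgt : injective (fun e => (gn e, tgt e)).
Local Open Scope group_scope.
Implicit Types (g h : freeGroup I).
Let lab e := fgl (gn e, false).
Local Notation walk := (walk org tgt lab setT).

Section Action.
Variable S : finGroupType.
Implicit Types (a : {ffun E -> S}).

(** In a folded graph the edges with generator [b] form a partial injection of [V]. Twisted by [a]
    in the second coordinate it remains one, and is completed to a permutation. *)
Lemma skew_perm a b : exists p : {perm V * S},
  [forall e, (gn e == b) ==> [forall s, p (org e, s) == (tgt e, s * a e)]].
Proof.
pose f (q : V * S) := if [pick e | (gn e == b) && (org e == q.1)] is Some e
  then (tgt e, q.2 * a e) else q.
pose D := [set q : V * S | [exists e, (gn e == b) && (org e == q.1)]].
have fE e s : gn e = b -> f (org e, s) = (tgt e, s * a e).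
  move=> eb; rewrite /f; case: pickP => [e' /andP[/eqP eb' /eqP eo]|/(_ e)].
    by have -> : e' = e by apply: fold_org; rewrite /= eb eb' eo.
  by rewrite eb !eqxx.
have [|p pE] := @extend_perm _ D f.
  move=> [q s] [q' s']; rewrite !inE.
  move=> /existsP[e /andP[/eqP eb /eqP /= <-]].
  move=> /existsP[e' /andP[/eqP eb' /eqP /= <-]]; rewrite !fE // => -[tt].
  have <- : e = e' by apply: fold_tgt; rewrite /= eb eb' tt.
  by move/mulIg->.
exists p; apply/forallP => e; apply/implyP => /eqP eb; apply/forallP => s.
rewrite pE ?fE // inE; apply/existsP; exists e; by rewrite eb !eqxx.
Qed.

Definition skew a b := xchoose (skew_perm a b).

Lemma skewE a e s : skew a (gn e) (org e, s) = (tgt e, s * a e).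
Proof.
have /forallP/(_ e) := xchooseP (skew_perm a (gn e)).
by rewrite eqxx => /forallP/(_ s)/eqP.
Qed.

Lemma skewVE a e s : (skew a (gn e))^-1 (tgt e, s) = (org e, s * (a e)^-1).
Proof. by rewrite -{1}(mulgKV (a e) s) -skewE permK. Qed.

Variable u : V.

Definition hol a g := (weval (skew a) g (u, 1)).2.

Lemma weval_skew a v g : walk u v g ->
  forall s, weval (skew a) g (u, s) = (v, s * hol a g).
Proof.
move=> wg; suff [h hE] : exists h : S, forall s, weval (skew a) g (u, s) = (v, s * h).
  by move=> s; rewrite /hol !hE mul1g.
elim: wg => [|e x _ _ [h hE]|e x _ _ [h hE]].
- by exists 1 => s; rewrite weval1 perm1 mulg1.
- by exists (h * a e) => s; rewrite wevalM weval_fgl permM hE skewE mulgA.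
exists (h * (a e)^-1) => s.
by rewrite wevalM -fgl_linv weval_fgl permM hE skewVE mulgA.
Qed.

Lemma hol_walkF a e g : walk u (org e) g -> hol a (g * lab e) = hol a g * a e.
Proof.
by move=> wg; rewrite /hol wevalM weval_fgl permM (weval_skew a wg) mul1g skewE.
Qed.

Lemma hol_walkB a e g : walk u (tgt e) g ->
  hol a (g * (lab e)^-1) = hol a g * (a e)^-1.
Proof.
move=> wg.
by rewrite /hol wevalM -fgl_linv weval_fgl permM (weval_skew a wg) mul1g skewVE.
Qed.

Lemma holM a g h v : walk u u g -> walk u v h -> hol a (g * h) = hol a g * hol a h.
Proof.
move=> wg wh; rewrite {1}/hol wevalM permM (weval_skew a wg) (weval_skew a wh).
by rewrite mul1g.
Qed.

Lemma hol1 a : hol a 1 = 1. Proof. by rewrite /hol weval1 perm1. Qed.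

Lemma holV a g : walk u u g -> hol a g^-1 = (hol a g)^-1.
Proof.
move=> wg; apply: (mulgI (hol a g)).
by rewrite -(holM _ wg (walk_sym wg)) !mulgV hol1.
Qed.

Variables (k : nat) (y : 'I_k -> freeGroup I).
Hypothesis yP : forall g, walk u u g <-> gens (codom y) g.

Let wy i : walk u u (y i).
Proof. by apply/yP; apply: gen_in; apply: codom_f. Qed.

Lemma hol_weval a z : hol a (weval y z) = weval (fun i => hol a (y i)) z.
Proof.
rewrite /(weval y) /(weval _ z).
elim: (fgword z) => [|l s IHs]; first by rewrite !big_nil hol1.
rewrite !big_cons; have wl : walk u u (leval y l).
  by case: l => i []; rewrite /leval //=; apply: walk_sym.
rewrite (holM _ wl (v := u)) ?IHs; first by case: l {wl} => i [] //; rewrite /leval /= holV.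
apply/yP; elim: {IHs}s => [|{wl}l s IHs]; first by rewrite big_nil; apply: gen1.
by rewrite big_cons; apply: gen_mul => //; apply/yP; case: l => i [];
   rewrite /leval //=; apply: walk_sym.
Qed.

(** The path to the origin of an edge followed by this edge is a loop followed by the path to its
    target, so the value of [a] on the edge is recovered from its values on loops and on paths. *)
Lemma hol_ext a a' phi : (forall v, walk u v (phi v)) ->
  (forall i, hol a (y i) = hol a' (y i)) ->
  (forall v, hol a (phi v) = hol a' (phi v)) -> a = a'.
Proof.
move=> wphi ey ephi; apply/ffunP => e.
have eH g : walk u u g -> hol a g = hol a' g.
  move=> /yP /gens_weval[z ->]; rewrite !hol_weval /weval.
  by apply: eq_bigr => -[i []] _; rewrite /leval /= ey.
apply: (mulgI (hol a (phi (org e)))); rewrite -hol_walkF // ephi -hol_walkF //.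
have wc : walk u u (phi (org e) * lab e * (phi (tgt e))^-1).
  apply: walk_trans (walk_sym (wphi _)); apply: walkF => //; exact: in_setT.
rewrite -(mulgKV (phi (tgt e)) (phi (org e) * lab e)).
by rewrite !(holM _ wc (wphi _)) ephi eH.
Qed.

Hypothesis conn : forall v, exists g, walk u v g.

Let phi := s2val (cid2 (walk_potential conn)).
Let phi_u : phi u = 1. Proof. exact: (s2valP (cid2 (walk_potential conn))). Qed.
Let wphi v : walk u v (phi v).
Proof. exact: (s2valP' (cid2 (walk_potential conn))). Qed.

(** Values on the loop generators and on the paths to the other vertices. Bounds on ranks, freeness
    and uniformity all follow from the injectivity of this map between finite sets. *)
Definition holmap (a : {ffun E -> S}) :
    {ffun 'I_k -> S} * {ffun {v | v != u} -> S} :=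
  ([ffun i => hol a (y i)], [ffun v => hol a (phi (val v))]).

Lemma holmap_inj : injective holmap.
Proof.
move=> a a' [/ffunP ey /ffunP ephi]; apply: (hol_ext wphi).
  by move=> i; have := ey i; rewrite !ffunE.
move=> v; have [->|vu] := eqVneq v u; first by rewrite phi_u !hol1.
by have := ephi (Sub v vu); rewrite !ffunE.
Qed.

Lemma card_conn : #|S| ^ #|E| <= #|S| ^ (k + #|V|.-1).
Proof.
have := leq_card _ holmap_inj; rewrite card_prod !card_ffun card_ord card_sig.
by rewrite cardC1 expnD.
Qed.

Lemma holmap_bij : k + #|V| = #|E|.+1 -> bijective holmap.
Proof.
move=> kE; apply: inj_card_bij; first exact: holmap_inj.
rewrite card_prod !card_ffun card_ord card_sig cardC1 -expnD.
have V0 : 0 < #|V| by apply/card_gt0P; exists u.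
by rewrite (_ : k + #|V|.-1 = #|E|) //; move: kE V0; clear; lia.
Qed.

End Action.
End Holonomy.

(** The reduced word is laid out as a path. Reducedness makes this graph folded, so each generator
    acts by a permutation of the vertices, and [z] carries the first vertex to the last. *)
Lemma residually_finite (I : choiceType) (z : freeGroup I) : z <> 1%g ->
  exists (S : finGroupType) (t : I -> S), weval t z <> 1%g.
Proof.
move=> z1; case: (posnP (size (fgword z))) => [/size0nil z0|sz].
  by case: z1; apply: fgword_inj.
pose n := size (fgword z); have [l0 _] : exists l0 : I * bool, true.
  by move: sz; case: (fgword z) => // l s _; exists l.
pose c (j : 'I_n) := nth l0 (fgword z) j.
pose org (j : 'I_n) : 'I_n.+1 := inord (if (c j).2 then j.+1 else j).
pose tgt (j : 'I_n) : 'I_n.+1 := inord (if (c j).2 then nat_of_ord j else j.+1).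
pose gn (j : 'I_n) := (c j).1.
have nc (j j' : 'I_n) : j' = j.+1 :> nat -> c j' <> linv (c j).
  move=> jj; have := reduced_nth l0 (valP z) (j := j); rewrite -jj.
  by move=> /(_ (ltn_ord j'))/eqP.
have inj_aux (f : 'I_n -> bool) : (forall j, f j = (c j).2) \/
    (forall j, f j = ~~ (c j).2) ->
    injective (fun j => (gn j, inord (if f j then j.+1 else j) : 'I_n.+1)).
  move=> fE j j' [gj /(congr1 val)]; rewrite /= !inordK; last 2 first.
  - by case: (f j'); rewrite ltnS ?ltn_ord // ltnW.
  - by case: (f j); rewrite ltnS ?ltn_ord // ltnW.
  have cE : (c j).2 != (c j').2 -> c j' = linv (c j) /\ c j = linv (c j').
    by move: gj; rewrite /gn /linv; case: (c j) (c j') => [i []] [i' []] //= ->.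
  have {}cE : f j != f j' -> c j' = linv (c j) /\ c j = linv (c j').
    by move=> ff; apply: cE; case: fE ff => fE; rewrite !fE //; case: (c j).2 (c j').2 => [] [].
  have [fj|fj] := boolP (f j); have [fj'|fj'] := boolP (f j') => ejj.
  - by apply: val_inj; case: ejj.
  - by case: (nc j j'); [rewrite ejj | case: cE; rewrite // fj (negPf fj')].
  - by case: (nc j' j); [rewrite ejj | case: cE; rewrite // (negPf fj) fj'].
  - exact: val_inj.
have fo : injective (fun j => (gn j, org j)).
  by apply: (inj_aux (fun j => (c j).2)); left.
have ft : injective (fun j => (gn j, tgt j)).
  have := inj_aux (fun j => ~~ (c j).2) (or_intror (fun=> erefl)).
  move=> it j j' [e1 e2]; apply: it; congr (_, _) => //.
  by move: e2; rewrite /tgt; case: ((c j).2) ((c j').2) => [] [].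
(* Trivial labels: only the action on the vertices matters here. *)
pose a : {ffun 'I_n -> 'S_1} := [ffun=> 1%g].
exists {perm ('I_n.+1 * 'S_1)}, (skew fo ft a).
have wz k : k <= n -> walk org tgt (fun e => fgl (gn e, false)) setT ord0 (inord k)
    (\prod_(l <- take k (fgword z)) fgl l)%g.
  elim: k => [_|k IHk kn].
    rewrite take0 big_nil (_ : inord 0 = ord0); first exact: walk0.
    by apply: val_inj; rewrite /= inordK.
  have wk := IHk (ltnW kn); rewrite (take_nth l0) // -cats1 big_cat big_seq1 /=.
  pose j := Ordinal kn; have -> : nth l0 (fgword z) k = c j by [].
  have cj : c j = (gn j, (c j).2) by rewrite /gn; case: (c j).
  rewrite cj; case cb: (c j).2.
    have -> : inord k.+1 = org j by rewrite /org cb.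
    rewrite (_ : (_, true) = linv (gn j, false)) // fgl_linv.
    by apply: walkB; rewrite ?inE // /tgt cb.
  have -> : inord k.+1 = tgt j by rewrite /tgt cb.
  by apply: walkF; rewrite ?inE // /org cb.
have := wz n (leqnn n); rewrite take_size -fg_prod => wz' z1'.
have := weval_skew fo ft a wz' 1%g; rewrite z1' perm1 => -[/(congr1 val)/= /eqP].
by rewrite inordK // => /eqP e0 _; move: sz; rewrite -/n -e0.
Qed.

Section FoldedGraph.
Variables (I : choiceType) (V E : finType) (org tgt : E -> V) (gn : E -> I).
Hypothesis fold_org : injective (fun e => (gn e, org e)).
Hypothesis fold_tgt : injective (fun e => (gn e, tgt e)).
Let lab e : freeGroup I := fgl (gn e, false).
Local Notation walk := (walk org tgt lab setT).
Variable u : V.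
Hypothesis conn : forall v, exists g, walk u v g.
Variables (k : nat) (y : 'I_k -> freeGroup I).
Hypothesis yP : forall g, walk u u g <-> gens (codom y) g.

(** The exponents are compared in the cardinal bound for a group of order 2. *)
Lemma folded_rank : #|E| < k + #|V|.
Proof.
have := card_conn fold_org fold_tgt 'S_2 yP conn.
rewrite card_Sn leq_exp2l //.
have V0 : 0 < #|V| by apply/card_gt0P; exists u.
by move: V0; clear; lia.
Qed.

(** When the counts agree [holmap] is bijective, so the values on the [y i] can be prescribed freely
    in every finite group. A relation between the [y i] would then hold in all finite groups,
    against residual finiteness. *)
Lemma folded_basis : k + #|V| = #|E|.+1 -> injective (weval y).
Proof.
move=> kE z z' ezz; apply: divg1_eq; apply: contrapT => zz; have [S [t tz]] := residually_finite zz.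
case: (holmap_bij fold_org fold_tgt S yP conn kE) => f fK Kf; apply: tz.
have := Kf ([ffun i => t i], [ffun=> 1%g]).
set a := f _ => /(congr1 fst)/= /ffunP ea.
have -> : weval t (z / z')%g = weval (fun i => hol fold_org fold_tgt u a (y i)) (z / z')%g.
  by rewrite /weval; apply: eq_bigr => -[i []] _; have := ea i; rewrite !ffunE /leval /= => ->.
by rewrite -(hol_weval fold_org fold_tgt yP a) wevalM wevalV ezz mulgV hol1.
Qed.

(** Since [holmap] is bijective, multiplying the value at [y i] by a fixed element is a bijection of
    the labellings ([sh]); hence all values are taken equally often. *)
Lemma folded_uniform (S : finGroupType) (R : nmodType) (F : S -> R) i :
  k + #|V| = #|E|.+1 ->
  ((\sum_(a : {ffun E -> S}) F (hol fold_org fold_tgt u a (y i))) *+ #|S| =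
   (\sum_s F s) *+ (#|S| ^ #|E|))%R.
Proof.
move=> kE; have bij := holmap_bij fold_org fold_tgt S yP conn kE.
pose c s := #|[set a : {ffun E -> S} | hol fold_org fold_tgt u a (y i) == s]|.
have cE s : c s = c 1%g.
  case: (bij) => f fK Kf.
  pose sh (s' : S) (a : {ffun E -> S}) := let p := holmap fold_org fold_tgt y conn a in
    f ([ffun j => if j == i then (s' * p.1 j)%g else p.1 j], p.2).
  have shi s' a : hol fold_org fold_tgt u (sh s' a) (y i) =
      (s' * hol fold_org fold_tgt u a (y i))%g.
    have := Kf ([ffun j => if j == i then (s' * (holmap fold_org fold_tgt y conn a).1 j)%g
      else (holmap fold_org fold_tgt y conn a).1 j], (holmap fold_org fold_tgt y conn a).2).
    by rewrite -/(sh s' a) => /(congr1 fst)/= /ffunP/(_ i); rewrite !ffunE eqxx.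
  have shI s' : injective (sh s').
    move=> a a' /(congr1 (holmap fold_org fold_tgt y conn)).
    rewrite /sh !Kf => -[/ffunP e1 e2]; apply: (bij_inj bij).
    apply/eqP; rewrite xpair_eqE; apply/andP; split; apply/eqP; last exact: e2.
    apply/ffunP => j; have := e1 j; rewrite !ffunE.
    by case: eqP => // _ /mulgI.
  apply/eqP; rewrite eqn_leq; apply/andP; split.
    rewrite /c -(card_imset _ (shI (s^-1)%g)); apply: subset_leq_card.
    by apply/subsetP => _ /imsetP[a + ->]; rewrite !inE shi => /eqP->; rewrite mulVg.
  rewrite /c -(card_imset _ (shI s)); apply: subset_leq_card.
  by apply/subsetP => _ /imsetP[a + ->]; rewrite !inE shi => /eqP->; rewrite mulg1.
have ctot : c 1%g * #|S| = #|S| ^ #|E|.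
  rewrite -card_ffun -[RHS]sum1_card (partition_big (fun a => hol fold_org fold_tgt u a (y i)) predT) //=.
  rewrite mulnC -sum_nat_const; apply: eq_bigr => s _.
  by rewrite -(cE s) /c -sum1_card; apply: eq_bigl => a; rewrite inE.
rewrite -ctot GRing.mulrnA; congr (_ *+ _)%R.
rewrite (partition_big (fun a => hol fold_org fold_tgt u a (y i)) predT) //= -GRing.sumrMnl.
apply: eq_bigr => s _; rewrite -(cE s) (eq_bigr (fun=> F s)) => [|a /eqP->//].
by rewrite GRing.sumr_const; congr (_ *+ _)%R; apply: eq_card => a; rewrite !inE.
Qed.

End FoldedGraph.
Import Order.TTheory GRing.Theory Num.Theory.

(** * Merging base points in quotients of w-cycles *)

Section Transport.
Local Open Scope ring_scope.
Variables (K : fieldType) (A B : finType) (p : pred A) (g : A -> B).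
Definition lpush_fun (v : {ffun A -> K^o}) : {ffun B -> K^o} :=
  [ffun z => \sum_(a | p a && (g a == z)) v a].

Lemma lpush_is_linear : linear lpush_fun.
Proof.
move=> k u v; apply/ffunP => z; rewrite !ffunE scaler_sumr -big_split.
by apply: eq_bigr => a _; rewrite !ffunE.
Qed.
HB.instance Definition _ := GRing.isLinear.Build K _ _ _ lpush_fun lpush_is_linear.

Definition lpush := linfun lpush_fun.

Lemma lpushE v z : lpush v z = \sum_(a | p a && (g a == z)) v a.
Proof. by rewrite lfunE ffunE. Qed.

Lemma sum_lpush (v : {ffun A -> K^o}) (P : pred B) :
  \sum_(z | P z) lpush v z = \sum_(a | p a && P (g a)) v a.
Proof.
rewrite [RHS](partition_big g P) => [|a /andP[]//]; apply: eq_bigr => z Pz.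
rewrite lpushE; apply: eq_bigl => a.
by case: eqP => [->|]; rewrite ?Pz ?andbT ?andbF.
Qed.

End Transport.

Lemma subrACA (V : zmodType) (x y z t : V) :
  (x - y - (z - t) = x - z - (y - t))%R.
Proof. by rewrite !opprB addrACA [RHS]addrACA (addrC (- y)%R). Qed.

Section Delta.
Local Open Scope ring_scope.
Variable K : fieldType.

Definition dlt (A : finType) (a : A) : {ffun A -> K^o} := [ffun z => (z == a)%:R].

Lemma lpush_dlt (A B : finType) (p : pred A) (g : A -> B) a :
  lpush K p g (dlt a) = (p a)%:R *: dlt (g a).
Proof.
apply/ffunP => z; rewrite lpushE !ffunE big_mkcond (bigD1 a) //= big1 ?addr0.
  by rewrite ffunE eqxx (eq_sym z); case: (p a); case: eqP => //= _;
     rewrite ?scaler0 ?scale0r ?scale1r.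
by move=> a' aa'; rewrite ffunE (negPf aa'); case: ifP.
Qed.

Lemma dltE (A : finType) (a z : A) : dlt a z = (z == a)%:R.
Proof. exact: ffunE. Qed.

Lemma dlt_inj (A : finType) : injective (@dlt A).
Proof.
move=> a b e; apply/eqP; have := dltE b a; rewrite -e dltE eqxx.
by case: (a == b) => // /eqP; rewrite oner_eq0.
Qed.

Lemma lpushT_dlt (A B : finType) (g : A -> B) a :
  lpush K predT g (dlt a) = dlt (g a).
Proof. by rewrite lpush_dlt scale1r. Qed.

Lemma dlt_sum (A : finType) (v : {ffun A -> K^o}) : v = \sum_a v a *: dlt a.
Proof.
apply/ffunP => z; rewrite sum_ffunE (bigD1 z) //= !ffunE eqxx big1 ?addr0.
  by rewrite /GRing.scale /= mulr1.
by move=> a az; rewrite !ffunE eq_sym (negPf az) scaler0.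
Qed.

(** The chains that vanish in the quotient, spanned by the differences of equivalent points. The
    codimension is the number of classes, which turns counts of classes into dimensions. *)
Definition clsum (A : finType) (R : rel A) : {vspace {ffun A -> K^o}} :=
  lker (lpush K predT (pi R)).

Lemma clsumP (A : finType) (R : rel A) (v : {ffun A -> K^o}) :
  reflect (forall q, \sum_(a | pi R a == q) v a = 0) (v \in clsum R).
Proof.
rewrite memv_ker; apply: (iffP eqP) => [/ffunP v0 q|v0].
  by have := v0 q; rewrite lpushE ffunE.
by apply/ffunP => q; rewrite lpushE ffunE; apply: v0.
Qed.

Lemma clsum_dlt (A : finType) (R : rel A) a b : equivalence_rel R ->
  (dlt a - dlt b \in clsum R) = R a b.
Proof.
move=> eR; rewrite memv_ker linearB.
rewrite -[X in X - _]/(lpush K predT (pi R) (dlt a)).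
rewrite -[X in _ - X]/(lpush K predT (pi R) (dlt b)).
rewrite !lpushT_dlt subr_eq0 -piE //.
by apply/eqP/eqP => [/dlt_inj|->].
Qed.

Lemma dim_clsum (A : finType) (R : rel A) :
  (\dim (clsum R) + #|{: quo R}|)%N = #|A|.
Proof.
have := limg_ker_dim (lpush K predT (pi R)) fullv.
rewrite capfv !dimvf /dim /= !muln1 => <-; congr (_ + _)%N.
suff -> : (limg (lpush K predT (pi R)) = fullv)%VS by rewrite dimvf /dim /= muln1.
apply/eqP; rewrite eqEsubv subvf; apply/subvP => w _; rewrite (dlt_sum w).
apply: memv_suml => q _; apply: memvZ; apply/memv_imgP; exists (dlt (qrep q)).
  exact: memvf.
by rewrite lpushT_dlt qrepK.
Qed.

Lemma clsum_sub (A : finType) (R : rel A) (U : {vspace {ffun A -> K^o}}) :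
  equivalence_rel R -> (forall a b, R a b -> dlt a - dlt b \in U) ->
  (clsum R <= U)%VS.
Proof.
move=> eR RU; apply/subvP => v /clsumP v0.
have -> : v = \sum_a v a *: (dlt a - dlt (qrep (pi R a))).
  under eq_bigr do rewrite scalerBr.
  rewrite sumrB -dlt_sum [X in _ - X](partition_big (pi R) predT) //=.
  rewrite big1 ?subr0 // => q _.
  rewrite (eq_bigr (fun a => v a *: dlt (qrep q))) => [|a /eqP->//].
  by rewrite -scaler_suml v0 scale0r.
by apply: memv_suml => a _; apply: memvZ; apply: RU; apply: qrepP.
Qed.

Lemma dim_addv_line (V : vectType K) (U : {vspace V}) v :
  \dim (U + <[v]>) = (\dim U + (v \notin U))%N.
Proof.
case: (boolP (v \in U)) => vU /=.
  by rewrite addn0 (addv_idPl _) // -memvE.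
have v0 : v != 0 by apply: contraNneq vU => ->; apply: mem0v.
rewrite dimv_disjoint_sum ?dim_vline ?v0 //.
apply/eqP; rewrite -subv0; apply/subvP => z; rewrite memv_cap memv0.
case/andP => zU /vlineP[k ekz]; move: zU; rewrite ekz.
have [->|k0] := eqVneq k 0; first by rewrite scale0r.
by move=> /(memvZ k^-1); rewrite scalerA mulVf // scale1r (negPf vU).
Qed.

End Delta.

(** * Folded congruences on copies of a cyclic word *)

Section CyclicWord.
Variables (I : choiceType) (L : nat) (c : 'I_L.+1 -> I * bool).

Definition cyc_reduced := forall i, c (ordS i) != linv (c i).

Section Marks.
Variables (X : finType) (tau : X -> X).
Local Notation Y := (X * 'I_L.+1)%type.
Implicit Types (y : Y) (R N F : rel Y).

(* The graph of [X] copies of the word, closed up according to [tau]: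
   vertices and edges are both indexed by [Y], the edge [y] joining [y] to
   [cnext y]. *)
Definition cnext y : Y :=
  (if y.2 == ord_max then tau y.1 else y.1, ordS y.2).
Definition corg y := if (c y.2).2 then cnext y else y.
Definition ctgt y := if (c y.2).2 then y else cnext y.
Definition cgen y := (c y.2).1.

(** Folded congruences: the quotient graph has at most one edge of each generator out of, and into,
    each vertex. *)
Definition ccl R := equivalence_rel R /\
  forall y y', cgen y = cgen y' -> R (corg y) (corg y') = R (ctgt y) (ctgt y').

Definition cedge R : rel Y :=
  fun y y' => (cgen y == cgen y') && R (corg y) (corg y').

Lemma cedge_equiv R : equivalence_rel R -> equivalence_rel (cedge R).
Proof.
move=> eR; apply: equivalence_relT => [y|y y'|y y' y''].
- by rewrite /cedge eqxx eqr_refl.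
- by rewrite /cedge eq_sym (eqr_sym eR).
- by move=> /andP[/eqP e1 r1] /andP[/eqP e2 r2]; rewrite /cedge -e2 e1 eqxx (eqr_trans eR r1).
Qed.

Lemma ccl_next R y y' : ccl R -> y.2 = y'.2 -> R y y' = R (cnext y) (cnext y').
Proof.
move=> [eR cR] e2; have := cR y y'; rewrite /cgen /corg /ctgt e2 => /(_ erefl).
by case: (c _).2.
Qed.

Lemma cedge_same R y y' : ccl R -> y.2 = y'.2 -> cedge R y y' = R y y'.
Proof.
move=> cR e2; rewrite /cedge /cgen /corg e2 eqxx; case: (c _).2 => //=.
by rewrite -ccl_next.
Qed.

Lemma iter_cnext2 t y y' : y.2 = y'.2 -> (iter t cnext y).2 = (iter t cnext y').2.
Proof. by move=> e2; elim: t => //= t IHt; rewrite IHt. Qed.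

Lemma ccl_iter R t y y' : ccl R -> y.2 = y'.2 ->
  R (iter t cnext y) (iter t cnext y') = R y y'.
Proof.
move=> cR e2; elim: t => //= t IHt; rewrite -ccl_next //.
exact: iter_cnext2.
Qed.

Lemma val_iter_ordS t (i : 'I_L.+1) :
  nat_of_ord (iter t (@ordS _) i) = (i + t) %% L.+1.
Proof.
elim: t => [|t IHt] /=; first by rewrite addn0 modn_small.
by rewrite IHt -addn1 modnDml addn1 addnS.
Qed.

Lemma iter_cnext_ord t y : (iter t cnext y).2 = iter t (@ordS _) y.2.
Proof. by elim: t => //= t ->. Qed.

Definition cclos (P : Y -> Y -> Prop) : rel Y :=
  fun y y' => `[< forall R, ccl R -> (forall a b, P a b -> R a b) -> R y y' >].

Lemma cclosP P : ccl (cclos P).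
Proof.
have eqC : equivalence_rel (cclos P).
  apply: equivalence_relT => [y|y y'|y y' y''].
  - by apply/asboolP => R [eR _] _; apply: eqr_refl.
  - by apply/asboolP/asboolP => + R cR PR => /(_ R cR PR); rewrite (eqr_sym cR.1).
  - move=> /asboolP r1 /asboolP r2; apply/asboolP => R cR PR.
    by apply: (eqr_trans cR.1 (r1 R cR PR)); apply: r2.
split=> // y y' e; apply/asboolP/asboolP => + R cR PR => /(_ R cR PR);
  by rewrite (cR.2 _ _ e).
Qed.

Lemma cclos_in P a b : P a b -> cclos P a b.
Proof. by move=> Pab; apply/asboolP => R _; apply. Qed.

Lemma cclos_min P R : ccl R -> (forall a b, P a b -> R a b) ->
  forall a b, cclos P a b -> R a b.
Proof. by move=> cR PR a b /asboolP; apply. Qed.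

Local Open Scope ring_scope.
Local Notation K := rat.
Local Notation dlt := (dlt K).
Local Notation ZV N := (clsum K N).
Local Notation ZE N := (clsum K (cedge N)).

Definition mvend (d : bool) (b : I) :=
  lpush K (fun e : Y => cgen e == b) (if d then ctgt else corg).

Lemma cedge_end R d y y' : ccl R -> cgen y = cgen y' ->
  cedge R y y' = R ((if d then ctgt else corg) y) ((if d then ctgt else corg) y').
Proof.
by move=> cR e; rewrite /cedge e eqxx /=; case: d => //; rewrite cR.2.
Qed.

(** Among edges with one generator, two edges are identified exactly when their ends on a given side
    are, so the edge classes inject into the vertex classes. *)
Lemma mvend_ZE N d b v : ccl N -> v \in ZE N -> mvend d b v \in ZV N.
Proof.
move=> cN /clsumP v0; apply/clsumP => q.
rewrite sum_lpush; set s := if d then ctgt else corg.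
case: (pickP (fun e => (cgen e == b) && (pi N (s e) == q))) => [e0|]; last first.
  by move=> P0; rewrite big_pred0.
move=> /andP[/eqP gb /eqP eq0]; rewrite -[RHS](v0 (pi (cedge N) e0)).
apply: eq_bigl => e; rewrite piE; last exact: cedge_equiv cN.1.
have [eb|nb] := eqVneq (cgen e) b; last first.
  by rewrite /cedge gb; case: eqP nb => // ->; rewrite eqxx.
by rewrite (cedge_end d cN) ?eb ?gb // -eq0 piE //; case: cN.
Qed.

Lemma mask_ZE N b v : ccl N -> v \in ZE N ->
  lpush K (fun e : Y => cgen e == b) id v \in ZE N.
Proof.
move=> cN /clsumP v0; apply/clsumP => q; have [e0 /eqP ->] := pi_surj q.
have E z : lpush K (fun e : Y => cgen e == b) id v z = if cgen z == b then v z else 0.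
  rewrite lpushE big_mkcond (bigD1 z) //= eqxx andbT big1 ?addr0 //.
  by move=> a az; rewrite (negPf az) andbF.
have eN := cedge_equiv cN.1.
under eq_bigr do rewrite E; have [eb|nb] := eqVneq (cgen e0) b.
  rewrite -[RHS](v0 (pi (cedge N) e0)); apply: eq_bigr => e.
  by rewrite piE // => /andP[/eqP-> _]; rewrite eb eqxx.
rewrite big1 // => e; rewrite piE // => /andP[/eqP-> _].
by rewrite (negPf nb).
Qed.

(** * Linear dependence of the identifications forced by a merge *)

Section Merge.
Variables (N : rel Y) (x s : X).
Hypotheses (cN : ccl N) (Nxs : ~~ N (x, ord0) (s, ord0)).
Hypothesis cw : cyc_reduced.
Let A t := iter t cnext (x, ord0 : 'I_L.+1).
Let B t := iter t cnext (s, ord0 : 'I_L.+1).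
Let lt t := c (A t).2.
Definition mlink t := dlt (A t) - dlt (B t).
Local Notation sg := mlink.

Let AB t : (A t).2 = (B t).2. Proof. exact: iter_cnext2. Qed.
Let NAB t : N (A t) (B t) = false.
Proof. by rewrite ccl_iter //; apply: negbTE. Qed.

Let lt_red t : lt t.+1 != linv (lt t).
Proof. by rewrite /lt /A /= cw. Qed.

(** The chosen end of the edge read at time [t] is the point at time [t] or [t + 1], according to
    the sign of the letter. *)
Lemma mvend_link d b t :
  mvend d b (sg t) = if (lt t).1 == b then sg (t + (d (+) (lt t).2)) else 0.
Proof.
rewrite linearB.
rewrite -[X in X - _]/(mvend d b (dlt (A t))) -[X in _ - X]/(mvend d b (dlt (B t))).
rewrite !lpush_dlt /cgen -AB -/(lt t) /corg /ctgt.
case: eqP => _; last by rewrite !scale0r subr0.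
case: d => /=; rewrite -AB -/(lt t); case: (lt t).2;
  by rewrite /= !scale1r ?addn0 ?addn1.
Qed.

Lemma mvend_linkZ d b (a : K) t : mvend d b (a *: sg t) =
  a *: (if (lt t).1 == b then sg (t + (d (+) (lt t).2))%N else 0).
Proof. by rewrite -mvend_link linearZ. Qed.

Lemma mask_linkZ b (a : K) t :
  lpush K (fun e : Y => cgen e == b) id (a *: sg t) =
  a *: (if (lt t).1 == b then sg t else 0).
Proof.
rewrite linearZ; congr (_ *: _); rewrite /sg linearB.
rewrite -[X in X - _]/(lpush K (fun e : Y => cgen e == b) id (dlt (A t))).
rewrite -[X in _ - X]/(lpush K (fun e : Y => cgen e == b) id (dlt (B t))).
rewrite !lpush_dlt /cgen -AB -/(lt _); case: eqP => _; last by rewrite !scale0r subr0.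
by rewrite !scale1r.
Qed.

Implicit Types (U W : {vspace {ffun Y -> K^o}}).

Fixpoint wspan U k m :=
  if m is m'.+1 then (wspan U k m' + <[sg (k + m')%N]>)%VS else U.

Lemma wspanP U k m v : reflect
  (exists a : nat -> K, v - \sum_(i < m) a i *: sg (k + i)%N \in U)
  (v \in wspan U k m).
Proof.
elim: m v => [|m IHm] v /=.
  by apply: (iffP idP) => [vU|[a]]; [exists (fun=> 0)|]; rewrite big_ord0 subr0.
apply: (iffP memv_addP) => [[u /IHm[a ua] [_ /vlineP[l ->] ->]]|[a]].
  exists (fun i => if i == m then l else a i); rewrite big_ord_recr /= eqxx.
  rewrite opprD addrACA subrr addr0.
  rewrite (eq_bigr (fun i : 'I_m => a i *: sg (k + i)%N)) // => i _.
  by rewrite ltn_eqF.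
rewrite big_ord_recr /= opprD addrA => va.
exists (v - a m *: sg (k + m)%N); last first.
  by exists (a m *: sg (k + m)%N); rewrite ?subrK // memvZ ?memv_line.
by apply/IHm; exists a; rewrite addrAC.
Qed.

Lemma wspan_sub U k m : (U <= wspan U k m)%VS.
Proof. by elim: m => [|m IHm] //=; apply: subv_trans IHm (addvSl _ _). Qed.

Lemma wspan_link U k m i : (i < m)%N -> sg (k + i)%N \in wspan U k m.
Proof.
elim: m => // m IHm; rewrite ltnS leq_eqVlt => /orP[/eqP->|im] /=.
  exact: (subvP (addvSr _ _)) (memv_line _).
exact: (subvP (addvSl _ _)) (IHm im).
Qed.

Lemma wspan_le U W k m : (U <= W)%VS ->
  (forall i, (i < m)%N -> sg (k + i)%N \in W) -> (wspan U k m <= W)%VS.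
Proof.
move=> UW; elim: m => //= m IHm sW; rewrite subv_add -memvE sW // andbT.
by apply: IHm => i im; apply: sW; apply: ltnW.
Qed.

Lemma dim_wspan U k m : \dim (wspan U k m) =
  (\dim U + \sum_(i < m) (sg (k + i)%N \notin wspan U k i))%N.
Proof.
elim: m => [|m IHm] /=; first by rewrite big_ord0 addn0.
by rewrite dim_addv_line IHm big_ord_recr addnA.
Qed.

Section Fold.
Variable F : rel Y.
Hypotheses (cF : ccl F) (NF : forall a b, N a b -> F a b).
Hypothesis Fxs : F (x, ord0) (s, ord0).
Hypothesis Fmin : forall R, ccl R -> (forall a b, N a b -> R a b) ->
  R (x, ord0) (s, ord0) -> forall a b, F a b -> R a b.

Definition bdry := (lpush K predT ctgt - lpush K predT corg)%VF.

Lemma bdry_dlt e : bdry (dlt e) = dlt (ctgt e) - dlt (corg e).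
Proof. by rewrite !lfunE /= opp_lfunE !lpushT_dlt. Qed.

Lemma bdry_ZE : (bdry @: ZE N <= ZV N)%VS.
Proof.
apply/subvP => _ /memv_imgP[v /clsumP v0 ->]; apply/clsumP => q.
rewrite !lfunE /=.
have E (w w' : {ffun Y -> K^o}) z : (w + w') z = w z + w' z by rewrite ffunE.
have E' (w : {ffun Y -> K^o}) z : (- w) z = - w z by rewrite ffunE.
under eq_bigr do rewrite E opp_lfunE E'.
rewrite sumrB !sum_lpush /=.
have Z d : \sum_(a | pi N ((if d then ctgt else corg) a) == q) v a = 0.
  rewrite (partition_big (pi (cedge N)) predT) //= big1 // => r _.
  have [a0 /eqP ->] := pi_surj r; have eN := cedge_equiv cN.1.
  have [q0|q0] := eqVneq (pi N ((if d then ctgt else corg) a0)) q; last first.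
    rewrite big_pred0 // => a; apply/negbTE; apply: contra q0 => /andP[/eqP <-].
    rewrite !piE //; last by case: cN.
    by rewrite eqr_sym // => /[dup] /andP[/eqP e _]; rewrite (cedge_end d cN).
  rewrite -[RHS](v0 (pi (cedge N) a0)); apply: eq_bigl => a; rewrite andb_idl // piE //.
  rewrite -q0 piE; last by case: cN.
  by move=> /[dup] /andP[/eqP e _]; rewrite (cedge_end d cN).
by rewrite (Z true) (Z false) subr0.
Qed.

Lemma bdry_link t : bdry (sg t) = sg t.+1 - sg t \/ bdry (sg t) = sg t - sg t.+1.
Proof.
rewrite linearB.
rewrite -[X in X - _]/(bdry (dlt (A t))) -[X in _ - X]/(bdry (dlt (B t))).
rewrite !bdry_dlt /corg /ctgt -AB; case: (c _).2; [right | left];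
  by rewrite /sg /= [LHS]subrACA.
Qed.

Lemma F_edge_link t : sg t \in ZE F.
Proof.
rewrite clsum_dlt; last by apply: cedge_equiv cF.1.
by rewrite cedge_same // ccl_iter.
Qed.

(** [ZV F] lies in the vertex window plus the boundaries of [ZE F]. The boundary of the edge window
    is already in the vertex window, which is longer by one link, so only a complement of the edge
    window in [ZE F] adds dimensions. *)
Lemma fold_ineq k m :
  (\dim (wspan (ZE N) k m) + \dim (ZV F) <=
   \dim (wspan (ZV N) k m.+1) + \dim (ZE F))%N.
Proof.
set SE := wspan (ZE N) k m; set SV := wspan (ZV N) k m.+1.
have NEF : (ZE N <= ZE F)%VS.
  apply: clsum_sub => [|a b]; first exact: cedge_equiv cN.1.
  rewrite clsum_dlt; last exact: cedge_equiv cF.1.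
  by move=> /andP[e /NF r]; rewrite /cedge e.
have SEF : (SE <= ZE F)%VS by apply: wspan_le => // i _; apply: F_edge_link.
have SEV : (bdry @: SE <= SV)%VS.
  suff : (SE <= bdry @^-1: SV)%VS by move=> /(limgS bdry)/subv_trans; apply; apply/subvP => _ /memv_imgP[v + ->]; rewrite -memv_preim.
  apply: wspan_le => [|i im].
    apply/subvP => v vZ; rewrite -memv_preim; apply: (subvP (wspan_sub _ _ _)).
    by apply: (subvP bdry_ZE); apply: memv_img.
  rewrite -memv_preim; have s1 : sg (k + i)%N \in SV by rewrite wspan_link // ltnS ltnW.
  have s2 : sg (k + i).+1 \in SV by rewrite -addnS wspan_link.
  by case: (bdry_link (k + i)) => ->; rewrite memvB.
have VF : (ZV F <= SV + bdry @: ZE F)%VS.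
  apply: clsum_sub; first by case: cF.
  set W := (SV + _)%VS.
  (* [F] restricted by membership in [W] is again a folded congruence that contains [N] and the
     merge, so it is all of [F] by minimality. *)
  pose R y y' := F y y' && (dlt y - dlt y' \in W).
  suff RF a b : F a b -> R a b by move=> a b /RF/andP[].
  have eR : equivalence_rel R.
    apply: equivalence_relT => [y|y y'|y y' y''].
    - by rewrite /R subrr mem0v eqr_refl //; case: cF.
    - by rewrite /R (eqr_sym cF.1) -(opprB (dlt y')) memvN.
    - move=> /andP[f1 d1] /andP[f2 d2]; rewrite /R (eqr_trans cF.1 f1 f2) /=.
      by rewrite -(subrK (dlt y) (dlt y')) -addrA memvD.
  have SW : (SV <= W)%VS by apply: addvSl.
  have cR : ccl R.
    split=> [//|y y' e]; rewrite /R (cF.2 _ _ e).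
    case Fyy: (F _ _); last by rewrite !andFb.
    rewrite !andTb.
    have eE : dlt y - dlt y' \in ZE F.
      rewrite clsum_dlt; last exact: cedge_equiv cF.1.
      by rewrite /cedge e eqxx cF.2.
    have : bdry (dlt y - dlt y') \in W.
      by apply: (subvP (addvSr _ _)); apply: memv_img.
    rewrite linearB -[X in X - _]/(bdry (dlt y)) -[X in _ - X]/(bdry (dlt y')).
    rewrite !bdry_dlt subrACA => dW.
    have -> : dlt (ctgt y) - dlt (ctgt y') = dlt (ctgt y) - dlt (ctgt y') -
       (dlt (corg y) - dlt (corg y')) + (dlt (corg y) - dlt (corg y')) by rewrite subrK.
    by rewrite [RHS]rpredDl.
  apply: Fmin => [//|y y' Nyy'|].
    rewrite /R NF //=; apply: (subvP SW); apply: (subvP (wspan_sub _ _ _)).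
    by rewrite clsum_dlt //; case: cN.
  (* The merge is equivalent to the identification at any single time; this is what lets the window
     start at an arbitrary [k]. *)
  rewrite -(ccl_iter k cR) //; rewrite /R ccl_iter // Fxs /=.
  by apply: (subvP SW); rewrite -[k]addn0 wspan_link.
have dU : (\dim (ZE F :\: SE) + \dim SE = \dim (ZE F))%N.
  by rewrite addnC -{1}(capv_idPr SEF) dimv_cap_compl.
have : (ZV F <= SV + bdry @: (ZE F :\: SE))%VS.
  apply: subv_trans VF _; rewrite subv_add addvSl /=.
  rewrite -{1}(addv_diff_cap (ZE F) SE) (capv_idPr SEF) limgD.
  by rewrite subv_add addvSr (subv_trans SEV) // addvSl.
move=> /dimvS; rewrite -dU addnA addnC => h.
rewrite leq_add2r.
apply: leq_trans h _; apply: leq_trans (dimv_add_leqif _ _).1 _.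
by rewrite leq_add2l -(limg_ker_dim bdry (ZE F :\: SE)) leq_addl.
Qed.

Definition newV k i := sg (k + i)%N \notin wspan (ZV N) k i.
Definition newE k i := sg (k + i)%N \notin wspan (ZE N) k i.

Lemma newV0 k : newV k 0.
Proof. by rewrite /newV addn0 clsum_dlt ?NAB //; case: cN. Qed.

(** A dependence among edges is pushed to the end of the last letter at which that letter's link
    stays in place. No earlier link can land on it: this would need the preceding letter to cancel
    the last one. *)
Lemma newVE k i : newV k i -> newE k i.
Proof.
apply: contraLR; rewrite negbK => /wspanP[a aZ].
rewrite negbK; set W := wspan _ _ _.
pose b := (lt (k + i)).1; pose d := (lt (k + i)).2.
have := mvend_ZE d b cN aZ; rewrite linearB linear_sum.
rewrite -[X in X - _]/(mvend d b (sg (k + i)%N)) mvend_link -/b -/d eqxx addbb addn0.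
rewrite (eq_bigr (fun j : 'I_i => a j *: (if (lt (k + j)).1 == b
   then sg (k + j + (d (+) (lt (k + j)).2))%N else 0))) => [sZ|j _]; last first.
  exact: mvend_linkZ.
rewrite -[sg _](subrK (\sum_(j < i) a j *: (if (lt (k + j)).1 == b
   then sg (k + j + (d (+) (lt (k + j)).2))%N else 0))).
rewrite memvD //; first exact: (subvP (wspan_sub _ _ _)).
apply: memv_suml => j _; apply: memvZ; case: eqP => [eb|]; last by rewrite mem0v.
rewrite -addnA; apply: wspan_link; case dE: (_ (+) _); last by rewrite addn0.
rewrite addn1 ltn_neqAle ltn_ord andbT; apply/eqP => eij.
have := lt_red (k + j); rewrite -addnS eij => /eqP; apply.
rewrite [lt (k + i)]surjective_pairing -/b -/d /linv -eb; congr (_, _).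
by move: dE; clear; case: d => [] /=; case: (lt _).2.
Qed.

Variable T : nat.
Hypotheses (T0 : (0 < T)%N) (LT : (L.+1 %| T)%N).
Hypotheses (NAT : N (A T) (A 0)) (NBT : N (B T) (B 0)).

Lemma iter_ord0 t : (L.+1 %| t)%N -> iter t (@ordS L.+1) ord0 = ord0.
Proof. by move=> Lt; apply: ord_inj; rewrite val_iter_ordS add0n; apply/eqP. Qed.

Let AT t : N (A (t + T)) (A t).
Proof. by rewrite /A iterD ccl_iter // iter_cnext_ord iter_ord0. Qed.
Let BT t : N (B (t + T)) (B t).
Proof. by rewrite /B iterD ccl_iter // iter_cnext_ord iter_ord0. Qed.

Lemma link_perV t : sg (t + T)%N - sg t \in ZV N.
Proof. by rewrite /sg subrACA memvB // clsum_dlt ?AT ?BT //; case: cN. Qed.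

Lemma newV_per k i : newV k (i + T) = false.
Proof.
apply/negbTE; rewrite /newV negbK addnA -(subrK (sg (k + i)%N) (sg _)) memvD //.
  by apply: (subvP (wspan_sub _ _ _)); apply: link_perV.
by apply: wspan_link; rewrite -addn1 leq_add2l.
Qed.

Let exV k : exists i, ~~ newV k i.
Proof. by exists T; rewrite -[T]add0n newV_per. Qed.
(** Length of the longest independent window of vertex links from time [k]; the links repeat after
    [T] modulo [ZV N], so it is at most [T]. *)
Definition mgap k := ex_minn (exV k).

Lemma mgapP k : [/\ ~~ newV k (mgap k), forall i, (i < mgap k)%N -> newV k i,
  (0 < mgap k)%N & (mgap k <= T)%N].
Proof.
rewrite /mgap; case: ex_minnP => m nm mm; split=> //.
- by move=> i im; apply: contraLR im => /mm; rewrite -leqNgt.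
- by case: m nm {mm} => //; rewrite newV0.
- by apply: mm; rewrite -[T]add0n newV_per.
Qed.

Lemma fold_ineq' k m :
  (\sum_(i < m) newE k i + #|{: quo N}| + #|{: quo (cedge F)}| <=
   \sum_(i < m.+1) newV k i + #|{: quo F}| + #|{: quo (cedge N)}|)%N.
Proof.
have := fold_ineq k m; rewrite !dim_wspan.
rewrite -/(newV _ _).
have := dim_clsum K N; have := dim_clsum K F.
have := dim_clsum K (cedge N); have := dim_clsum K (cedge F).
rewrite /newV /newE.
move: (\dim (ZV N)) (\dim (ZV F)) (\dim (ZE N)) (\dim (ZE F)).
move: (\sum_(i < m.+1) _)%N (\sum_(i < m) _)%N #|_| #|_| #|_| #|_| #|_|.
by clear; lia.
Qed.

Lemma sum_true (f : nat -> bool) m : (forall i, (i < m)%N -> f i) ->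
  (\sum_(i < m) f i = m)%N.
Proof.
move=> fT; rewrite (eq_bigr (fun=> 1%N)) => [|i _]; last by rewrite fT.
by rewrite sum1_card card_ord.
Qed.

(** The inequality is taken for the window up to the first vertex dependence. There the edge links
    are independent as well, and both counts of new links equal [mgap 0]. *)
Lemma chi_merge :
  (#|{: quo N}| + #|{: quo (cedge F)}| <= #|{: quo F}| + #|{: quo (cedge N)}|)%N.
Proof.
have [nm mm m0 _] := mgapP 0; have := fold_ineq' 0 (mgap 0).
rewrite big_ord_recr /= (negPf nm) addn0.
rewrite !sum_true // => [|i /mm/newVE//].
by rewrite -!addnA leq_add2l.
Qed.

Hypothesis chi_eq :
  (#|{: quo N}| + #|{: quo (cedge F)}| = #|{: quo F}| + #|{: quo (cedge N)}|)%N.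

(** If the edges were still independent at the first vertex dependence, the window up to the second
    one would hold one more new edge link than new vertex links, against the equality of $\chi$. *)
Lemma lossless k : ~~ newE k (mgap k).
Proof.
have [nm mm m0 mT] := mgapP k; apply/negP => eM; set m := mgap k in nm mm m0 mT eM.
(* A second vertex dependence exists, by periodicity at [m + T] at the latest. *)
have exP : exists p, (m < p)%N && ~~ newV k p.
  by exists (m + T)%N; rewrite newV_per -addn1 leq_add2l T0.
case: (ex_minnP exP) => p /andP[mp np] pmin.
have pv i : (m < i < p)%N -> newV k i.
  move=> /andP[mi ip]; apply: contraLR ip => ni; rewrite -leqNgt; apply: pmin.
  by rewrite mi.
have pe i : (i < p)%N -> newE k i.
  by move=> ip; case: (ltngtP i m) => [/mm/newVE|mi|->//]; last by apply: newVE; apply: pv; rewrite mi.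
have := fold_ineq' k p; rewrite sum_true // big_ord_recr /= (negPf np) addn0.
have -> : (\sum_(i < p) newV k i = p.-1)%N.
  rewrite (bigD1 (Ordinal mp)) //= (negPf nm) add0n.
  rewrite (eq_bigr (fun=> 1%N)) => [|i im].
    by rewrite sum1_card cardC1 card_ord.
  case: (ltngtP i m) im => [/mm->|mi _|im] //; last by rewrite -val_eqE /= im eqxx.
  by rewrite pv // mi ltn_ord.
move: chi_eq; rewrite -!addnA => ->; rewrite leq_add2r.
by rewrite leqNgt ltn_predL (leq_ltn_trans _ mp).
Qed.

Lemma win_ind U k n (a : nat -> K) :
  (forall i, (i < n)%N -> sg (k + i)%N \notin wspan U k i) ->
  \sum_(i < n) a i *: sg (k + i)%N \in U -> forall i, (i < n)%N -> a i = 0.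
Proof.
elim: n => // n IHn nU; rewrite big_ord_recr /=.
have [an0|an0] := eqVneq (a n) 0.
  rewrite an0 scale0r addr0 => aU i; rewrite ltnS leq_eqVlt => /orP[/eqP->//|].
  by apply: IHn => // j jn; apply: nU; apply: ltnW.
move=> aU; case/negP: (nU n (leqnn _)); apply/wspanP.
exists (fun i => - (a n)^-1 * a i).
under eq_bigr do rewrite -scalerA.
rewrite -scaler_sumr scaleNr opprK.
have -> : sg (k + n)%N = (a n)^-1 *: (a n *: sg (k + n)%N).
  by rewrite scalerA mulVf // scale1r.
by rewrite -scalerDr addrC memvZ.
Qed.

Section Relations.
Variables (k : nat) (m : nat) (a : nat -> K).
(** A dependence among edge links confined to one generator, so that it may be pushed to either end
    of its edges; the first coefficient is normalised to make such dependences comparable. *)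
Definition erel := [/\ \sum_(i < m.+1) a i *: sg (k + i)%N \in ZE N, a 0 = 1,
  forall i, a i != 0 -> (i <= m)%N &
  forall i, a i != 0 -> (lt (k + i)).1 = (lt k).1].
Hypothesis rel : erel.

(** The dependence is pushed to one end of the letter at time [k]: where its reading begins for [e]
    false, where it finishes for [e] true. A link whose [flip] is true advances by one step, and
    [shifted] gives the resulting coefficients. *)
Definition flip e i := e (+) ((lt k).2 (+) (lt (k + i)).2).
Definition shifted e j := (if flip e j then 0 else a j) +
  (if j is j'.+1 then if flip e j' then a j' else 0 else 0).

(** Otherwise consecutive letters would cancel. Hence no two nonzero coefficients collide when
    pushed. *)
Lemma flip_adj e j : a j.+1 != 0 -> a j != 0 -> flip e j -> flip e j.+1.
Proof.
case: rel => _ _ _ gn aj1 aj; rewrite /flip; apply: contraTT.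
have := lt_red (k + j); rewrite -addnS.
rewrite [lt (k + j.+1)]surjective_pairing [lt (k + j)]surjective_pairing /linv /=.
rewrite !gn //; case: (lt k).2 => /=; case: e; case: (lt _).2; case: (lt _).2 => //=;
  by rewrite eqxx.
Qed.

Lemma shiftedL e j : ~~ flip e j -> a j != 0 -> shifted e j = a j.
Proof.
move=> fj aj; rewrite /shifted (negPf fj); case: j fj aj => [|j] fj aj; rewrite ?addr0 //.
case: ifP => fj'; last by rewrite addr0.
have [->|aj'] := eqVneq (a j) 0; first by rewrite addr0.
by rewrite flip_adj in fj.
Qed.

Lemma shiftedR e j : flip e j -> a j != 0 -> shifted e j.+1 = a j.
Proof.
move=> fj aj; rewrite /shifted fj; case: ifP => fj'; first by rewrite add0r.
have [->|aj'] := eqVneq (a j.+1) 0; first by rewrite add0r.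
by rewrite flip_adj in fj'.
Qed.

Lemma shifted_neq0 e j : shifted e j != 0 -> (~~ flip e j /\ a j != 0) \/
  exists j', [/\ j = j'.+1, flip e j' & a j' != 0].
Proof.
rewrite /shifted; case: ifP => fj; last first.
  have [->|aj _] := eqVneq (a j) 0; last by left.
  case: j fj => [|j] _; rewrite add0r ?eqxx //; case: ifP; rewrite ?eqxx // => fj aj.
  by right; exists j.
case: j fj => [|j] _; rewrite add0r ?eqxx //; case: ifP; rewrite ?eqxx // => fj aj.
by right; exists j.
Qed.

Lemma shifted_rel e : \sum_(j < m.+2) shifted e j *: sg (k + j)%N \in ZV N.
Proof.
case: rel => aZ a0 am gn; have am1 : a m.+1 = 0.
  by apply/eqP; apply: contraT => /am; rewrite ltnn.
have := mvend_ZE (e (+) (lt k).2) (lt k).1 cN aZ; rewrite linear_sum.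
rewrite (eq_bigr (fun i : 'I_m.+1 => (if flip e i then 0 else a i) *: sg (k + i)%N +
  (if flip e i then a i else 0) *: sg (k + i.+1)%N)) => [|i _]; last first.
  rewrite [LHS]mvend_linkZ; have [->|ai] := eqVneq (a i) 0.
    by rewrite !if_same !scale0r addr0.
  by rewrite gn // eqxx -addbA -/(flip e i); case: ifP;
     rewrite ?addn0 ?addn1 ?addnS scale0r ?add0r ?addr0.
rewrite big_split /= => aV.
suff -> : \sum_(j < m.+2) shifted e j *: sg (k + j)%N =
    \sum_(i < m.+1) (if flip e i then 0 else a i) *: sg (k + i)%N +
    \sum_(i < m.+1) (if flip e i then a i else 0) *: sg (k + i.+1)%N by [].
under eq_bigr do rewrite scalerDl.
rewrite big_split /=; congr (_ + _).
  by rewrite big_ord_recr /= am1 if_same scale0r addr0.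
by rewrite big_ord_recl /= scale0r add0r.
Qed.

End Relations.

(** [lossless] provides a dependence. Its first coefficient is nonzero because the window of length
    [m] from [k.+1] is independent; masking by the generator of the first letter keeps the chain in
    [ZE N]. *)
Lemma erel_exists k m : mgap k = m -> (m <= mgap k.+1)%N -> exists a, erel k m a.
Proof.
move=> mk mk1; have [nV nVm m0 mT] := mgapP k; have nE := lossless k.
have [_ nV1 _ _] := mgapP k.+1; rewrite mk in nV nVm m0 mT nE.
have eind0 (a : nat -> K) : \sum_(i < m) a i *: sg (k + i)%N \in ZE N ->
    forall i, (i < m)%N -> a i = 0.
  by apply: win_ind => i im; apply: newVE; apply: nVm.
have eind1 (a : nat -> K) : \sum_(i < m) a i *: sg (k.+1 + i)%N \in ZE N ->
    forall i, (i < m)%N -> a i = 0.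
  by apply: win_ind => i im; apply: newVE; apply: nV1; apply: leq_trans mk1.
move: nE; rewrite negbK => /wspanP[a' aZ].
pose a1 i := if i == m then 1 else if (i < m)%N then - a' i else 0.
have a1Z : \sum_(i < m.+1) a1 i *: sg (k + i)%N \in ZE N.
  rewrite big_ord_recr /= {2}/a1 eqxx scale1r addrC.
  rewrite (eq_bigr (fun i : 'I_m => - (a' i *: sg (k + i)%N))) ?sumrN // => i _.
  by rewrite /a1 ltn_eqF // ltn_ord scaleNr.
have a10 : a1 0 != 0.
  apply/eqP => e0; move: a1Z; rewrite big_ord_recl e0 scale0r add0r => a1Z.
  have := eind1 (fun i => a1 i.+1); rewrite /= => /(_ _ m.-1).
  rewrite prednK // leqnn /a1 eqxx => /(_ _ isT) h.
  have /eqP : (1 : K) = 0; last by rewrite oner_eq0.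
  apply: h; suff -> : \sum_(i < m) a1 i.+1 *: sg (k.+1 + i)%N =
    \sum_(i < m) a1 (lift ord0 i) *: sg (k + lift ord0 i)%N by [].
  by apply: eq_bigr => i _; rewrite addSnnS.
pose a i := if (lt (k + i)).1 == (lt k).1 then (a1 0)^-1 * a1 i else 0.
exists a; split.
- suff -> : \sum_(i < m.+1) a i *: sg (k + i)%N = (a1 0)^-1 *:
      lpush K (fun e : Y => cgen e == (lt k).1) id (\sum_(i < m.+1) a1 i *: sg (k + i)%N).
    by apply: memvZ; apply: mask_ZE.
  rewrite linear_sum scaler_sumr; apply: eq_bigr => i _.
  rewrite [X in _ = _ *: X]mask_linkZ /a; case: eqP => _; last by rewrite !scaler0 scale0r.
  by rewrite scalerA.
- by rewrite /a addn0 eqxx mulVf.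
- move=> i; rewrite /a; case: ifP; rewrite ?eqxx // => _; rewrite mulf_eq0 negb_or.
  by case/andP=> _; rewrite /a1; case: (ltngtP i m) => //; rewrite eqxx.
by move=> i; rewrite /a; case: ifP => [/eqP|_ /eqP].
Qed.

(** If the last letter had the opposite sign, pushing forward would advance the first link and leave
    the last in place: a dependence among [m] links from [k.+1], too short for [mgap k.+1]. *)
Lemma erel_top k m a : mgap k = m -> (m <= mgap k.+1)%N -> erel k m a ->
  a m != 0 /\ lt (k + m) = lt k.
Proof.
move=> mk mk1 rel; have [nV nVm m0 mT] := mgapP k.
have [_ nV1 _ _] := mgapP k.+1; rewrite mk in nV nVm m0 mT.
case: (rel) => aZ a0 am gn; have am0 : a m != 0.
  apply/eqP => am0; move: aZ; rewrite big_ord_recr /= am0 scale0r addr0 => aZ.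
  have nE i : (i < m)%N -> sg (k + i)%N \notin wspan (ZE N) k i.
    by move=> im; apply: newVE; apply: nVm.
  by have /eqP := win_ind nE aZ m0; rewrite a0 oner_eq0.
split=> //; rewrite [RHS]surjective_pairing [LHS]surjective_pairing gn //; congr (_, _).
apply/eqP; apply: contraT => ne.
have fm : ~~ flip k true m by rewrite /flip; move: ne; case: (lt _).2; case: (lt _).2.
have f0 : flip k true 0 by rewrite /flip addn0; case: (lt _).2.
have s0 : shifted k a true 0 = 0 by rewrite /shifted f0 addr0.
have sm : shifted k a true m.+1 = 0.
  rewrite /shifted (negPf fm) addr0; case: ifP => // _; apply/eqP.
  by apply: contraT => /am; rewrite ltnn.
have := shifted_rel rel true; rewrite big_ord_recl [shifted _ _ _ _]s0 scale0r add0r.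
rewrite big_ord_recr [X in (_ + X \in _) -> _](_ : _ = 0); last first.
  by rewrite [shifted _ _ _ _]sm scale0r.
rewrite [X in X \in _]addr0 => sV.
have := @win_ind (ZV N) k.+1 m (fun i => shifted k a true i.+1).
have -> : (\sum_(i < m) shifted k a true i.+1 *: sg (k.+1 + i)%N) =
   \sum_(i < m) shifted k a true (lift ord0 (widen_ord (leqnSn m) i)) *:
     sg (k + lift ord0 (widen_ord (leqnSn m) i))%N.
  by apply: eq_bigr => i _; rewrite addSnnS.
have nW i : (i < m)%N -> sg (k.+1 + i)%N \notin wspan (ZV N) k.+1 i.
  by move=> im; apply: nV1; apply: leq_trans mk1.
by move=> /(_ nW sV 0 m0)/eqP; rewrite (shiftedR rel) ?a0 ?oner_eq0.
Qed.

(** * Propagation of a short dependence along the word *)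

Section Forest.
Variables k1 m : nat.
Hypotheses (gapm : forall k, (k1 <= k)%N -> mgap k = m).
Hypothesis mT : (m < T)%N.
Hypothesis aperiodic : forall k i,
  (forall n, lt (k + n + i) = lt (k + n)) -> (L.+1 %| i)%N.
Hypothesis NB1 : N (B L.+1) (B 0).
Hypothesis Tmin : forall t, (0 < t < T)%N -> (L.+1 %| t)%N -> ~~ N (A t) (A 0).

Let gap_le k : (k1 <= k)%N -> (m <= mgap k.+1)%N.
Proof. by move=> k1k; rewrite gapm // ltnW. Qed.

(** The letter at [k] finishes where the next one begins. The dependence at [k] pushed forward and
    the one at [k.+1] pushed backward both start with coefficient 1 at [k.+1]; their difference
    lives on the next [m] links, which are independent. *)
Lemma erel_step k a : (k1 <= k)%N -> erel k m a -> exists a',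
  erel k.+1 m a' /\ forall j, (j <= m)%N -> shifted k a true j.+1 = shifted k.+1 a' false j.
Proof.
move=> k1k rel; have k1k1 : (k1 <= k.+1)%N by apply: ltnW.
have [a' rel'] := erel_exists (gapm k1k1) (gap_le k1k1).
exists a'; split=> //.
have [_ top'] := erel_top (gapm k1k1) (gap_le k1k1) rel'.
case: (rel) => _ a0 am gn; case: (rel') => _ a0' am' gn'.
have r0 : shifted k a true 0 = 0 by rewrite /shifted /flip addn0; case: (lt k).2.
have r1 : shifted k a true 1 = 1.
  by rewrite (shiftedR rel) ?a0 ?oner_eq0 // /flip addn0; case: (lt k).2.
have rm : shifted k.+1 a' false m.+1 = 0.
  rewrite /shifted {2}/flip top' /= addbb addr0; case: ifP => // _; apply/eqP.
  by apply: contraT => /am'; rewrite ltnn.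
have r1' : shifted k.+1 a' false 0 = 1.
  by rewrite /shifted /flip addn0 addbb addr0 a0'.
have V1 : \sum_(j < m.+1) shifted k a true j.+1 *: sg (k.+1 + j)%N \in ZV N.
  have := shifted_rel rel true; rewrite big_ord_recl [shifted _ _ _ _]r0 scale0r add0r.
  by under eq_bigr do rewrite -addSnnS.
have V2 : \sum_(j < m.+1) shifted k.+1 a' false j *: sg (k.+1 + j)%N \in ZV N.
  have := shifted_rel rel' false; rewrite big_ord_recr [X in (_ + X \in _) -> _](_ : _ = 0).
    by rewrite [X in X \in _]addr0.
  by rewrite [shifted _ _ _ _]rm scale0r.
pose b j := shifted k a true j.+1 - shifted k.+1 a' false j.
have b0 : b 0 = 0 by rewrite /b r1 r1' subrr.
have VB : \sum_(j < m.+1) b j *: sg (k.+1 + j)%N \in ZV N.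
  by under eq_bigr do rewrite scalerBl; rewrite sumrB memvB.
have VB' : \sum_(j < m) b j.+1 *: sg (k.+2 + j)%N \in ZV N.
  move: VB; rewrite big_ord_recl [b _]b0 scale0r add0r.
  by under eq_bigr do rewrite -addSnnS.
have k1k2 : (k1 <= k.+2)%N by apply: ltnW.
have [_ nV _ _] := mgapP k.+2; rewrite (gapm k1k2) in nV.
have h : forall i, (i < m)%N -> b i.+1 = 0 by apply: (win_ind _ VB') => i /nV.
by case=> [_|j jm]; apply/eqP; rewrite -subr_eq0; apply/eqP; [exact: b0 | exact: h].
Qed.

Lemma flip_lt k a i : erel k m a -> a i != 0 -> ~~ flip k false i -> lt (k + i) = lt k.
Proof.
move=> [_ _ _ gn] ai; rewrite /flip /= => ne.
rewrite [LHS]surjective_pairing [RHS]surjective_pairing gn //; congr (_, _).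
by case: (lt k).2 (lt (k + i)).2 ne => [] [].
Qed.

(** A letter of opposite sign at offset [i] does not move when pushed forward, so it appears at
    offset [i - 1] for the next dependence. There it comes either from a letter equal to the next
    one, which would then cancel the letter at [k], or from a letter of opposite sign at offset
    [i - 2], excluded by induction. *)
Lemma erel_plus i k a : (k1 <= k)%N -> erel k m a -> a i != 0 -> ~~ flip k false i.
Proof.
elim/ltn_ind: i k a => i IHi k a k1k rel ai; apply/negP => fi.
have ft : ~~ flip k true i by move: fi; rewrite /flip /=; case: (_ (+) _).
case: (rel) => _ a0 am gn.
case: i IHi ai fi ft => [|i] IHi ai fi ft; first by rewrite /flip addn0 addbb in fi.
have [a' [rel' ea]] := erel_step k1k rel.
have := ea i (ltnW (am _ ai)); rewrite (shiftedL rel ft ai) => es.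
have k1k1 : (k1 <= k.+1)%N by apply: ltnW.
have : shifted k.+1 a' false i != 0 by rewrite -es.
case/shifted_neq0 => [[f1 a1]|[j [ej f1 a1]]].
  have := flip_lt rel' a1 f1; rewrite addSnnS => el.
  have /eqP := lt_red k; apply; rewrite -el.
  rewrite [LHS]surjective_pairing gn // /linv; congr (_, _).
  by move: fi; rewrite /flip /=; case: (lt k).2; case: (lt _).2.
by have := IHi j _ k.+1 a' k1k1 rel' a1; rewrite f1 ej => /(_ (leqnSn _)).
Qed.

(** With all signs equal, pushing forward is a shift by one and pushing backward is no shift, so the
    support is carried along unchanged. *)
Lemma erel_supp k a n : (k1 <= k)%N -> erel k m a ->
  exists2 a', erel (k + n) m a' & forall i, a i != 0 -> a' i != 0.
Proof.
move=> k1k rel; elim: n => [|n [a1 rel1 h1]]; first by exists a; rewrite ?addn0.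
have k1n : (k1 <= k + n)%N by apply: leq_trans (leq_addr _ _).
have [a' [rel' ea]] := erel_step k1n rel1; exists a'; rewrite ?addnS // => i /h1 ai.
have fi := erel_plus k1n rel1 ai.
have ft : flip (k + n) true i by move: fi; rewrite /flip /=; case: (_ (+) _).
case: (rel1) => _ _ am _; have := ea i (am _ ai); rewrite (shiftedR rel1 ft ai) => es.
have : shifted (k + n).+1 a' false i != 0 by rewrite -es.
case/shifted_neq0 => [[]//|[j [ej f1 aj]]].
have k1n1 : (k1 <= (k + n).+1)%N by apply: ltnW.
by have := erel_plus k1n1 rel' aj; rewrite f1.
Qed.

(** An offset in the support is a period of the word, hence a multiple of its length. At such
    offsets, below [T], the edges from [x] are in classes distinct from that of [A k1], and those
    from [s] all lie in the class of [B k1]. The sum over the class of [A k1] is thus the first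
    coefficient, 1, whereas it should vanish. *)
Lemma forest_contra : False.
Proof.
have [a rel] := erel_exists (gapm (leqnn k1)) (gap_le (leqnn k1)).
have Ldiv i : a i != 0 -> (L.+1 %| i)%N.
  move=> ai; apply: (aperiodic (k := k1)) => n.
  have [a' rel' h] := erel_supp n (leqnn k1) rel.
  have k1n := leq_addr n k1.
  by apply: (flip_lt rel') (h _ ai) _; apply: (erel_plus k1n rel'); apply: h.
case: (rel) => /clsumP aZ a0 am _; have eN := cN.1.
have eE := cedge_equiv eN.
have nAE i : (L.+1 %| i)%N -> (0 < i < T)%N -> ~~ cedge N (A (k1 + i)) (A k1).
  move=> Li iT; rewrite cedge_same //.
    rewrite {1}/A iterD ccl_iter ?Tmin //.
    by rewrite iter_cnext_ord iter_ord0.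
  by rewrite /A !iter_cnext_ord iterD iter_ord0.
have BB i : (L.+1 %| i)%N -> N (B i) (B 0).
  case/dvdnP => q ->; elim: q => [|q IHq]; first by rewrite mul0n eqr_refl.
  apply: (eqr_trans eN _ NB1); rewrite mulSn {1}/B iterD ccl_iter //.
  by rewrite iter_cnext_ord iter_ord0 // dvdn_mull.
have nBE i : (L.+1 %| i)%N -> ~~ cedge N (B (k1 + i)) (A k1).
  move=> Li; rewrite cedge_same //; last by rewrite -AB /A !iter_cnext_ord iterD iter_ord0.
  rewrite {1}/B iterD ccl_iter //; last by rewrite iter_cnext_ord iter_ord0.
  apply/negP => NBA; have := NAB 0; rewrite (eqr_sym eN) => /negP; apply.
  by apply: (eqr_trans eN) NBA; rewrite (eqr_sym eN) BB.
have := aZ (pi (cedge N) (A k1)); rewrite (eq_bigr (fun z =>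
   \sum_(i < m.+1) a i * ((z == A (k1 + i))%:R - (z == B (k1 + i))%:R))) => [|z _]; last first.
  rewrite sum_ffunE; apply: eq_bigr => i _; rewrite /sg !ffunE.
  by [].
rewrite exchange_big /= big_ord_recl [X in _ + X]big1 => [|i _]; last first.
  rewrite -mulr_sumr; have [->|ai] := eqVneq (a (lift ord0 i)) 0; first by rewrite mul0r.
  rewrite sumrB !big1 ?subrr ?mulr0 // => z; rewrite piE //.
    by case: eqP => // -> ; rewrite (negPf (nBE _ (Ldiv _ ai))).
  case: eqP => // ->; rewrite (negPf (nAE _ (Ldiv _ ai) _)) //=.
  by apply: leq_ltn_trans (am _ ai) mT.
rewrite addr0 -mulr_sumr a0 mul1r sumrB (bigD1 (A k1)) ?eqxx //= addn0 eqxx.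
rewrite !big1 ?addr0 ?subr0; first by move/eqP; rewrite oner_eq0.
  move=> z; rewrite piE //; case: eqP => // ->; have := nBE 0 (dvdn0 _).
  by rewrite addn0 => /negPf->.
by move=> z /andP[_ /negPf->].
Qed.

End Forest.

Section Leaf.
Hypothesis aperiodic : forall k i,
  (forall n, lt (k + n + i) = lt (k + n)) -> (L.+1 %| i)%N.
Hypothesis NB1 : N (B L.+1) (B 0).
Hypothesis Tmin : forall t, (0 < t < T)%N -> (L.+1 %| t)%N -> ~~ N (A t) (A 0).

(** The dependence at [k], pushed forward, is a vertex dependence among [m + 1] links from
    [k.+1]. *)
Lemma mgap_step k m : mgap k = m -> (m <= mgap k.+1)%N -> (mgap k.+1 <= m)%N.
Proof.
move=> mk mk1; have [a rel] := erel_exists mk mk1; rewrite leqNgt; apply/negP => lm.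
have [_ nV _ _] := mgapP k.+1; case: (rel) => _ a0 _ _.
have r0 : shifted k a true 0 = 0 by rewrite /shifted /flip addn0; case: (lt k).2.
have := shifted_rel rel true; rewrite big_ord_recl [shifted _ _ _ _]r0 scale0r add0r.
under eq_bigr do rewrite -addSnnS.
have nW i : (i < m.+1)%N -> sg (k.+1 + i)%N \notin wspan (ZV N) k.+1 i.
  by move=> im; apply: nV; apply: leq_trans lm.
move=> /(win_ind (a := fun j => shifted k a true j.+1) nW)/(_ 0 isT)/eqP.
by rewrite (shiftedR rel) ?a0 ?oner_eq0 // /flip addn0; case: (lt k).2.
Qed.

(** The smallest gap, once attained, persists by [mgap_step]. If some gap is below [T], so is the
    smallest, and the propagation above gives a contradiction. *)
Lemma link_indep (a : nat -> K) :
  \sum_(i < T) a i *: sg i \in ZE N -> forall i, (i < T)%N -> a i = 0.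
Proof.
have [mT|mT] := ltnP (mgap 0) T; last first.
  have [_ nV _ _] := mgapP 0; apply: (@win_ind (ZE N) 0) => i iT.
  by apply: newVE; apply: nV; apply: leq_trans mT.
have exm : exists m, `[< exists k, mgap k = m >] by exists (mgap 0); apply/asboolP; exists 0%N.
case: (ex_minnP exm) => m /asboolP[k1 k1m] mmin.
have min k : (m <= mgap k)%N by apply: mmin; apply/asboolP; exists k.
have gapm k : (k1 <= k)%N -> mgap k = m.
  move=> /subnKC <-; elim: (k - k1)%N => [|n IHn]; first by rewrite addn0.
  apply/eqP; rewrite eqn_leq min andbT addnS; exact: mgap_step.
by case: (forest_contra gapm (leq_ltn_trans (min 0%N) mT) aperiodic NB1 Tmin).
Qed.

Definition incid (j : 'I_T * bool) : Y := if j.2 then B j.1 else A j.1.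

(** If every edge class met were met twice, the [2T] incidences would fall in at most [T] classes.
    Each link has coefficients of sum zero over these classes, so the [T] links would be dependent
    modulo [ZE N]. *)
Lemma leaf_exists : exists j : 'I_T * bool,
  forall j' : 'I_T * bool, j' != j -> ~~ cedge N (incid j') (incid j).
Proof.
have eE := cedge_equiv cN.1.
apply: contrapT => noleaf.
pose f j := pi (cedge N) (incid j).
have two j : (1 < #|[set j' | f j' == f j]|)%N.
  have [j' jj' ejj'] : exists2 j', j' != j & cedge N (incid j') (incid j).
    apply: contrapT => nj; apply: noleaf; exists j => j' jj'; apply/negP => e.
    by apply: nj; exists j'.
  rewrite (cardsD1 j) inE eqxx (cardsD1 j') !inE jj' /f piE // ejj'.
  by [].
pose U := f @: [set: 'I_T * bool].
have UT : (#|U| <= T)%N.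
  have : (\sum_(u in U) 2 <= \sum_(u in U) #|[set j' | f j' == u]|)%N.
    by apply: leq_sum => _ /imsetP[j _ ->]; apply: two.
  rewrite sum_nat_const; have <- : (\sum_(j : 'I_T * bool) 1 = \sum_(u in U) #|[set j' | f j' == u]|)%N.
    rewrite (partition_big f (mem U)) => [|j _]; last exact: imset_f.
    by apply: eq_bigr => u _; rewrite sum1_card; apply: eq_card => j; rewrite !inE.
  by rewrite sum1_card card_prod card_ord card_bool leq_pmul2r.
pose u0 := f (Ordinal T0, false).
pose cs (t : 'I_T) q : K := (pi (cedge N) (A t) == q)%:R - (pi (cedge N) (B t) == q)%:R.
(* The class [u0] is dropped: its coordinate is determined by the others, the total being zero. This
   leaves fewer than [T] columns. *)
pose M : 'M[K]_(T, #|U :\ u0|) := \matrix_(t, u) cs t (enum_val u).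
have /rowV0Pn[v] : kermx M != 0.
  rewrite kermx_eq0 -row_leq_rank -ltnNge; apply: leq_ltn_trans (rank_leq_col _) _.
  by apply: leq_trans UT; rewrite [leqRHS](cardsD1 u0) imset_f.
rewrite sub_kermx => /eqP vM /eqP v0; apply: v0.
pose a t := if insub t is Some i then v 0 i else 0.
have aE (i : 'I_T) : a i = v 0 i by rewrite /a valK.
have csE q : \sum_(z | pi (cedge N) z == q) (\sum_(i < T) a i *: sg i) z =
    \sum_(i < T) a i * cs i q.
  rewrite (eq_bigr (fun z => \sum_(i < T) a i * ((z == A i)%:R - (z == B i)%:R))) => [|z _]; last first.
    by rewrite sum_ffunE; apply: eq_bigr => i _; rewrite /sg !ffunE.
  rewrite exchange_big /=; apply: eq_bigr => i _; rewrite -mulr_sumr; congr (_ * _).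
  rewrite sumrB /cs; congr (_ - _).
    rewrite big_mkcond (bigD1 (A i)) //= eqxx big1 ?addr0 => [|z /negPf->]; last by rewrite if_same.
    by case: ifP.
  rewrite big_mkcond (bigD1 (B i)) //= eqxx big1 ?addr0 => [|z /negPf->]; last by rewrite if_same.
  by case: ifP.
have csU q : q \in U :\ u0 -> \sum_(i < T) a i * cs i q = 0.
  move=> qU; have := congr1 (fun w : 'rV_ _ => w 0 (enum_rank_in qU q)) vM.
  rewrite mxE [RHS]mxE => e; rewrite -[RHS]e; apply: eq_bigr => i _.
  by rewrite mxE enum_rankK_in // aE.
have csn q : q \notin U -> \sum_(i < T) a i * cs i q = 0.
  move=> qU; rewrite big1 // => i _; rewrite /cs.
  have qA b : (f (i, b) == q) = false.
    by apply: contraNF qU => /eqP<-; apply: imset_f.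
  by have := qA false; have := qA true; rewrite /f /= => -> ->; rewrite subrr mulr0.
have cs0 : \sum_(i < T) a i * cs i u0 = 0.
  have tot : \sum_q \sum_(i < T) a i * cs i q = 0.
    rewrite exchange_big big1 //= => i _; rewrite -mulr_sumr sumrB.
    have one (y : Y) : \sum_q (pi (cedge N) y == q)%:R = 1 :> K.
      rewrite (bigD1 (pi (cedge N) y)) //= eqxx big1 ?addr0 // => q.
      by rewrite eq_sym => /negPf->.
    by rewrite !one subrr mulr0.
  move: tot; rewrite (bigD1 u0) //= [X in _ + X]big1 ?addr0 // => q qu0.
  by have [qU|qU] := boolP (q \in U); [rewrite csU ?inE ?qu0 | rewrite csn].
have aZ : \sum_(i < T) a i *: sg i \in ZE N.
  apply/clsumP => q; rewrite csE; have [->//|qu0] := eqVneq q u0.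
  by have [qU|qU] := boolP (q \in U); [rewrite csU ?inE ?qu0 | rewrite csn].
by apply/rowP => i; rewrite mxE -aE; apply: (link_indep aZ).
Qed.

End Leaf.

End Fold.
End Merge.

(** * Subgroups carried by folded quotients *)

Section QuotientGraph.
Local Open Scope group_scope.
Variable R : rel Y.
Hypothesis cR : ccl R.
Let eR : equivalence_rel R. Proof. by case: cR. Qed.
Let eE : equivalence_rel (cedge R). Proof. exact: cedge_equiv. Qed.

Definition qorg (e : quo (cedge R)) : quo R := pi R (corg (qrep e)).
Definition qtgt (e : quo (cedge R)) : quo R := pi R (ctgt (qrep e)).
Definition qgen (e : quo (cedge R)) : I := cgen (qrep e).
Definition qlab (e : quo (cedge R)) : freeGroup I := fgl (qgen e, false).

Lemma qedge_rep y : cgen (qrep (pi (cedge R) y)) = cgen y /\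
  forall d : bool, R ((if d then ctgt else corg) y)
    ((if d then ctgt else corg) (qrep (pi (cedge R) y))).
Proof.
have r := qrepP eE y; case/andP: (r) => /eqP e _; split=> // d.
by rewrite -(cedge_end d cR).
Qed.

Lemma qorg_pi y : qorg (pi _ y) = pi R (corg y).
Proof.
by apply/eqP; rewrite /qorg piE // eqr_sym //; have [_ /(_ false)] := qedge_rep y.
Qed.

Lemma qtgt_pi y : qtgt (pi _ y) = pi R (ctgt y).
Proof.
by apply/eqP; rewrite /qtgt piE // eqr_sym //; have [_ /(_ true)] := qedge_rep y.
Qed.

Lemma qgen_pi y : qgen (pi _ y) = cgen y.
Proof. by rewrite /qgen; case: (qedge_rep y). Qed.

Lemma qfold_org : injective (fun e => (qgen e, qorg e)).
Proof.
move=> e e' h; have eg := congr1 fst h; have /eqP := congr1 snd h.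
rewrite /= /qorg piE // => eo.
by rewrite -(qrepK e) -(qrepK e'); apply/eqP; rewrite piE // /cedge eo andbT; apply/eqP.
Qed.

Lemma qfold_tgt : injective (fun e => (qgen e, qtgt e)).
Proof.
move=> e e' h; have eg := congr1 fst h; have /eqP := congr1 snd h.
rewrite /= /qtgt piE // -cR.2 // => eo.
by rewrite -(qrepK e) -(qrepK e'); apply/eqP; rewrite piE // /cedge eo andbT; apply/eqP.
Qed.

Definition qwalk Es u v g := walk qorg qtgt qlab Es u v g.

Lemma qwalk_step (Es : {set quo (cedge R)}) u y g : pi (cedge R) y \in Es -> qwalk Es u (pi R y) g ->
  qwalk Es u (pi R (cnext y)) (g * fgl (c y.2)).
Proof.
move=> yE; have lab : qlab (pi _ y) = fgl (cgen y, false) by rewrite /qlab qgen_pi.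
have o := qorg_pi y; have t := qtgt_pi y; move: o t; rewrite /corg /ctgt.
case cy: (c y.2) => [b []] /=.
  move=> <- <- w; rewrite (_ : fgl (b, true) = (qlab (pi _ y))^-1).
    exact: walkB.
  by rewrite lab -fgl_linv /cgen cy.
by move=> <- <- w; rewrite (_ : fgl (b, false) = qlab (pi _ y)); [apply: walkF | rewrite lab /cgen cy].
Qed.

Fixpoint pword t y := if t is t'.+1 then pword t' y * fgl (c (iter t' cnext y).2) else 1.

Lemma qwalk_path (Es : {set quo (cedge R)}) u y g t : (forall i, (i < t)%N -> pi (cedge R) (iter i cnext y) \in Es) ->
  qwalk Es u (pi R y) g -> qwalk Es u (pi R (iter t cnext y)) (g * pword t y).
Proof.
move=> + w; elim: t => [|t IHt] iE /=; first by rewrite mulg1.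
rewrite mulgA; apply: qwalk_step; first exact: iE.
by apply: IHt => i it; apply: iE; apply: ltnW.
Qed.

(* [phi] descends to the cosets of [H] on the quotient graph. *)
Section Potential.
Variables (H : freeGroup I -> Prop) (phi : Y -> freeGroup I).
Hypotheses (sH : subgrp H).
Hypothesis phi_edge : forall y, H (phi y * fgl (c y.2) * (phi (cnext y))^-1).

Definition pot : rel Y := fun y y' => `[< H (phi y * (phi y')^-1) >].

Lemma pot_chord y : H (phi (corg y) * fgl (cgen y, false) * (phi (ctgt y))^-1).
Proof.
case: sH => H1 HM HV; have := phi_edge y; rewrite /corg /ctgt /cgen.
case: (c y.2) => b [] //= /HV; rewrite !invMg invgK mulgA.
by rewrite -fgl_linv.
Qed.

Lemma pot_ccl : ccl pot.
Proof.
case: sH => H1 HM HV; split.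
  apply: equivalence_relT => [y|y y'|y y' y''].
  - by apply/asboolP; rewrite mulgV.
  - by apply/asboolP/asboolP => /HV; rewrite invMg invgK.
  - by move=> /asboolP h1 /asboolP h2; apply/asboolP; have := HM _ _ h1 h2; rewrite mulgA mulgKV.
move=> y y' e; have h := pot_chord y; have h' := pot_chord y'; rewrite -e in h'.
apply/asboolP/asboolP => k.
  by have := HM _ _ (HM _ _ (HV _ h) k) h'; rewrite !invMg !invgK !mulgA !(mulgK, mulgKV).
by have := HM _ _ (HM _ _ h k) (HV _ h'); rewrite !invMg !invgK !mulgA !(mulgK, mulgKV).
Qed.

Hypothesis Rpot : forall y y', R y y' -> pot y y'.

Lemma pot_walk (Es : {set quo (cedge R)}) y0 y g : qwalk Es (pi R y0) (pi R y) g ->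
  H (phi y0 * g * (phi y)^-1).
Proof.
case: sH => H1 HM HV.
have ext z z' x : R z z' -> H (x * (phi z)^-1) -> H (x * (phi z')^-1).
  by move=> /Rpot/asboolP h k; have := HM _ _ k h; rewrite mulgA mulgKV.
move=> w; suff K v : qwalk Es (pi R y0) v g -> forall z, v = pi R z -> H (phi y0 * g * (phi z)^-1).
  exact: K w y erefl.
elim=> [|e x eEs _ IH|e x eEs _ IH] z.
- by move/eqP; rewrite piE // => /ext; apply; rewrite mulg1 mulgV.
- move/eqP; rewrite piE // => /ext; apply.
  have := HM _ _ (IH _ erefl) (pot_chord (qrep e)).
  by rewrite /qlab /qgen !mulgA !(mulgK, mulgKV).
move/eqP; rewrite piE // => /ext; apply.
have := HM _ _ (IH _ erefl) (HV _ (pot_chord (qrep e))).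
by rewrite /qlab /qgen !invMg !invgK !mulgA !(mulgK, mulgKV).
Qed.

End Potential.

End QuotientGraph.

Section MarkedGroups.
Local Open Scope group_scope.

Fixpoint pre t : freeGroup I :=
  if t is t'.+1 then pre t' * fgl (c (iter t' (@ordS _) ord0)) else 1.

Lemma pword_pre t x : pword t (x, ord0) = pre t.
Proof. by elim: t => //= t ->; rewrite iter_cnext_ord. Qed.

Lemma pword_add a b y : pword (a + b)%N y = pword a y * pword b (iter a cnext y).
Proof.
elim: b => [|b IHb]; first by rewrite addn0 /= mulg1.
by rewrite addnS /= IHb mulgA addnC iterD.
Qed.

Definition cycword := pre L.+1.
Local Notation W := cycword.

Lemma iter_mark x (i : 'I_L.+1) : iter i cnext (x, ord0) = (x, i).
Proof.
have [i' iE] : exists i' : nat, nat_of_ord i = i' by exists i.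
rewrite iE; elim: i' i iE => [|i' IH] i iE /=; first by congr pair; apply: val_inj.
have i'L : (i' < L.+1)%N by rewrite -ltnS -iE ltnW // ltnS ltn_ord.
rewrite (IH (Ordinal i'L) erefl) /cnext /=; case: eqP => [/(congr1 val) /= e|_].
  by exfalso; move: (ltn_ord i); rewrite iE e ltnn.
by congr pair; apply: val_inj; rewrite /= iE modn_small // -iE.
Qed.

Lemma iter_cycle x : iter L.+1 cnext (x, ord0) = (tau x, ord0).
Proof.
rewrite /= (iter_mark x ord_max) /cnext eqxx; congr pair; apply: val_inj.
by rewrite /= modnn.
Qed.

Lemma pre_add a b : (L.+1 %| a)%N -> pre (a + b)%N = pre a * pre b.
Proof.
move=> aL; elim: b => [|b IHb]; first by rewrite addn0 /= mulg1.
rewrite addnS /= IHb mulgA; congr (_ * fgl (c _)); apply: ord_inj.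
by rewrite !val_iter_ordS !add0n -modnDml (eqP aL).
Qed.

Lemma pre_mod t : (L.+1 %| t)%N -> pre t = W ^+ (t %/ L.+1)%N.
Proof.
move=> /dvdnP[j ->]; rewrite mulnK //; elim: j => // j IHj.
by rewrite mulSn pre_add ?dvdnn // IHj expgS.
Qed.

(** The loops of the quotient of a single cycle onto which [N] projects. This subgroup is defined
    even when the base points of [N] are not identified, and merging them does not change it. *)
Definition prg N : freeGroup I -> Prop :=
  gen (fun g => g = W \/ exists a b, N a b /\ g = pre a.2 * (pre b.2)^-1).

Lemma prg_subgrp N : subgrp (prg N).
Proof. exact: gen_subgrp. Qed.

Lemma prg_W N : prg N W.
Proof. by apply: gen_in; left. Qed.

Lemma prg_in N a b : N a b -> prg N (pre a.2 * (pre b.2)^-1).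
Proof. by move=> Nab; apply: gen_in; right; exists a, b. Qed.

Lemma prg_min N H : subgrp H -> H W ->
  (forall a b, N a b -> H (pre a.2 * (pre b.2)^-1)) -> forall g, prg N g -> H g.
Proof. by move=> sH HW HN; apply: gen_min => // g [->//|[a [b [Nab ->]]]]; apply: HN. Qed.

Lemma pre_edge H y : subgrp H -> H W ->
  H (pre y.2 * fgl (c y.2) * (pre (cnext y).2)^-1).
Proof.
move=> [H1 _ _] HW; have -> : pre y.2 * fgl (c y.2) = pre y.2.+1.
  rewrite /=; congr (_ * fgl (c _)); apply: ord_inj.
  by rewrite val_iter_ordS add0n modn_small.
rewrite /cnext /=; have [e|ne] := eqVneq (nat_of_ord y.2) L; last first.
  by rewrite modn_small ?mulgV // ltnS ltn_neqAle ne -ltnS ltn_ord.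
by rewrite e modnn invg1 mulg1.
Qed.

Lemma pot_pre H : subgrp H -> H W -> ccl (pot H (fun y => pre y.2)).
Proof. by move=> sH HW; apply: pot_ccl => // y; apply: pre_edge. Qed.

(** Equality of the prefixes modulo [H] is itself a folded congruence, so the closure adds no
    element. *)
Lemma prg_cclos (P : Y -> Y -> Prop) H : subgrp H -> H W ->
  (forall a b, P a b -> H (pre a.2 * (pre b.2)^-1)) ->
  forall g, prg (cclos P) g -> H g.
Proof.
move=> sH HW PH; apply: prg_min => // a b Cab; apply/asboolP.
exact: (cclos_min (pot_pre sH HW) (fun a b Pab => introT (asboolP _) (PH a b Pab)) Cab).
Qed.

Section Walks.
Variable N : rel Y.
Hypothesis cN : ccl N.

Lemma qwalk_prg (Es : {set quo (cedge N)}) x s g :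
  qwalk Es (pi N (x, ord0)) (pi N (s, ord0)) g -> prg N g.
Proof.
move=> /(@pot_walk _ cN (prg N) (fun y => pre y.2)) h.
have := h (prg_subgrp N) (fun y => pre_edge y (prg_subgrp N) (prg_W N))
  (fun a b Nab => introT (asboolP _) (prg_in Nab)).
by rewrite mul1g invg1 mulg1.
Qed.

Lemma qwalk_pre (Es : {set quo (cedge N)}) s t :
  (forall i, (i < t)%N -> pi (cedge N) (iter i cnext (s, ord0)) \in Es) ->
  qwalk Es (pi N (s, ord0)) (pi N (iter t cnext (s, ord0))) (pre t).
Proof.
move=> iE; rewrite -(pword_pre _ s) -(mul1g (pword _ _)); apply: (qwalk_path cN iE).
exact: walk0.
Qed.

Lemma qwalk_mark s (i : 'I_L.+1) : qwalk setT (pi N (s, ord0)) (pi N (s, i)) (pre i).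
Proof. by rewrite -[(s, i)]iter_mark; apply: qwalk_pre => *; rewrite inE. Qed.

Lemma merged_mark s a : (forall u, N (u, ord0) (s, ord0)) -> N a (s, a.2).
Proof.
by case: a => u i mg /=; rewrite -[(s, _)]iter_mark -[(u, _)]iter_mark ccl_iter.
Qed.

Lemma qwalk_cycle s : N (tau s, ord0) (s, ord0) ->
  qwalk setT (pi N (s, ord0)) (pi N (s, ord0)) W.
Proof.
move=> Ns; rewrite [X in qwalk _ _ X _](_ : _ = pi N (iter L.+1 cnext (s, ord0))); last first.
  by apply/eqP; rewrite iter_cycle eq_sym piE //; case: cN.
by apply: qwalk_pre => *; rewrite inE.
Qed.

Lemma prg_walk s g : (forall u, N (u, ord0) (s, ord0)) ->
  prg N g <-> qwalk setT (pi N (s, ord0)) (pi N (s, ord0)) g.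
Proof.
move=> mg; split; last exact: qwalk_prg.
apply: prg_min; [exact: walk_subgrp|exact: qwalk_cycle|move=> a b Nab].
apply: (@walk_trans _ _ _ _ _ _ _ _ (pi N (s, a.2))); first exact: qwalk_mark.
apply: walk_sym; have -> : pi N (s, a.2) = pi N (s, b.2); last exact: qwalk_mark.
apply/eqP; rewrite piE; last by case: cN.
apply: (eqr_trans cN.1 _ (merged_mark b mg)); apply: (eqr_trans cN.1 _ Nab).
by rewrite (eqr_sym cN.1); apply: merged_mark.
Qed.

Definition conn s := forall v, exists g, qwalk setT (pi N (s, ord0)) v g.

Lemma merged_conn s : (forall u, N (u, ord0) (s, ord0)) -> conn s.
Proof.
move=> mg v; have [a /eqP->] := pi_surj v; exists (pre a.2).
have -> : pi N a = pi N (s, a.2); last exact: qwalk_mark.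
by apply/eqP; rewrite piE; [exact: merged_mark | case: cN].
Qed.

Lemma conn_gen_le s k : conn s -> (#|{: quo (cedge N)}| < #|{: quo N}| + k)%N ->
  exists z, (size z <= k)%N /\
    forall g, qwalk setT (pi N (s, ord0)) (pi N (s, ord0)) g <-> gens z g.
Proof.
move=> cs lt; have [z [sz zP]] := walk_gens cs; exists z; split=> //.
by move: sz lt; rewrite cardsT; move: #|_| #|_|; clear; lia.
Qed.

End Walks.

Lemma conn_sub N F s : ccl N -> ccl F -> (forall a b, N a b -> F a b) -> conn N s -> conn F s.
Proof.
move=> cN cF NF cs v; have [a /eqP->] := pi_surj v; have [g w] := cs (pi N a); exists g.
suff K u h : qwalk setT (pi N (s, ord0)) u h ->
    forall z, u = pi N z -> qwalk setT (pi F (s, ord0)) (pi F z) h by apply: K w a erefl.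
have E z z' : pi N z = pi N z' -> pi F z = pi F z'.
  move=> /eqP; rewrite piE; last exact: cN.1.
  by move=> h'; apply/eqP; rewrite piE; [apply: NF | apply: cF.1].
have Q (e : quo (cedge N)) : exists e' : quo (cedge F), [/\ qlab e = qlab e', qorg e' = pi F (corg (qrep e)) & qtgt e' = pi F (ctgt (qrep e))].
  by exists (pi (cedge F) (qrep e)); rewrite qorg_pi // qtgt_pi // /qlab qgen_pi.
elim=> [|e x _ _ IH|e x _ _ IH] z ez.
- by rewrite (E _ _ ez); apply: walk0.
- have [e' [-> o t]] := Q e; rewrite -(E _ _ ez) -t.
  by apply: walkF; rewrite ?inE // o; apply: IH.
have [e' [-> o t]] := Q e; rewrite -(E _ _ ez) -o.
by apply: walkB; rewrite ?inE // t; apply: IH.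
Qed.

End MarkedGroups.

(** * Removing an edge that a loop uses exactly once *)

Section RemoveEdge.
Variables (G : groupType) (V E : finType) (org tgt : E -> V) (lab : E -> G).
Variables (e0 : E) (u : V).
Local Open Scope group_scope.
Local Notation wk := (walk org tgt lab).
Local Notation Es := (~: [set e0]).

Lemma walk_reroute v g h : wk Es (org e0) (tgt e0) h -> wk setT u v g ->
  exists g', wk Es u v g'.
Proof.
move=> w0; elim=> [|e x _ _ [g' IH]|e x _ _ [g' IH]]; first by exists 1; apply: walk0.
  have [ee|ne] := eqVneq e e0; last first.
    by exists (g' * lab e); apply: walkF; rewrite ?inE.
  by rewrite ee in IH *; exists (g' * h); apply: walk_trans w0.
have [ee|ne] := eqVneq e e0; last first.
  by exists (g' * (lab e)^-1); apply: walkB; rewrite ?inE.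
by rewrite ee in IH *; exists (g' * h^-1); apply: walk_trans (walk_sym w0).
Qed.

Lemma walk_remove (H : G -> Prop) phi : subgrp H -> phi u = 1 ->
  (forall v, wk Es u v (phi v)) -> (forall g, wk Es u u g -> H g) ->
  H (chord org tgt lab phi e0) -> forall g, wk setT u u g -> H g.
Proof.
move=> [H1 HM HV] pu wphi KH H0 g.
have HE e : H (chord org tgt lab phi e).
  have [->//|ne] := eqVneq e e0; apply: KH.
  by apply: (@walk_chord _ _ _ _ _ _ _ setT); rewrite ?inE.
suff K v : wk setT u v g -> H (g * (phi v)^-1) by move=> /K; rewrite pu invg1 mulg1.
elim=> [|e x _ _ IH|e x _ _ IH]; first by rewrite pu mulgV.
  by have := HM _ _ IH (HE e); rewrite /chord !mulgA !(mulgK, mulgKV).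
by have := HM _ _ IH (HV _ (HE e)); rewrite /chord !invMg !invgK !mulgA !(mulgK, mulgKV).
Qed.

End RemoveEdge.

Section LeafEdge.
Local Open Scope group_scope.
Variables (N : rel Y) (x s : X) (T t0 : nat).
Hypothesis cN : ccl N.
Let A t := iter t cnext (x, ord0 : 'I_L.+1).
Hypotheses (t0T : (t0 < T)%N) (NAT : N (A T) (A 0)).
Hypothesis leaf : forall t, (t < T)%N -> t != t0 -> ~~ cedge N (A t) (A t0).
Let eps := pi (cedge N) (A t0).
Let Es := ~: [set eps].
Let eE := cedge_equiv cN.1.

Let inEs t : (t < T)%N -> t != t0 -> pi (cedge N) (A t) \in Es.
Proof. by move=> tT tt; rewrite !inE piE //; apply: leaf. Qed.

Let path1 : qwalk Es (pi N (A 0)) (pi N (A t0)) (pword t0 (A 0)).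
Proof.
rewrite -(mul1g (pword _ _)); apply: (qwalk_path cN) => [i it|]; last exact: walk0.
by apply: inEs; [apply: ltn_trans t0T | rewrite ltn_eqF].
Qed.

Let p2 := pword (T - t0.+1) (A t0.+1).

Let path2 : qwalk Es (pi N (A t0.+1)) (pi N (A 0)) p2.
Proof.
have <- : pi N (A T) = pi N (A 0) by apply/eqP; rewrite piE //; apply: cN.1.
rewrite -(mul1g p2) -{1}(subnK t0T) /A iterD; apply: (qwalk_path cN) => [i it|]; last exact: walk0.
rewrite -iterD; apply: inEs; first by rewrite addnC -ltn_subRL.
by rewrite addnS eqn_leq leqNgt ltnS leq_addl.
Qed.

Let pwordT : pword T (A 0) = pword t0 (A 0) * fgl (c (A t0).2) * p2.
Proof. by rewrite -{1}(subnKC t0T) pword_add. Qed.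

Let reroute : exists h, qwalk Es (qorg eps) (qtgt eps) h.
Proof.
rewrite qorg_pi // qtgt_pi // /corg /ctgt.
have w := walk_trans path2 path1; case: (c _).2; first by exists (p2 * pword t0 (A 0)).
by exists (p2 * pword t0 (A 0))^-1; apply: walk_sym.
Qed.

Lemma leaf_conn : conn N s -> forall v, exists g, qwalk Es (pi N (s, ord0)) v g.
Proof. by move=> cs v; have [g wv] := cs v; case: reroute => h w; apply: walk_reroute w wv. Qed.

(** The rest of the loop joins the two ends of the removed edge, so the graph remains connected and
    its rank drops by one. *)
Lemma leaf_gens k : conn N s -> (#|{: quo (cedge N)}| < #|{: quo N}| + k)%N ->
  exists z, (size z < k)%N /\
    forall g, qwalk Es (pi N (s, ord0)) (pi N (s, ord0)) g <-> gens z g.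
Proof.
move=> cs lt; have [z [sz zP]] := walk_gens (leaf_conn cs); exists z; split=> //.
move: sz lt; rewrite cardsC1 (cardD1 eps) inE add1n /=.
by move: #|_| #|_|; clear; lia.
Qed.

(** The loop at [x] crosses the edge at time [t0] once only, so the chord of this edge is expressed
    by the word of the loop and loops avoiding the edge. *)
Lemma leaf_walks (H : freeGroup I -> Prop) g : conn N s -> subgrp H ->
  (forall h, qwalk Es (pi N (s, ord0)) (pi N (s, ord0)) h -> H h) ->
  qwalk Es (pi N (s, ord0)) (pi N (x, ord0)) g -> H (g * pword T (x, ord0) * g^-1) ->
  forall h, qwalk setT (pi N (s, ord0)) (pi N (s, ord0)) h -> H h.
Proof.
move=> cs sH KH wg HT; have [phi pu wphi] := walk_potential (leaf_conn cs).
apply: (walk_remove sH pu wphi KH).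
have [H1 HM HV] := sH.
have h1 : H (g * pword t0 (A 0) * (phi (pi N (A t0)))^-1).
  by apply: KH; apply: walk_trans (walk_sym (wphi _)); apply: walk_trans wg path1.
have h2 : H (phi (pi N (A t0.+1)) * p2 * g^-1).
  by apply: KH; apply: walk_trans (walk_sym wg); apply: walk_trans (wphi _) path2.
have h3 : H (phi (pi N (A t0)) * fgl (c (A t0).2) * (phi (pi N (A t0.+1)))^-1).
  have := HM _ _ (HM _ _ (HV _ h1) HT) (HV _ h2); rewrite pwordT.
  by rewrite !invMg !invgK !mulgA !(mulgK, mulgKV).
rewrite /chord qorg_pi // qtgt_pi // /qlab qgen_pi // /corg /ctgt /cgen.
move: h3; rewrite -/(A t0.+1); case: (c _) => b [] //= h3.
by have := HV _ h3; rewrite !invMg !invgK -fgl_linv mulgA.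
Qed.

End LeafEdge.

(** * Merging base points until the word becomes a generator *)

Section Merging.
Local Open Scope group_scope.
Hypothesis cw : cyc_reduced.

Definition merge (N : rel Y) (x s : X) : rel Y :=
  cclos (fun a b => N a b \/ a = (x, ord0) /\ b = (s, ord0)).

Lemma merge_ccl N x s : ccl (merge N x s).
Proof. exact: cclosP. Qed.

Lemma merge_sub N x s a b : N a b -> merge N x s a b.
Proof. by move=> Nab; apply: cclos_in; left. Qed.

Lemma merge_in N x s : merge N x s (x, ord0) (s, ord0).
Proof. by apply: cclos_in; right. Qed.

Lemma merge_min N x s R : ccl R -> (forall a b, N a b -> R a b) ->
  R (x, ord0) (s, ord0) -> forall a b, merge N x s a b -> R a b.
Proof. by move=> cR NR Rxs; apply: cclos_min => // a b [/NR//|[-> ->]]. Qed.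

(** All base points have the empty prefix. *)
Lemma prg_merge N x s g : prg (merge N x s) g <-> prg N g.
Proof.
split; last first.
  apply: prg_min; [exact: prg_subgrp|exact: prg_W|move=> a b /merge_sub Nab].
  exact: (prg_in (Nab x s)).
apply: prg_cclos; [exact: prg_subgrp|exact: prg_W|move=> a b [/prg_in//|[-> ->]]].
by rewrite mulgV; apply: gen1.
Qed.

Lemma card_quo_merge N x s : ccl N -> ~~ N (x, ord0) (s, ord0) ->
  (#|{: quo (merge N x s)}| < #|{: quo N}|)%N.
Proof.
move=> cN Nxs; have cF := merge_ccl N x s.
pose f (q : quo N) := pi (merge N x s) (qrep q).
have fE y : f (pi N y) = pi (merge N x s) y.
  apply/eqP; rewrite /f piE; last exact: cF.1.
  by apply: merge_sub; rewrite (eqr_sym cN.1); apply: qrepP; apply: cN.1.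
have sf : codom f =i predT.
  by move=> q; rewrite inE; apply/codomP; have [y /eqP->] := pi_surj q; exists (pi N y).
rewrite -[X in (X < _)%N](eq_card sf) ltn_neqAle leq_image_card andbT; apply: contra Nxs => /image_injP fi.
rewrite -piE; last exact: cN.1.
apply/eqP/fi => //; apply/eqP; rewrite !fE piE; [exact: merge_in | exact: cF.1].
Qed.

(** Pigeonhole among the classes of base points met from [x]; a coincidence is then carried back to
    [x], as identifications at equal positions propagate both ways. *)
Lemma period N x : ccl N -> exists T, [/\ (0 < T)%N, (L.+1 %| T)%N,
  N (iter T cnext (x, ord0)) (x, ord0) &
  forall t, (0 < t < T)%N -> (L.+1 %| t)%N -> ~~ N (iter t cnext (x, ord0)) (x, ord0)].
Proof.
move=> cN.
pose f (i : 'I_#|{: quo N}|.+1) := pi N (iter (i * L.+1) cnext (x, ord0)).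
have ex : exists T, [&& (0 < T)%N, (L.+1 %| T)%N & N (iter T cnext (x, ord0)) (x, ord0)].
  have /injectivePn[i [j ij /eqP]] : ~~ injectiveb f.
    by apply/negP => /injectiveP /leq_card; rewrite card_ord ltnn.
  wlog ltij : i j ij / (i < j)%N => [wl|].
    case: (ltngtP i j) => [|lt|e]; [exact: wl | | by rewrite (ord_inj e) eqxx in ij].
    by rewrite eq_sym; apply: wl => //; rewrite eq_sym.
  rewrite /f piE; last exact: cN.1.
  rewrite -{1}(subnK (ltnW ltij)) mulnDl addnC iterD ccl_iter //=; last first.
    by apply: ord_inj; rewrite iter_cnext_ord val_iter_ordS modnMl.
  rewrite (eqr_sym cN.1) => Nj; exists ((j - i) * L.+1)%N.
  by rewrite muln_gt0 subn_gt0 ltij dvdn_mull.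
case: (ex_minnP ex) => T /and3P[T0 LT NT] Tm; exists T; split=> // t /andP[t0 tT] Lt.
by apply: contraL tT => Nt; rewrite -leqNgt; apply: Tm; rewrite t0 Lt.
Qed.

Lemma fixed_iter N s T : ccl N -> N (tau s, ord0) (s, ord0) -> (L.+1 %| T)%N ->
  N (iter T cnext (s, ord0)) (s, ord0).
Proof.
move=> cN Ns /dvdnP[j ->]; elim: j => [|j IHj]; first by rewrite mul0n; apply: eqr_refl; apply: cN.1.
rewrite mulSn iterD; apply: (eqr_trans cN.1 _ Ns); rewrite -iter_cycle ccl_iter //.
by apply: ord_inj; rewrite iter_cnext_ord val_iter_ordS modnMl.
Qed.

Lemma chi_merge_fixed N x s : ccl N -> N (tau s, ord0) (s, ord0) ->
  ~~ N (x, ord0) (s, ord0) ->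
  (#|{: quo N}| + #|{: quo (cedge (merge N x s))}| <=
   #|{: quo (merge N x s)}| + #|{: quo (cedge N)}|)%N.
Proof.
move=> cN Ns Nxs; have [T [T0 LT NT _]] := period x cN.
apply: (chi_merge cN Nxs cw (merge_ccl N x s) (@merge_sub N x s) (@merge_in N x s)
  (@merge_min N x s) T0 LT NT (fixed_iter cN Ns LT)).
Qed.

(** Merging the base points into [s] one at a time keeps [prg N] and does not decrease $\chi$. At
    the end [prg N] is the group of loops of a connected graph, where the count of edges bounds the
    rank. *)
Lemma prg_fixed N s k : ccl N -> N (tau s, ord0) (s, ord0) ->
  (#|{: quo (cedge N)}| < #|{: quo N}| + k)%N ->
  exists z, (size z <= k)%N /\ forall g, prg N g <-> gens z g.
Proof.
have [m] := ubnP #|{: quo N}|; elim: m N => // m IHm N; rewrite ltnS => Nm cN Ns lt.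
have [mg|] := pselect (forall u, N (u, ord0) (s, ord0)).
  have [z [sz zP]] := conn_gen_le (merged_conn cN mg) lt; exists z; split=> // g.
  by rewrite (prg_walk cN _ mg).
move=> /existsNP[x /negP Nxs].
have [||||z [sz zP]] := IHm (merge N x s).
- exact: leq_trans (card_quo_merge cN Nxs) Nm.
- exact: merge_ccl.
- exact: merge_sub.
- have := chi_merge_fixed cN Ns Nxs; move: lt; move: #|_| #|_| #|_| #|_|; clear; lia.
by exists z; split=> // g; rewrite -zP prg_merge.
Qed.

(** A potential modulo [H] that respects [N] and the pair [x], [s] respects the merge, where every
    point is identified with its position on the cycle of [s]; there the potential is the prefix. *)
Lemma prg_merged (H : freeGroup I -> Prop) phi N x s : ccl N -> subgrp H -> H cycword ->
  (forall y, H (phi y * fgl (c y.2) * (phi (cnext y))^-1)) ->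
  (forall a b, N a b -> H (phi a * (phi b)^-1)) ->
  H (phi (x, ord0) * (phi (s, ord0))^-1) ->
  (forall i : 'I_L.+1, H (pre i * (phi (s, i))^-1)) ->
  (forall u, merge N x s (u, ord0) (s, ord0)) -> forall g, prg N g -> H g.
Proof.
move=> cN sH HW He HN Hxs Hs mg; have [H1 HM HV] := sH.
have cF := merge_ccl N x s.
apply: prg_min => // a b Nab.
have : merge N x s (s, a.2) (s, b.2).
  apply: (eqr_trans cF.1 _ (merged_mark cF b mg)).
  apply: (eqr_trans cF.1 _ (merge_sub _ _ Nab)).
  by rewrite (eqr_sym cF.1); apply: merged_mark.
move=> /(merge_min (pot_ccl sH He)) h.
have /asboolP h' : pot H phi (s, a.2) (s, b.2).
  by apply: h => [y z /HN h|]; apply/asboolP.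
by have := HM _ _ (HM _ _ (Hs a.2) h') (HV _ (Hs b.2)); rewrite !invMg !invgK !mulgA !(mulgK, mulgKV).
Qed.

Definition gen_le (H : freeGroup I -> Prop) k :=
  exists z, (size z <= k)%N /\ forall g, H g <-> gens z g.
(** [w] itself counts among the [k] generators; for [H] of rank [k] this amounts to [w] being
    primitive in [H]. *)
Definition wgen_le (H : freeGroup I -> Prop) w k :=
  exists z, (size z < k)%N /\ forall g, H g <-> gens (w :: z) g.
(** The lower bound [n] on the primitivity rank, expressed by generating families alone. *)
Definition pi_hyp n w := forall H k, (k < n)%N -> gen_le H k -> H w -> wgen_le H w k.

Lemma conn_sym N x s : conn N s -> conn N x.
Proof.
move=> cs v; have [g wg] := cs v; have [h wh] := cs (pi N (x, ord0)).
by exists (h^-1 * g); apply: walk_trans wg; apply: walk_sym.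
Qed.

Variable n : nat.
Hypotheses (n1 : (1 < n)%N) (piW : pi_hyp n cycword).
Hypothesis aper : forall k i : nat, (forall m : nat,
  c (iter (k + m + i)%N (@ordS _) ord0) = c (iter (k + m)%N (@ordS _) ord0)) -> (L.+1 %| i)%N.

(** The loops at [s] avoiding the leaf edge form a group with fewer than [n] generators that
    contains the word, since the cycle of [s] avoids that edge; by [piW] the word is one of the
    generators. A path [g] from [s] to [x] is added: conjugated by it, the word read at [x] recovers
    the removed edge. *)
Lemma leaf_wgen N x s T (t0 : nat) : ccl N -> conn N s -> N (tau s, ord0) (s, ord0) ->
  (#|{: quo (cedge N)}| < #|{: quo N}| + n)%N ->
  (t0 < T)%N -> (L.+1 %| T)%N -> N (iter T cnext (x, ord0)) (x, ord0) ->
  (forall t, (t < T)%N -> t != t0 ->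
     ~~ cedge N (iter t cnext (x, ord0)) (iter t0 cnext (x, ord0))) ->
  (forall t, (t < L.+1)%N ->
     ~~ cedge N (iter t cnext (s, ord0)) (iter t0 cnext (x, ord0))) ->
  (forall u, merge N x s (u, ord0) (s, ord0)) -> wgen_le (prg N) cycword n.
Proof.
move=> cN cs Ns lt t0T LT NAT leaf leafB mg.
have [z0 [sz0 z0P]] := leaf_gens cN t0T NAT leaf cs lt.
set Es := ~: _ in z0P; have KW : qwalk Es (pi N (s, ord0)) (pi N (s, ord0)) cycword.
  rewrite [X in qwalk _ _ X _](_ : _ = pi N (iter L.+1 cnext (s, ord0))); last first.
    by apply/eqP; rewrite iter_cycle eq_sym piE //; case: cN.
  apply: qwalk_pre => // i iL; rewrite !inE piE; last exact: cedge_equiv cN.1.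
  exact: leafB.
have [z [sz zP]] : wgen_le (gens z0) cycword n.-1.
  have n0 : (0 < n)%N by apply: ltn_trans n1.
  apply: piW; [by rewrite prednK | exists z0; split=> // | by apply/z0P].
  by move: sz0 n0; clear; lia.
have [g wg] := leaf_conn cN t0T NAT leaf cs (pi N (x, ord0)); rewrite -/Es in wg.
have wg' := walk_sub (subsetT _) wg.
pose H := gens (cycword :: rcons z g); have sH : subgrp H by apply: gen_subgrp.
have [H1 HM HV] := sH.
have HW : H cycword by apply: gen_in; rewrite inE eqxx.
have Hg : H g by apply: gen_in; rewrite inE mem_rcons inE eqxx orbT.
have KH h : qwalk Es (pi N (s, ord0)) (pi N (s, ord0)) h -> H h.
  move=> /z0P/zP; apply: gen_sub => {}h hz; apply: gen_in.
  by move: hz; rewrite !inE mem_rcons inE => /orP[->//|->]; rewrite !orbT.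
have HN h : qwalk setT (pi N (s, ord0)) (pi N (s, ord0)) h -> H h.
  apply: (leaf_walks cN t0T NAT leaf cs sH KH wg); apply: (HM _ _ _ (HV _ Hg)).
  apply: (HM) => //; rewrite pword_pre pre_mod //.
  by elim: (T %/ L.+1)%N => [//|m IHm]; rewrite expgS; apply: (HM).
exists (rcons z g); split; first by rewrite size_rcons; move: sz; case: (n).
move=> h; split.
  have [phi _ wphi] := walk_potential cs.
  apply: (prg_merged (phi := fun y => phi (pi N y)) cN sH HW _ _ _ _ mg) => [y|a b Nab||i].
  - apply: HN; apply: walk_trans (walk_sym (wphi _)).
    by apply: (qwalk_step cN); [rewrite inE | exact: wphi].
  - have -> : pi N a = pi N b by apply/eqP; rewrite piE //; apply: cN.1.
    by rewrite mulgV.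
  - suff h2 : H (phi (pi N (x, ord0)) / g * (g / phi (pi N (s, ord0)))).
      by rewrite mulgA mulgKV in h2.
    apply: (HM); first by apply: HN; apply: walk_trans (wphi _) (walk_sym wg').
    by apply: (HM) => //; apply: (HV); apply: HN; apply: wphi.
  - by apply: HN; apply: walk_trans (walk_sym (wphi _)); apply: qwalk_mark.
apply: gen_min; first exact: prg_subgrp.
move=> {}h; rewrite inE mem_rcons inE => /or3P[/eqP->|/eqP->|hz]; first exact: prg_W.
  exact: qwalk_prg wg.
apply: (qwalk_prg cN (Es := Es)) => //; apply/z0P/zP; apply: gen_in.
by rewrite inE hz orbT.
Qed.

Lemma leaf_merge N x s : ccl N -> N (tau s, ord0) (s, ord0) -> ~~ N (x, ord0) (s, ord0) ->
  (#|{: quo N}| + #|{: quo (cedge (merge N x s))}| =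
   #|{: quo (merge N x s)}| + #|{: quo (cedge N)}|)%N ->
  exists T t0 b, [/\ (t0 < T)%N, (L.+1 %| T)%N, N (iter T cnext (x, ord0)) (x, ord0),
    N (tau x, ord0) (x, ord0) -> T = L.+1 &
    forall (t : nat) (b' : bool), (t < T)%N -> (t, b') != (t0, b) ->
      ~~ cedge N (iter t cnext (if b' then s else x, ord0))
                 (iter t0 cnext (if b then s else x, ord0))].
Proof.
move=> cN Ns Nxs chi; have [T [T0 LT NT Tmin]] := period x cN.
have [||[t0 b] lf] := leaf_exists cN Nxs cw (merge_ccl N x s) (@merge_sub N x s)
  (@merge_in N x s) (@merge_min N x s) T0 LT NT (fixed_iter cN Ns LT) chi _ _ Tmin.
- by move=> k i h; apply: (aper (k := k)) => m; have := h m; rewrite !iter_cnext_ord.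
- by apply: (fixed_iter cN Ns); apply: dvdnn.
exists T, t0, b; split=> // [Nx|t b' tT ne].
  apply/eqP; rewrite eqn_leq (dvdn_leq T0 LT) andbT leqNgt; apply/negP => LT'.
  by have := Tmin L.+1; rewrite LT' dvdnn => /(_ isT isT); rewrite iter_cycle Nx.
have := lf (Ordinal tT, b'); rewrite /incid /=.
have -> : ((Ordinal tT, b') != (t0, b)) by apply: contra ne => /eqP[<- <-].
by case: b' b {ne lf} => -[] /(_ isT).
Qed.

Lemma merge_sym N x s a b : merge N x s a b -> merge N s x a b.
Proof.
apply: merge_min; [exact: merge_ccl|exact: merge_sub|].
by rewrite (eqr_sym (merge_ccl N s x).1); apply: merge_in.
Qed.

Lemma wgen_le_mono H w k k' : (k <= k')%N -> wgen_le H w k -> wgen_le H w k'.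
Proof. by move=> kk' [z [sz zP]]; exists z; split=> //; apply: leq_trans kk'. Qed.

Lemma wgen_le_eq H H' w k : (forall g, H g <-> H' g) -> wgen_le H w k -> wgen_le H' w k.
Proof. by move=> HH' [z [sz zP]]; exists z; split=> // g; rewrite -HH'. Qed.

(** The cycle of [s] repeats its edges after each reading of the word, so an edge met once leaves
    room for a single reading. *)
Lemma leaf_fixed_period N s T t0 : ccl N -> N (tau s, ord0) (s, ord0) -> (L.+1 %| T)%N ->
  (t0 < T)%N -> (forall t, (t < T)%N -> t != t0 ->
     ~~ cedge N (iter t cnext (s, ord0)) (iter t0 cnext (s, ord0))) -> T = L.+1.
Proof.
move=> cN Ns LT t0T lf.
have TL : (L.+1 <= T)%N by apply: dvdn_leq => //; apply: leq_ltn_trans t0T.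
apply/eqP; rewrite eqn_leq TL andbT leqNgt; apply/negP => LT'.
have [tL|tL] := ltnP (t0 + L.+1) T.
  have := lf (t0 + L.+1)%N tL.
  rewrite -{2}(addn0 t0) eqn_add2l => /(_ isT); rewrite iterD cedge_same //; last first.
    by apply: iter_cnext2; rewrite iter_cycle.
  by rewrite ccl_iter ?iter_cycle // Ns.
have := lf (t0 - L.+1)%N.
have Lt0 : (L.+1 <= t0)%N.
  case/dvdnP: LT LT' tL => [[|[|j]]] -> //; rewrite ?mul1n ?ltnn // => _.
  by rewrite !mulSn; move: (j * L.+1)%N; clear; lia.
rewrite (leq_ltn_trans (leq_subr _ _) t0T) => /(_ isT).
rewrite ltn_eqF ?ltn_subrL ?(leq_trans _ Lt0) // => /(_ isT).
rewrite -{2}(subnK Lt0) iterD cedge_same //; last by apply: iter_cnext2; rewrite iter_cycle.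
by rewrite ccl_iter ?iter_cycle // (eqr_sym cN.1) Ns.
Qed.

(** Base points are merged into [s] until one merge remains. At that merge either $\chi$ increases,
    so that fewer than [n] generators suffice and [piW] applies, or $\chi$ is unchanged and there is
    a leaf. *)
Lemma merge_wgen N x s : ccl N -> conn N s -> N (tau s, ord0) (s, ord0) ->
  ~~ N (x, ord0) (s, ord0) ->
  (#|{: quo (cedge N)}| < #|{: quo N}| + n)%N -> wgen_le (prg N) cycword n.
Proof.
have [m] := ubnP #|{: quo N}|; elim: m N x => // m IHm N x; rewrite ltnS => Nm cN cs Ns Nxs lt.
have cF := merge_ccl N x s; have chi := chi_merge_fixed cN Ns Nxs.
have Fs : merge N x s (tau s, ord0) (s, ord0) by apply: merge_sub.
have [mg|] := pselect (forall u, merge N x s (u, ord0) (s, ord0)); last first.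
  move=> /existsNP[u /negP Fus]; apply: (wgen_le_eq (prg_merge N x s)).
  apply: (IHm _ u) => //.
  - exact: leq_trans (card_quo_merge cN Nxs) Nm.
  - exact: (conn_sub cN cF (@merge_sub N x s)).
  by move: lt chi; move: #|_| #|_| #|_| #|_|; clear; lia.
have [lossy|lossl] := ltnP #|{: quo (cedge (merge N x s))}| (#|{: quo (merge N x s)}| + n.-1).
  apply: (wgen_le_mono (leq_pred n)); apply: (wgen_le_eq (prg_merge N x s)).
  apply: piW; [by move: n1; clear; case: (n) | exact: prg_fixed cF Fs lossy | exact: prg_W].
have [|T [t0 [b [t0T LT NT fx lf]]]] := leaf_merge cN Ns Nxs.
  apply/eqP; rewrite eqn_leq chi /=.
  by move: lt chi lossl n1; move: #|_| #|_| #|_| #|_|; clear; lia.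
have TL : (L.+1 <= T)%N by apply: dvdn_leq => //; apply: leq_ltn_trans t0T.
(* A leaf on the cycle of [s] forces [T = L.+1], so that [x] is fixed as well and the two base
   points exchange roles. *)
case: b lf => lf.
  have TL' : T = L.+1.
    apply: (leaf_fixed_period cN Ns LT t0T) => t tT ne.
    by apply: (lf t true tT); rewrite xpair_eqE (negPf ne).
  apply: (@leaf_wgen N s x L.+1 t0) => //.
  - exact: conn_sym cs.
  - by rewrite -iter_cycle; move: NT; rewrite TL'.
  - by rewrite -TL'.
  - by rewrite iter_cycle.
  - move=> t tL ne; rewrite -TL' in tL; apply: (lf t true tL).
    by rewrite xpair_eqE (negPf ne).
  - move=> t tL; rewrite -TL' in tL; apply: (lf t false tL).
    by rewrite xpair_eqE andbF.
  - move=> u; apply: (@merge_sym N x s); apply: (eqr_trans cF.1 (mg u)).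
    by rewrite (eqr_sym cF.1).
apply: (@leaf_wgen N x s T t0) => // [t tT ne|t tL].
  by apply: (lf t false tT); rewrite xpair_eqE (negPf ne).
by apply: (lf t true); [apply: leq_trans TL | rewrite xpair_eqE andbF].
Qed.

End Merging.
End Marks.

(** * Maps between sets of copies, and an added cycle *)

Section MarkMaps.
Variables (X X' : finType) (tau : X -> X) (tau' : X' -> X') (f : X' -> X).
Hypothesis ft : forall x, f (tau' x) = tau (f x).

Definition mmap (y : X' * 'I_L.+1) : X * 'I_L.+1 := (f y.1, y.2).
Definition mpull (M : rel (X * 'I_L.+1)) : rel (X' * 'I_L.+1) :=
  fun a b => M (mmap a) (mmap b).

Lemma mmap_next y : mmap (cnext tau' y) = cnext tau (mmap y).
Proof. by rewrite /mmap /cnext /=; case: eqP; rewrite ?ft. Qed.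

Lemma mmap_org y : mmap (corg tau' y) = corg tau (mmap y).
Proof. by rewrite /corg -mmap_next; case: (c _).2. Qed.

Lemma mmap_tgt y : mmap (ctgt tau' y) = ctgt tau (mmap y).
Proof. by rewrite /ctgt -mmap_next; case: (c _).2. Qed.

Lemma mpull_cedge M a b : cedge tau' (mpull M) a b = cedge tau M (mmap a) (mmap b).
Proof. by rewrite /cedge /mpull !mmap_org. Qed.

Lemma mpull_ccl M : ccl tau M -> ccl tau' (mpull M).
Proof.
move=> [eM cM]; split; last by move=> y y' e; rewrite /mpull !mmap_org !mmap_tgt; apply: cM.
apply: equivalence_relT => [y|y y'|y y' y''].
- exact: (eqr_refl eM).
- exact: (eqr_sym eM).
- exact: (eqr_trans eM).
Qed.

Lemma prg_mpull M g : prg (mpull M) g -> prg M g.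
Proof.
apply: prg_min; [exact: prg_subgrp|exact: prg_W|move=> a b Mab].
exact: (prg_in (a := mmap a) (b := mmap b)).
Qed.

Lemma qwalk_map (M' : rel (X' * 'I_L.+1)) (R : rel (X * 'I_L.+1)) y0 y g :
  ccl tau' M' -> ccl tau R -> (forall a b, M' a b -> R (mmap a) (mmap b)) ->
  qwalk (tau := tau') setT (pi M' y0) (pi M' y) g ->
  qwalk (tau := tau) setT (pi R (mmap y0)) (pi R (mmap y)) g.
Proof.
move=> cM cR MR w.
have E z z' : pi M' z = pi M' z' -> pi R (mmap z) = pi R (mmap z').
  move=> /eqP; rewrite piE; last exact: cM.1.
  by move=> h'; apply/eqP; rewrite piE; [apply: MR | apply: cR.1].
suff K u : qwalk (tau := tau') setT (pi M' y0) u g ->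
    forall z, u = pi M' z -> qwalk (tau := tau) setT (pi R (mmap y0)) (pi R (mmap z)) g.
  exact: K w y erefl.
have Q (e : quo (cedge tau' M')) : exists e' : quo (cedge tau R),
    [/\ qlab e = qlab e', qorg e' = pi R (mmap (corg tau' (qrep e))) &
     qtgt e' = pi R (mmap (ctgt tau' (qrep e)))].
  exists (pi (cedge tau R) (mmap (qrep e))).
  by rewrite qorg_pi // qtgt_pi // /qlab qgen_pi // mmap_org mmap_tgt.
elim=> [|e x _ _ IH|e x _ _ IH] z ez.
- by rewrite (E _ _ ez); apply: walk0.
- have [e' [-> o t]] := Q e; rewrite -(E _ _ ez) -t.
  by apply: walkF; rewrite ?inE // o; apply: IH.
have [e' [-> o t]] := Q e; rewrite -(E _ _ ez) -o.
by apply: walkB; rewrite ?inE // t; apply: IH.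
Qed.

End MarkMaps.

Lemma card_quo_split (T T1 T2 : finType) (R : rel T) (R1 : rel T1) (R2 : rel T2) f1 f2 :
  equivalence_rel R -> equivalence_rel R1 -> equivalence_rel R2 ->
  (forall a b, R1 a b = R (f1 a) (f1 b)) -> (forall a b, R2 a b = R (f2 a) (f2 b)) ->
  (forall a b, ~~ R (f1 a) (f2 b)) ->
  (forall t, (exists a, R t (f1 a)) \/ (exists b, R t (f2 b))) ->
  #|{: quo R}| = (#|{: quo R1}| + #|{: quo R2}|)%N.
Proof.
move=> eR e1 e2 f1E f2E disj cov; rewrite -card_sum.
pose h (q : quo R1 + quo R2) := match q with
  inl q => pi R (f1 (qrep q)) | inr q => pi R (f2 (qrep q)) end.
have h1 a : h (inl (pi R1 a)) = pi R (f1 a).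
  by apply/eqP; rewrite /h piE // -f1E eqr_sym //; apply: qrepP.
have h2 b : h (inr (pi R2 b)) = pi R (f2 b).
  by apply/eqP; rewrite /h piE // -f2E eqr_sym //; apply: qrepP.
have hi : injective h.
  move=> [q|q] [q'|q']; have [a /eqP->] := pi_surj q; have [b /eqP->] := pi_surj q';
    rewrite ?h1 ?h2 => /eqP; rewrite piE // -?f1E -?f2E => r.
  - by congr inl; apply/eqP; rewrite piE.
  - by rewrite (negPf (disj _ _)) in r.
  - by rewrite eqr_sym // (negPf (disj _ _)) in r.
  - by congr inr; apply/eqP; rewrite piE.
rewrite -(card_codom hi); apply: eq_card => q; rewrite inE; apply/esym/codomP.
have [t /eqP->] := pi_surj q; have [[a ta]|[b tb]] := cov t.
  by exists (inl (pi R1 a)); rewrite h1; apply/eqP; rewrite piE.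
by exists (inr (pi R2 b)); rewrite h2; apply/eqP; rewrite piE.
Qed.

Section Discrete.
Hypothesis cw : cyc_reduced.

Lemma cyc_reduced_ord i j : (c i).1 = (c j).1 -> (c i).2 != (c j).2 -> i != ordS j.
Proof.
move=> e1 e2; apply: contraNneq (cw j) => <-; move: e1 e2; rewrite /linv.
by case: (c i) (c j) => b [] [b' []] //= ->.
Qed.

(** Two edges of the same generator and of opposite signs that share an origin, or a target, would
    be cancelling letters in cyclically adjacent positions. *)
Lemma ccl_eq : ccl (@id unit) (fun a b => a == b).
Proof.
split.
  by apply: equivalence_relT => [y|y y'|y y' y'' /eqP->]; rewrite ?eqxx // eq_sym.
move=> [[] i] [[] j]; rewrite /cgen /corg /ctgt /cnext /= !if_same => g.
have inj := can_inj (@ordSK L.+1).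
have [e|ne] := eqVneq (c i).2 (c j).2.
  by rewrite e; case: (c j).2; rewrite !xpair_eqE /= (inj_eq inj).
have := cyc_reduced_ord g ne; have := cyc_reduced_ord (esym g); rewrite eq_sym ne => /(_ isT).
by case: (c i).2 (c j).2 ne => [] [] //= _; rewrite !xpair_eqE /= ![ordS _ == _]eq_sym => /negPf-> /negPf->.
Qed.

Lemma cedge_eq : cedge (@id unit) (fun a b => a == b) =2 (fun a b => a == b).
Proof.
move=> [[] i] [[] j]; apply/idP/eqP => [|[->]]; last by rewrite /cedge !eqxx.
rewrite /cedge /cgen /corg /cnext /= !if_same => /andP[/eqP g].
have inj := can_inj (@ordSK L.+1).
have [e|ne] := eqVneq (c i).2 (c j).2.
  by rewrite e; case: (c j).2; rewrite !xpair_eqE /= ?(inj_eq inj) => /eqP->.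
have := cyc_reduced_ord g ne; have := cyc_reduced_ord (esym g); rewrite eq_sym ne => /(_ isT).
by case: (c i).2 (c j).2 ne => [] [] //= _; rewrite !xpair_eqE /= ?[ordS _ == _]eq_sym
  => /negPf h1 /negPf h2; rewrite ?h1 ?h2.
Qed.

End Discrete.

Section AddCycle.
Local Open Scope group_scope.
Hypothesis cw : cyc_reduced.
Variables (X : finType) (tau : X -> X) (M : rel (X * 'I_L.+1)).
Hypothesis cM : ccl tau M.
Let eM := cM.1.

(** A fixed base point [None], identified with no other point, is added so that the merging argument
    always has a fixed point to merge into. Neither $\chi$ nor [prg] changes. *)
Definition addc : rel (option X * 'I_L.+1) := fun a b =>
  match a.1, b.1 with
  | Some x, Some y => M (x, a.2) (y, b.2)
  | None, None => a.2 == b.2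
  | _, _ => false
  end.

Let ft1 x : Some (tau x) = omap tau (Some x). Proof. by []. Qed.
Let ft2 : forall x : unit, None = omap tau None. Proof. by []. Qed.
Let f1 := mmap (Some : X -> option X).
Let f2 := mmap (fun _ : unit => None : option X).

Let pull1 : mpull Some addc =2 M.
Proof. by move=> [x i] [y j]. Qed.

Let pull2 : mpull (fun _ : unit => None : option X) addc =2 (fun a b => a == b).
Proof. by move=> [[] i] [[] j]; rewrite /mpull /addc /= xpair_eqE. Qed.

Let cover t : (exists a, t = f1 a) \/ (exists b, t = f2 b).
Proof. by case: t => [[x|] i]; [left; exists (x, i) | right; exists (tt, i)]. Qed.

Lemma addc_ccl : ccl (omap tau) addc.
Proof.
have c2 := ccl_eq cw.
have eA : equivalence_rel addc.
  apply: equivalence_relT => [[[x|] i]|[[x|] i] [[y|] j]|[[y|] j] [[x|] i] [[z|] k]] //; rewrite /addc /= ?eqxx //.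
  - exact: (eqr_refl eM).
  - exact: (eqr_sym eM).
  - exact: (eqr_trans eM).
  - by move=> /eqP->.
split=> // y y'.
have [[a ->]|[a ->]] := cover y; have [[b ->]|[b ->]] := cover y'.
- rewrite -!(mmap_org ft1) -!(mmap_tgt ft1) => e.
  by rewrite -!/(mpull Some addc _ _) !pull1; apply: cM.2.
- by rewrite -!(mmap_org ft1) -!(mmap_tgt ft1) -!(mmap_org (tau' := id) ft2) -!(mmap_tgt (tau' := id) ft2).
- by rewrite -!(mmap_org ft1) -!(mmap_tgt ft1) -!(mmap_org (tau' := id) ft2) -!(mmap_tgt (tau' := id) ft2).
rewrite -!(mmap_org (tau' := id) ft2) -!(mmap_tgt (tau' := id) ft2) => e.
by rewrite -!/(mpull (fun _ : unit => None) addc _ _) !pull2; apply: c2.2.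
Qed.

Lemma card_quo_eq (T : finType) (R : rel T) : R =2 (fun a b => a == b) -> #|{: quo R}| = #|T|.
Proof.
move=> RE; have eR : equivalence_rel R.
  apply: equivalence_relT => [y|y y'|y y' y'']; rewrite !RE ?eqxx //.
  by move=> /eqP->.
have h : injective (pi R) by move=> a b /eqP; rewrite piE // RE => /eqP.
rewrite -(card_codom h); apply: eq_card => q; rewrite inE; apply/esym/codomP.
by have [t /eqP->] := pi_surj q; exists t.
Qed.

Lemma card_addc_V : #|{: quo addc}| = (#|{: quo M}| + L.+1)%N.
Proof.
have e2 := (ccl_eq cw).1.
rewrite (card_quo_split (f1 := f1) (f2 := f2) addc_ccl.1 eM e2) //.
- by congr addn; rewrite card_quo_eq // card_prod card_unit card_ord mul1n.
- by move=> a b; rewrite -pull1.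
move=> t; have [[a ->]|[a ->]] := cover t; [left|right]; exists a;
  exact: (eqr_refl addc_ccl.1).
Qed.

Lemma card_addc_E : #|{: quo (cedge (omap tau) addc)}| = (#|{: quo (cedge tau M)}| + L.+1)%N.
Proof.
have e2 := cedge_equiv id (ccl_eq cw).1; have eA := cedge_equiv (omap tau) addc_ccl.1.
rewrite (card_quo_split (f1 := f1) (f2 := f2) eA (cedge_equiv tau eM) e2).
- congr addn; rewrite card_quo_eq ?card_prod ?card_unit ?card_ord ?mul1n //.
  exact: cedge_eq.
- by move=> a b; rewrite -(mpull_cedge ft1) /cedge pull1.
- by move=> a b; rewrite -(mpull_cedge (tau' := id) ft2) /cedge pull2.
- move=> a b; rewrite /cedge -(mmap_org ft1) -(mmap_org (tau' := id) ft2).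
  by rewrite andbF.
move=> t; have [[a ->]|[a ->]] := cover t; [left|right]; exists a;
  exact: (eqr_refl eA).
Qed.

Lemma prg_addc g : prg addc g <-> prg M g.
Proof.
split; apply: prg_min; try exact: prg_subgrp; try exact: prg_W.
  move=> [[x|] i] [[y|] j] //; rewrite /addc /=.
    exact: (@prg_in _ M (x, i) (y, j)).
  by move=> /eqP->; rewrite mulgV; apply: gen1.
by move=> [x i] [y j] h; apply: (@prg_in _ addc (Some x, i) (Some y, j)).
Qed.

Lemma prg_gen_le k : (#|{: quo (cedge tau M)}| < #|{: quo M}| + k)%N -> gen_le (prg M) k.
Proof.
move=> lt; have [||z [sz zP]] := prg_fixed cw (s := None) (k := k) addc_ccl.
- exact: (eqr_refl addc_ccl.1).
- by rewrite card_addc_V card_addc_E; move: lt; move: #|_| #|_|; clear; lia.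
by exists z; split=> // g; rewrite -prg_addc.
Qed.

(** With $\chi>0$ the group would have no generator, yet it contains the word. *)
Lemma card_V_E : cycword != 1 -> (#|{: quo M}| <= #|{: quo (cedge tau M)}|)%N.
Proof.
move=> W1; rewrite leqNgt; apply: contra W1 => lt; have [|z [sz zP]] := prg_gen_le (k := 0%N).
  by rewrite addn0.
have := prg_W M; rewrite zP; case: z sz {zP} => // _.
by elim=> // g h; rewrite inE.
Qed.

End AddCycle.

Section Special.
Local Open Scope group_scope.
Variable n : nat.
Hypotheses (cw : cyc_reduced) (n1 : (1 < n)%N) (piW : pi_hyp n cycword).
Hypothesis aper : forall k i : nat, (forall m : nat,
  c (iter (k + m + i)%N (@ordS _) ord0) = c (iter (k + m)%N (@ordS _) ord0)) -> (L.+1 %| i)%N.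

(** The added cycle is merged with [x0]. A leaf on the added cycle would give [x0] a period of one
    reading, that is, fix it; so the leaf is on the orbit of [x0], and the word replaces the chord
    of that edge among the generators. *)
Lemma unfixed_wgen (X : finType) (tau : X -> X) M x0 : ccl tau M -> conn tau M x0 ->
  ~~ M (tau x0, ord0) (x0, ord0) ->
  (#|{: quo (cedge tau M)}| < #|{: quo M}| + n)%N -> wgen_le (prg M) cycword n.
Proof.
move=> cM cx0 nfix lt; set N := addc M; pose tau' := omap tau.
have cN : ccl tau' N by apply: addc_ccl.
have ft1 x : Some (tau x) = tau' (Some x) by [].
pose F := merge tau' N (Some x0) None; have cF : ccl tau' F by apply: merge_ccl.
have Ns : N (tau' None, ord0) (None, ord0) by apply: (eqr_refl cN.1).
have Nxs : ~~ N (Some x0, ord0) (None, ord0) by [].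
have EN := card_addc_E cw cM; have VN := card_addc_V cw cM.
rewrite -/N -/tau' in EN VN.
have chi := chi_merge_fixed cw cN Ns Nxs; rewrite -/F in chi.
have Fx : F (Some x0, ord0) (None, ord0) by apply: merge_in.
have prgF g : prg F g <-> prg M g by rewrite prg_merge prg_addc.
have [mg|] := pselect (forall u, F (u, ord0) (None, ord0)); last first.
  move=> /existsNP[u /negP Fus]; apply: (wgen_le_eq prgF).
  apply: (merge_wgen cw n1 piW aper cF _ _ Fus).
  - move=> v; have [[[x|] i] /eqP->] := pi_surj v; last first.
      by exists (pre i); apply: qwalk_mark.
    have [g wg] := cx0 (pi M (x, i)); exists g.
    have -> : pi F (None, ord0) = pi F (mmap Some (x0, ord0)).
      by apply/eqP; rewrite eq_sym piE //; case: cF.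
    apply: (qwalk_map ft1 cM cF _ wg) => -[a i'] [b j'] Mab.
    exact: merge_sub.
  - exact: merge_sub.
  by move: lt chi; rewrite EN VN; move: #|_| #|_| #|_| #|_|; clear; lia.
have n0 : (0 < n)%N by apply: ltn_trans n1.
have [lossy|lossl] := ltnP #|{: quo (cedge tau' F)}| (#|{: quo F}| + n.-1).
  apply: (wgen_le_mono (leq_pred n)); apply: (wgen_le_eq prgF).
  apply: piW; [by rewrite prednK | | exact: prg_W].
  by apply: (prg_fixed cw (s := None) cF) => //; apply: merge_sub.
have [|T [t0 [b [t0T LT NT fx lf]]]] := leaf_merge cw aper cN Ns Nxs.
  apply/eqP; rewrite eqn_leq chi /= -/F.
  by move: lt lossl n0; rewrite EN VN; move: #|_| #|_| #|_| #|_|; clear; lia.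
case: b lf => lf.
  case/negP: nfix; have TL' : T = L.+1.
    apply: (leaf_fixed_period cN Ns LT t0T) => t tT ne.
    by apply: (lf t true tT); rewrite xpair_eqE (negPf ne).
  by move: NT; rewrite TL' iter_cycle.
have iS t : iter t (cnext tau') (Some x0, ord0) = mmap Some (iter t (cnext tau) (x0, ord0)).
  by elim: t => //= t ->; rewrite (mmap_next ft1).
have leaf t : (t < T)%N -> t != t0 ->
    ~~ cedge tau M (iter t (cnext tau) (x0, ord0)) (iter t0 (cnext tau) (x0, ord0)).
  move=> tT ne; have := lf t false tT; rewrite xpair_eqE (negPf ne) => /(_ isT).
  rewrite !iS -(mpull_cedge ft1) /cedge /mpull /N /addc /=.
  by case: (corg tau _) => ? ?; case: (corg tau _).
have NAT : M (iter T (cnext tau) (x0, ord0)) (x0, ord0).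
  by move: NT; rewrite iS; case: (iter _ _ _).
have [z0 [sz0 z0P]] := leaf_gens cM t0T NAT leaf cx0 lt.
exists z0; split=> // h.
pose H := gens (cycword :: z0); have sH : subgrp H by apply: gen_subgrp.
have [H1 HM HV] := sH; have HW : H cycword by apply: gen_in; rewrite inE eqxx.
have HK g : gens z0 g -> H g by apply: gen_sub => g' g'z; apply: gen_in; rewrite inE g'z orbT.
have HN g : qwalk (tau := tau) setT (pi M (x0, ord0)) (pi M (x0, ord0)) g -> H g.
  apply: (leaf_walks cM t0T NAT leaf cx0 sH (g := 1)) => [g' /z0P/HK//||].
    exact: walk0.
  rewrite mul1g invg1 mulg1 pword_pre pre_mod //.
  by elim: (T %/ L.+1)%N => [//|m IHm]; rewrite expgS; apply: (HM).
split.
  rewrite -(prg_addc M).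
  have [phi phi1 wphi] := walk_potential cx0.
  pose ph (y : option X * 'I_L.+1) := if y.1 is Some x then phi (pi M (x, y.2)) else pre y.2.
  have wMM x i g : qwalk (tau := tau) setT (pi M (x0, ord0)) (pi M (x, i)) g -> H (phi (pi M (x, i)) / g).
    by move=> w; apply: HN; apply: walk_trans (wphi _) (walk_sym w).
  apply: (prg_merged (phi := ph) (s := None) (x := Some x0) cN sH HW _ _ _ _ mg).
  - move=> [[x|] i]; last first.
      have -> : cnext tau' (None, i) = (None, ordS i) by rewrite /cnext /= if_same.
      exact: (pre_edge tau' (None, i) sH HW).
    rewrite -[(Some x, i)]/(mmap Some (x, i)) -(mmap_next ft1) /ph /=.
    apply: HN; apply: walk_trans (walk_sym (wphi _)).
    by apply: (qwalk_step cM (y := (x, i))); [rewrite inE | exact: wphi].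
  - move=> [[x|] i] [[y|] j] //; rewrite /N /addc /ph /=.
      move=> Mxy; have -> : pi M (x, i) = pi M (y, j) by apply/eqP; rewrite piE //; apply: cM.1.
      by rewrite mulgV.
    by move=> /eqP->; rewrite mulgV.
  - by rewrite /ph /= phi1 mul1g invg1.
  - by move=> i; rewrite /ph /= mulgV.
apply: gen_min; first exact: prg_subgrp.
move=> g; rewrite inE => /orP[/eqP->|gz]; first exact: prg_W.
by apply: (qwalk_prg cM (s := x0) (x := x0)); apply/z0P; apply: gen_in.
Qed.

End Special.

(** Copies are glued position by position along an equivalence of base points, except that the class
    of one fixed base point [y] is folded further, as a quotient of the single cycle. *)
Definition special (X : finType) (tau : X -> X) (M : rel (X * 'I_L.+1)) :=
  exists y, M (tau y, ord0) (y, ord0) /\ forall a b, M a b =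
    (M (a.1, ord0) (b.1, ord0) && (a.2 == b.2)) ||
    [&& M (a.1, ord0) (y, ord0), M (b.1, ord0) (y, ord0) & M (y, a.2) (y, b.2)].

Lemma qwalk_one (X : finType) (tau : X -> X) M u v : ccl tau M ->
  qwalk (tau := tau) (R := M) setT u v 1%g -> u = v.
Proof.
move=> cM w; have := weval_skew (qfold_org cM) (qfold_tgt cM)
  (S := 'S_1) [ffun=> 1%g] w 1%g.
by rewrite weval1 perm1 => -[].
Qed.

(** The quotient of prefixes being a loop, the two positions are joined by a walk of trivial label,
    which is closed in a folded graph. *)
Lemma prg_merged_eq (X : finType) (tau : X -> X) M s (i j : 'I_L.+1) : ccl tau M ->
  (forall u, M (u, ord0) (s, ord0)) -> prg M (pre i * (pre j)^-1)%g -> M (s, i) (s, j).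
Proof.
move=> cM mg; rewrite (prg_walk cM _ mg) => w; rewrite -piE; last exact: cM.1.
apply/eqP/(qwalk_one cM).
have := walk_trans (walk_trans (walk_sym (qwalk_mark cM s i)) w) (qwalk_mark cM s j).
by rewrite mulgA mulVg mul1g mulVg.
Qed.

(** Such a group is generated by the word, so it lies in the group of the discrete cycle, which
    separates all positions. *)
Lemma prg_trivial (X : finType) (tau : X -> X) M : cyc_reduced -> ccl tau M ->
  wgen_le (prg M) cycword 1 -> forall a b, M a b -> a.2 = b.2.
Proof.
move=> cw cM [[|? ?] [// _ zP]] a b /prg_in/zP h.
have /eqP[] // : (tt, a.2) == (tt, b.2).
apply: (prg_merged_eq (s := tt) (ccl_eq cw)) => [[]|]; first exact: eqxx.
move: h; apply: gen_min; first exact: prg_subgrp.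
by move=> g; rewrite inE => /eqP->; apply: prg_W.
Qed.

Lemma ccl_mark (X : finType) (tau : X -> X) M x y (i : 'I_L.+1) : ccl tau M ->
  M (x, i) (y, i) = M (x, ord0) (y, ord0).
Proof.
by move=> cM; rewrite -[(x, i)](iter_mark tau) -[(y, i)](iter_mark tau) ccl_iter.
Qed.

(** * Splitting a quotient into two unions of components *)

Section Split.
Variables (X : finType) (tau : X -> X) (M : rel (X * 'I_L.+1)) (P : pred X).
Hypotheses (cM : ccl tau M) (MP : forall a b, M a b -> P a.1 = P b.1).
Hypothesis tP : forall x, P (tau x) = P x.

Definition subtau (x : {x | P x}) : {x | P x} := Sub (tau (val x)) (etrans (tP _) (valP x)).
Definition subM : rel ({x | P x} * 'I_L.+1) := mpull val M.

Lemma subM_ccl : ccl subtau subM.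
Proof. exact: mpull_ccl. Qed.

Lemma subM_cedge a b : cedge subtau subM a b = cedge tau M (mmap val a) (mmap val b).
Proof. exact: mpull_cedge. Qed.

Lemma subM_cover a : P a.1 -> exists b, a = mmap (val : {x | P x} -> X) b.
Proof. by case: a => x i Px; exists (Sub x Px : {x | P x}, i). Qed.

End Split.

Section Split2.
Local Open Scope group_scope.
Variables (X : finType) (tau : X -> X) (M : rel (X * 'I_L.+1)) (P P' : pred X).
Hypotheses (cM : ccl tau M) (MP : forall a b, M a b -> P a.1 = P b.1).
Hypothesis PP : forall x, P' x = ~~ P x.
Hypotheses (tP : forall x, P (tau x) = P x) (tP' : forall x, P' (tau x) = P' x).
Let M1 : rel ({x | P x} * 'I_L.+1) := @subM _ M P.
Let M2 : rel ({x | P' x} * 'I_L.+1) := @subM _ M P'.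
Let v1 := mmap (val : {x | P x} -> X).
Let v2 := mmap (val : {x | P' x} -> X).

Let disj a b : ~~ M (v1 a) (v2 b).
Proof. 
by apply/negP => /MP /=; rewrite (valP a.1) => /esym; have := valP b.1; rewrite PP => /negPf->.
Qed.

Let cover a : (exists b, a = v1 b) \/ (exists b, a = v2 b).
Proof.
have [Pa|Pa] := boolP (P a.1); [left|right]; apply: subM_cover => //.
by rewrite PP.
Qed.

Lemma split_V : #|{: quo M}| = (#|{: quo M1}| + #|{: quo M2}|)%N.
Proof.
apply: (card_quo_split (f1 := v1) (f2 := v2) cM.1 (subM_ccl cM tP).1 (subM_ccl cM tP').1) => // t.
by have [[a ->]|[a ->]] := cover t; [left|right]; exists a; apply: (eqr_refl cM.1).
Qed.

Lemma split_E : #|{: quo (cedge tau M)}| =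
  (#|{: quo (cedge (subtau tP) M1)}| + #|{: quo (cedge (subtau tP') M2)}|)%N.
Proof.
have eE := cedge_equiv tau cM.1.
apply: (card_quo_split (f1 := v1) (f2 := v2) eE
  (cedge_equiv _ (subM_ccl cM tP).1) (cedge_equiv _ (subM_ccl cM tP').1)) => [a b|a b|a b|t].
- exact: subM_cedge.
- exact: subM_cedge.
- rewrite /cedge -(mmap_org (tau' := subtau tP)) // -(mmap_org (tau' := subtau tP')) //.
  by rewrite (negPf (disj _ _)) andbF.
by have [[a ->]|[a ->]] := cover t; [left|right]; exists a; apply: (eqr_refl eE).
Qed.

Lemma split_prg H : subgrp H -> (forall g, prg M1 g -> H g) -> (forall g, prg M2 g -> H g) ->
  forall g, prg M g -> H g.
Proof.
move=> sH H1 H2; apply: prg_min => //; first exact: H1 (prg_W _).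
move=> a b; have [[a' ->]|[a' ->]] := cover a; have [[b' ->]|[b' ->]] := cover b.
- by move=> h; apply/H1/(@prg_in _ M1 a' b').
- by rewrite (negPf (disj _ _)).
- by rewrite (eqr_sym cM.1) (negPf (disj _ _)).
- by move=> h; apply/H2/(@prg_in _ M2 a' b').
Qed.

Lemma split_wgen k1 k2 n : wgen_le (prg M1) cycword k1 -> wgen_le (prg M2) cycword k2 ->
  (k1 + k2 <= n.+1)%N -> wgen_le (prg M) cycword n.
Proof.
move=> [z1 [s1 z1P]] [z2 [s2 z2P]] kn; exists (z1 ++ z2); split.
  by rewrite size_cat; move: s1 s2 kn; clear; lia.
move=> g; split.
  apply: split_prg; first exact: gen_subgrp.
    move=> h /z1P; apply: gen_sub => h'; rewrite !inE => h'z; apply: gen_in.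
    by rewrite inE mem_cat; case/orP: h'z => ->; rewrite ?orbT.
  move=> h /z2P; apply: gen_sub => h'; rewrite !inE => h'z; apply: gen_in.
  by rewrite inE mem_cat; case/orP: h'z => ->; rewrite ?orbT.
apply: gen_min; first exact: prg_subgrp.
move=> h; rewrite inE mem_cat => /or3P[/eqP->|hz|hz]; first exact: prg_W.
  by apply: (prg_mpull (f := val) (M := M)); apply/z1P; apply: gen_in; rewrite inE hz orbT.
by apply: (prg_mpull (f := val) (M := M)); apply/z2P; apply: gen_in; rewrite inE hz orbT.
Qed.

Lemma split_special : cyc_reduced -> special (subtau tP) M1 ->
  wgen_le (prg M2) cycword 1 -> special tau M.
Proof.
move=> cw [y [fy sp]] w1; exists (val y); split; first exact: fy.
move=> a b; have [[a' ->]|[a' ->]] := cover a; have [[b' ->]|[b' ->]] := cover b.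
- exact: (sp a' b').
- have -> : M (v1 a') (v2 b') = false by apply/negP; apply/negP; apply: disj.
  have := disj (a'.1, ord0) (b'.1, ord0); rewrite /v1 /v2 /= => /negPf->.
  have := disj (y, ord0) (b'.1, ord0); rewrite /v1 /v2 /= (eqr_sym cM.1) => /negPf->.
  by rewrite andbF.
- have -> : M (v2 a') (v1 b') = false by apply/negP; rewrite (eqr_sym cM.1); apply/negP; apply: disj.
  have := disj (b'.1, ord0) (a'.1, ord0); rewrite /v1 /v2 /= (eqr_sym cM.1) => /negPf->.
  by have := disj (y, ord0) (a'.1, ord0); rewrite /v1 /v2 /= (eqr_sym cM.1) => /negPf->.
have := disj (y, ord0) (a'.1, ord0); rewrite /v1 /v2 /= (eqr_sym cM.1) => /negPf->.
rewrite orbF; apply/idP/andP => [h|[h /eqP e]].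
  have /= e := prg_trivial cw (subM_ccl cM tP') w1 (a := a') (b := b') h.
  rewrite e eqxx; split=> //; move: h; rewrite /v2 /mmap e.
  by rewrite (ccl_mark _ _ _ cM).
rewrite /v2 /mmap e.
by rewrite (ccl_mark _ _ _ cM).
Qed.

End Split2.

Section SpecialOrWgen.
Local Open Scope group_scope.
Variable n : nat.
Hypotheses (cw : cyc_reduced) (n1 : (1 < n)%N) (piW : pi_hyp n cycword).
Hypothesis W1 : cycword != 1.
Hypothesis aper : forall k i : nat, (forall m : nat,
  c (iter (k + m + i)%N (@ordS _) ord0) = c (iter (k + m)%N (@ordS _) ord0)) -> (L.+1 %| i)%N.

(** Only quotients in which some base point is fixed and all of them are already merged escape the
    two merging arguments, and those are special. *)
Lemma conn_special (X : finType) (tau : X -> X) M x0 : ccl tau M -> conn tau M x0 ->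
  (#|{: quo (cedge tau M)}| < #|{: quo M}| + n)%N ->
  wgen_le (prg M) cycword n \/ special tau M.
Proof.
move=> cM cx0 lt; have [[s fs]|nf] := pselect (exists s, M (tau s, ord0) (s, ord0)); last first.
  left; apply: (unfixed_wgen cw n1 piW aper cM cx0 _ lt).
  by apply/negP => h; apply: nf; exists x0.
have [mg|] := pselect (forall u, M (u, ord0) (s, ord0)); last first.
  move=> /existsNP[u /negP Mus]; left.
  exact: (merge_wgen cw n1 piW aper cM (conn_sym _ cx0) fs Mus lt).
right; exists s; split=> // a b; rewrite !mg /=.
have e y : M y (s, y.2) by apply: (merged_mark cM y mg).
have -> : M a b = M (s, a.2) (s, b.2).
  apply/idP/idP => h.
    apply: (eqr_trans cM.1 _ (e b)); apply: (eqr_trans cM.1 _ h).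
    by rewrite (eqr_sym cM.1).
  apply: (eqr_trans cM.1 (e a)); apply: (eqr_trans cM.1 h).
  by rewrite (eqr_sym cM.1).
by case: eqP => [->|_]; rewrite ?andbF // andbT (eqr_refl cM.1) orbT.
Qed.

(** Both parts have $\chi\le0$, and their ranks add up to at most [n + 1]. If both are below [n],
    [piW] applies to each. Otherwise the other part has rank at most 1, so its group is generated by
    the word, and induction handles the large part. *)
Lemma special_or_wgen (X : finType) (tau : X -> X) M : ccl tau M ->
  (#|{: quo (cedge tau M)}| < #|{: quo M}| + n)%N ->
  wgen_le (prg M) cycword n \/ special tau M.
Proof.
have [m] := ubnP #|X|; elim: m X tau M => // m IHm X tau M; rewrite ltnS => Xm cM lt.
have [x0 _|X0] := pickP (fun _ : X => true); last first.
  left; exists [::]; split; first exact: ltn_trans n1.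
  move=> g; split; last first.
    by apply: gen_min; [exact: prg_subgrp | move=> h; rewrite inE => /eqP->; exact: prg_W].
  apply: prg_min; [exact: gen_subgrp | by apply: gen_in; rewrite inE | ].
  by move=> [x i]; have := X0 x.
have [cx0|ncx0] := pselect (conn tau M x0); first exact: (conn_special cM cx0).
pose P : pred X := fun x => `[< exists g, qwalk (tau := tau) setT (pi M (x0, ord0)) (pi M (x, ord0)) g >].
pose P' : pred X := fun x => ~~ P x.
have link a b : M a b -> P a.1 -> P b.1.
  move=> Mab /asboolP[g w]; apply/asboolP; exists (g * pre a.2 * (pre b.2)^-1).
  apply: walk_trans (walk_sym (qwalk_mark cM b.1 b.2)).
  apply: (walk_trans w); have -> : pi M (b.1, b.2) = pi M (a.1, a.2); last exact: qwalk_mark.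
  apply/eqP; rewrite -!surjective_pairing eq_sym piE //; exact: cM.1.
have MP a b : M a b -> P a.1 = P b.1.
  move=> Mab; apply/idP/idP; first exact: link.
  by apply: link; rewrite (eqr_sym cM.1).
have tP x : P (tau x) = P x.
  have w : qwalk (tau := tau) setT (pi M (x, ord0)) (pi M (tau x, ord0)) cycword.
    by rewrite -iter_cycle; apply: qwalk_pre => // i _; rewrite inE.
  apply/asboolP/asboolP => -[g wg].
    by exists (g * cycword^-1); apply: (walk_trans wg); apply: walk_sym.
  by exists (g * cycword); apply: (walk_trans wg).
have tP' x : P' (tau x) = P' x by rewrite /P' tP.
have EE := split_E cM MP (fun x => erefl : P' x = ~~ P x) tP tP'.
have VV := split_V cM MP (fun x => erefl : P' x = ~~ P x) tP tP'.
have PP' x : P x = ~~ P' x by rewrite /P' negbK.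
have MP' a b : M a b -> P' a.1 = P' b.1 by move=> /MP; rewrite /P' => ->.
have cM1 := subM_ccl cM tP; have cM2 := subM_ccl cM tP'.
have h1 := card_V_E cw cM1 W1; have h2 := card_V_E cw cM2 W1.
have Px0 : P x0 by apply/asboolP; exists 1; apply: walk0.
have [x1 Px1] : exists x1, P' x1.
  apply: contrapT => nP; apply: ncx0 => v; have [[x i] /eqP->] := pi_surj v.
  have /asboolP[g w] : P x by apply: contrapT => /negP Px; apply: nP; exists x.
  by exists (g * pre i); apply: walk_trans w (qwalk_mark cM _ _).
have cX1 : (#|{: {x | P x}}| < m)%N.
  rewrite card_sig; apply: leq_trans Xm; rewrite -[X in (_ < X)%N](cardC P) -addn1 leq_add2l.
  by apply/card_gt0P; exists x1.
have cX2 : (#|{: {x | P' x}}| < m)%N.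
  rewrite card_sig; apply: leq_trans Xm; rewrite -[X in (_ < X)%N](cardC P') -addn1 leq_add2l.
  by apply/card_gt0P; exists x0; rewrite inE /in_mem /= /P' Px0.
have gen1 k : (#|{: quo (cedge (subtau tP) (@subM X M P))}| < #|{: quo (@subM X M P)}| + k)%N ->
    (k < n)%N -> wgen_le (prg (@subM X M P)) cycword k.
  by move=> lk kn; apply: piW => //; [exact: (prg_gen_le cw cM1 lk) | exact: prg_W].
have gen2 k : (#|{: quo (cedge (subtau tP') (@subM X M P'))}| < #|{: quo (@subM X M P')}| + k)%N ->
    (k < n)%N -> wgen_le (prg (@subM X M P')) cycword k.
  by move=> lk kn; apply: piW => //; [exact: (prg_gen_le cw cM2 lk) | exact: prg_W].
have ih1 := IHm _ _ _ cX1 cM1; have ih2 := IHm _ _ _ cX2 cM2.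
have sw := @split_wgen _ _ M P P' cM MP (fun x => erefl).
have ss := @split_special _ _ M P P' cM MP (fun x => erefl) tP tP' cw.
have sw' := @split_wgen _ _ M P' P cM MP' PP'.
have ss' := @split_special _ _ M P' P cM MP' PP' tP' tP cw.
move: lt h1 h2 gen1 gen2 ih1 ih2 EE VV; move: #|_| #|_| #|_| #|_| #|_| #|_|.
move=> E2 V2 E1 V1 V E lt h1 h2 gen1 gen2 ih1 ih2 EE VV.
have [k1n|nk1] := ltnP (E1.+1 - V1) n; last first.
  have w2 : wgen_le (prg (@subM X M P')) cycword 1.
    by apply: gen2 => //; move: lt h1 h2 nk1 n1 EE VV; clear; lia.
  have [|w1|s1] := ih1; first by move: lt h1 h2 nk1 n1 EE VV; clear; lia.
    by left; apply: sw w1 w2 _; rewrite addn1.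
  by right; apply: ss.
have [k2n|nk2] := ltnP (E2.+1 - V2) n; last first.
  have w1 : wgen_le (prg (@subM X M P)) cycword 1.
    by apply: gen1 => //; move: lt h1 h2 nk2 n1 EE VV; clear; lia.
  have [|w2|s2] := ih2; first by move: lt h1 h2 nk2 n1 EE VV; clear; lia.
    by left; apply: sw' w2 w1 _; rewrite addn1.
  by right; apply: ss'.
left; apply: (sw _ _ _ (gen1 _ _ k1n) (gen2 _ _ k2n));
  by move: lt h1 h2 k1n k2n EE VV; clear; lia.
Qed.

End SpecialOrWgen.

End CyclicWord.

(** * The folded graph of a subgroup along a word *)

Section PathGraph.
Variables (I : choiceType) (s : seq (I * bool)) (H : freeGroup I -> Prop).
Local Open Scope group_scope.
Hypothesis sH : subgrp H.
Let n := size s.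

Definition ppre t : freeGroup I := \prod_(l <- take t s) fgl l.

(** Points of the path are identified when their prefixes lie in the same coset of [H]. This
    produces a folded graph at once instead of through successive folds; along a concatenation of
    generators of [H], its loops are exactly [H]. *)
Definition prel : rel 'I_n.+1 := fun i j => `[< H (ppre i * (ppre j)^-1) >].

Definition pend (b : bool) (j : 'I_n) : 'I_n.+1 := inord (if b then j.+1 else j).
Definition plet (j : 'I_n) : I * bool := tnth (in_tuple s) j.
Definition porg j := pend (plet j).2 j.
Definition ptgt j := pend (~~ (plet j).2) j.

Lemma pprel_eq : equivalence_rel prel.
Proof.
have [H1 HM HV] := sH; apply: equivalence_relT => [y|y y'|y y' y''].
- by apply/asboolP; rewrite mulgV.
- by apply/asboolP/asboolP => /HV; rewrite invMg invgK.
- by move=> /asboolP h1 /asboolP h2; apply/asboolP; have := HM _ _ h1 h2; rewrite mulgA mulgKV.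
Qed.

Lemma ppreS (j : 'I_n) : ppre j.+1 = ppre j * fgl (plet j).
Proof.
rewrite /ppre (take_nth (plet j)) ?ltn_ord // -cats1 big_cat big_seq1 /=.
by rewrite -(tnth_nth (plet j) (in_tuple s) j).
Qed.

Lemma ppre_chord (j : 'I_n) : ppre (ptgt j) = ppre (porg j) * fgl ((plet j).1, false).
Proof.
have e1 : (inord j.+1 : 'I_n.+1) = j.+1 :> nat by rewrite inordK // ltnS ltn_ord.
have e2 : (inord j : 'I_n.+1) = j :> nat by rewrite inordK // ltnS ltnW.
have := ppreS j; rewrite /ptgt /porg /pend; case: (plet j) => b [] /=; rewrite e1 e2 => ->.
  by rewrite -mulgA (fgl_linv (b, false)) mulVg mulg1.
by [].
Qed.

Definition pedge : rel 'I_n := fun j k => ((plet j).1 == (plet k).1) && prel (porg j) (porg k).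

Lemma pedge_eq : equivalence_rel pedge.
Proof.
have e := pprel_eq; apply: equivalence_relT => [y|y y'|y y' y''].
- by rewrite /pedge eqxx (eqr_refl e).
- by rewrite /pedge eq_sym (eqr_sym e).
- by move=> /andP[/eqP e1 r1] /andP[/eqP e2 r2]; rewrite /pedge -e2 e1 eqxx (eqr_trans e r1).
Qed.

Lemma prel_tgt j k : (plet j).1 = (plet k).1 -> prel (porg j) (porg k) = prel (ptgt j) (ptgt k).
Proof. by move=> e; rewrite /prel !ppre_chord e invMg -!mulgA mulKVg. Qed.

Definition pqorg (e : quo pedge) : quo prel := pi prel (porg (qrep e)).
Definition pqtgt (e : quo pedge) : quo prel := pi prel (ptgt (qrep e)).
Definition pqgen (e : quo pedge) : I := (plet (qrep e)).1.
Local Notation pwalk := (walk pqorg pqtgt (fun e => fgl (pqgen e, false))).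

Lemma pq_rep j : [/\ pqorg (pi pedge j) = pi prel (porg j),
  pqtgt (pi pedge j) = pi prel (ptgt j) & pqgen (pi pedge j) = (plet j).1].
Proof.
have /andP[/eqP e r] := qrepP pedge_eq j.
have K a b : prel a b -> pi prel b = pi prel a.
  by move=> ab; apply/eqP; rewrite (piE pprel_eq) (eqr_sym pprel_eq).
split; [exact: K r | | exact/esym].
by apply: K; rewrite -prel_tgt.
Qed.

Lemma pfold_org : injective (fun e => (pqgen e, pqorg e)).
Proof.
move=> e e' h; have eg := congr1 fst h; have /eqP := congr1 snd h.
rewrite /= /pqorg piE; last exact: pprel_eq.
move=> eo; rewrite -(qrepK e) -(qrepK e'); apply/eqP.
by rewrite piE; [apply/andP; split=> //; apply/eqP | exact: pedge_eq].
Qed.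

Lemma pfold_tgt : injective (fun e => (pqgen e, pqtgt e)).
Proof.
move=> e e' h; have eg := congr1 fst h; have /eqP := congr1 snd h.
rewrite /= /pqtgt piE; last exact: pprel_eq.
rewrite -prel_tgt // => eo; rewrite -(qrepK e) -(qrepK e'); apply/eqP.
by rewrite piE; [apply/andP; split=> //; apply/eqP | exact: pedge_eq].
Qed.

Lemma pwalk_pre (Es : {set quo pedge}) t u : (u <= t)%N -> (t <= n)%N ->
  (forall j : 'I_n, (u <= j < t)%N -> pi pedge j \in Es) ->
  pwalk Es (pi prel (inord u)) (pi prel (inord t)) ((ppre u)^-1 * ppre t).
Proof.
elim: t => [|t IHt] ut tn jE.
  by move: ut; rewrite leqn0 => /eqP->; rewrite mulVg; apply: walk0.
move: ut; rewrite leq_eqVlt => /orP[/eqP->|ut]; first by rewrite mulVg; apply: walk0.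
have {}IHt := IHt ut (ltnW tn) (fun j h => jE j (introT andP (conj (proj1 (andP h)) (ltnW (proj2 (andP h)))))).
pose j := Ordinal tn; have [o t' g] := pq_rep j.
have jEs : pi pedge j \in Es by apply: jE; rewrite -ltnS ut /=.
rewrite -[t.+1]/(val j).+1 ppreS mulgA; move: o t' g; rewrite /porg /ptgt /pend.
case E: (plet j) => [b []] /= o t' g.
  by rewrite (fgl_linv (b, false)) -g -o; apply: walkB => //; rewrite t'.
by rewrite -g -t'; apply: walkF => //; rewrite o.
Qed.

Lemma pwalk_conn v : exists g, pwalk setT (pi prel ord0) v g.
Proof.
have [i /eqP->] := pi_surj v; exists ((ppre 0)^-1 * ppre i).
have := @pwalk_pre setT i 0 (leq0n _); rewrite -ltnS ltn_ord => /(_ isT).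
have -> : (inord 0 : 'I_n.+1) = ord0 by apply: val_inj; rewrite /= inordK.
by rewrite inord_val; apply=> j _; rewrite inE.
Qed.

Lemma pwalk_coset Es v g : pwalk Es (pi prel ord0) v g ->
  exists i : 'I_n.+1, v = pi prel i /\ H (g * (ppre i)^-1).
Proof.
have [H1 HM HV] := sH; have eP := pprel_eq.
have ext z z' x : pi prel z = pi prel z' -> H (x * (ppre z)^-1) -> H (x * (ppre z')^-1).
  move=> /eqP; rewrite piE // => /asboolP h k; have := HM _ _ k h.
  by rewrite mulgA mulgKV.
elim=> [|e x _ _ [i [oi h]]|e x _ _ [i [oi h]]].
- by exists ord0; rewrite /ppre take0 big_nil invg1 mulg1.
- exists (ptgt (qrep e)); split=> //; move: (ext _ _ _ (esym oi) h).
  by rewrite ppre_chord /pqgen invMg mulgA mulgK.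
exists (porg (qrep e)); split=> //; move: (ext _ _ _ (esym oi) h).
by rewrite ppre_chord /pqgen invMg !mulgA.
Qed.

Lemma pwalk_in Es g : pwalk Es (pi prel ord0) (pi prel ord0) g -> H g.
Proof.
move=> /pwalk_coset[i [/eqP]]; rewrite piE; last exact: pprel_eq.
have [H1 HM HV] := sH; move=> /asboolP; rewrite /ppre take0 big_nil mul1g => h1 h2.
by have := HM _ _ h2 (HV _ h1); rewrite invgK mulgKV.
Qed.

End PathGraph.

(** * Stallings graphs and ranks of subgroups *)

Section GroupRank.
Local Open Scope group_scope.

(** Rank with the Hopf property built in: a generating family of minimal size is automatically
    free. *)
Definition grank (I : choiceType) (H : freeGroup I -> Prop) r :=
  [/\ exists y, size y = r /\ forall g, H g <-> gens y g,
      forall y, (forall g, H g <-> gens y g) -> (r <= size y)%N &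
      forall y, size y = r -> (forall g, H g <-> gens y g) ->
        injective (weval (fun i : 'I_(size y) => nth 1 y i))].
End GroupRank.

Section FreeRank.
Variable I : choiceType.
Local Open Scope group_scope.
Implicit Types (H K : freeGroup I -> Prop) (y z : seq (freeGroup I)).

Lemma codom_nth y : codom (fun i : 'I_(size y) => nth 1 y i) = y.
Proof. by rewrite codomE -[RHS](mkseq_nth 1 y) /mkseq -val_enum_ord -map_comp. Qed.

Lemma folded_grank (V E : finType) (org tgt : E -> V) (gn : E -> I) u r :
  injective (fun e => (gn e, org e)) -> injective (fun e => (gn e, tgt e)) ->
  (forall v, exists g, walk org tgt (fun e => fgl (gn e, false)) setT u v g) ->
  (r + #|V| = #|E|.+1)%N ->
  grank (walk org tgt (fun e => fgl (gn e, false)) setT u u) r.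
Proof.
move=> fo ft cn rE.
have yP y : (forall g, walk org tgt (fun e => fgl (gn e, false)) setT u u g <-> gens y g) ->
    forall g, walk org tgt (fun e => fgl (gn e, false)) setT u u g <->
      gens (codom (fun i : 'I_(size y) => nth 1 y i)) g.
  by move=> h g; rewrite codom_nth.
split=> [|y /yP h|y sy /yP h].
- have [y [sy h]] := walk_gens cn; exists y; split=> //.
  by move: sy rE; rewrite cardsT; move: #|_| #|_|; clear; lia.
- by rewrite -(leq_add2r #|V|) rE; apply: (folded_rank fo ft cn h).
by apply: (folded_basis fo ft cn h); rewrite sy.
Qed.

Lemma grank_eq H K r : (forall g, H g <-> K g) -> grank H r -> grank K r.
Proof.
move=> HK [[y [sy yP]] min bas]; split.
- by exists y; split=> // g; rewrite -HK.
- by move=> z zP; apply: min => g; rewrite HK.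
by move=> z sz zP; apply: bas => // g; rewrite HK.
Qed.

Lemma grank_uniq H r r' : grank H r -> grank H r' -> r = r'.
Proof.
move=> [[y [sy yP]] min _] [[y' [sy' yP']] min' _].
by apply/eqP; rewrite eqn_leq -{2}sy -{1}sy' min // min'.
Qed.

Lemma flatten_prod z : \prod_(l <- flatten [seq fgword g | g <- z]) fgl l = \prod_(g <- z) g.
Proof.
elim: z => [|g z IHz]; first by rewrite !big_nil.
by rewrite /= big_cat big_cons /= IHz -fg_prod.
Qed.

Section PathGens.
Variables (H : freeGroup I -> Prop) (z : seq (freeGroup I)).
Hypothesis zP : forall g, H g <-> gens z g.
Let s := flatten [seq fgword g | g <- z].
Let sH : subgrp H.
Proof.
have [h1 h2 h3] := gen_subgrp (fun g => g \in z).
split; [by apply/zP | by move=> g h /zP gz /zP hz; apply/zP; apply: h2|].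
by move=> g /zP gz; apply/zP; apply: h3.
Qed.

Let gensH y : (forall g, g \in y -> H g) -> H (\prod_(g <- y) g).
Proof.
have [h1 h2 _] := sH; elim: y => [|g y IHy] yH; first by rewrite big_nil.
rewrite big_cons; apply: h2; first by apply: yH; rewrite inE eqxx.
by apply: IHy => h hy; apply: yH; rewrite inE hy orbT.
Qed.

Let zH g : g \in z -> H g.
Proof. by move=> gz; apply/zP; apply: gen_in. Qed.

Lemma pwalk_gens g : H g <-> walk (pqorg (s := s) (H := H)) (pqtgt (s := s) (H := H))
  (fun e => fgl (pqgen e, false)) setT (pi (@prel _ s H) ord0) (pi (@prel _ s H) ord0) g.
Proof.
split; last exact: pwalk_in.
move/zP; apply: gen_min; first exact: walk_subgrp.
move=> {}g gz; have [h1 h2 h3] := sH.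
have zE := cat_take_drop (index g z) z; rewrite (drop_nth 1) ?index_mem // nth_index // in zE.
set z1 := take _ z in zE; set z2 := drop _ z in zE.
have sE : s = flatten [seq fgword h | h <- z1] ++ fgword g ++ flatten [seq fgword h | h <- z2].
  by rewrite /s -zE map_cat flatten_cat.
set sa := flatten _ in sE.
have pa : ppre s (size sa) = \prod_(h <- z1) h.
  by rewrite /ppre sE take_size_cat // flatten_prod.
have pb : ppre s (size sa + size (fgword g)) = (\prod_(h <- z1) h) * g.
  rewrite /ppre sE catA take_size_cat ?size_cat // big_cat /= flatten_prod.
  by rewrite -fg_prod.
have Ha : H (\prod_(h <- z1) h) by apply: gensH => h /mem_take/zH.
have Hb : H (\prod_(h <- z1) h * g) by apply: h2 => //; apply: zH.
have bs : (size sa + size (fgword g) <= size s)%N.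
  by rewrite sE !size_cat addnA leq_addr.
have p0 t : (t <= size s)%N -> H (ppre s t) -> pi (@prel _ s H) (inord t) = pi (@prel _ s H) ord0.
  move=> ts Ht; apply/eqP; rewrite piE; last exact: pprel_eq.
  by apply/asboolP; rewrite inordK // [ppre s ord0]/ppre take0 big_nil invg1 mulg1.
have := @pwalk_pre _ s H sH setT _ _ (leq_addr (size (fgword g)) (size sa)) bs.
rewrite !p0 ?pa ?pb // ?mulKg; last by apply: leq_trans bs; apply: leq_addr.
by apply=> j _; rewrite inE.
Qed.

Lemma grank_ex : exists2 r, grank H r & (r <= size z)%N.
Proof.
have fo := pfold_org (s := s) sH; have ft := pfold_tgt (s := s) sH.
have cn := pwalk_conn (s := s) sH.
have [y [sy _]] := walk_gens cn.
have gr : grank H (size y).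
  by apply: (grank_eq (fun g => iff_sym (pwalk_gens g))); apply: folded_grank; rewrite // sy cardsT.
by exists (size y) => //; have [_ + _] := gr; apply.
Qed.

End PathGens.

(** The loops of the part of the Stallings graph of [H] that the path of [w] covers. *)
Definition path_gens H (w : freeGroup I) : freeGroup I -> Prop :=
  gen (fun g => g = w \/ exists i j, [/\ (i <= size (fgword w))%N, (j <= size (fgword w))%N,
    H (ppre (fgword w) i * (ppre (fgword w) j)^-1) &
    g = ppre (fgword w) i * (ppre (fgword w) j)^-1]).

(** [w] is put in front of the generators, so its path is an initial part of the Stallings graph.
    The subgraph it covers gives a free factor, since the total number of generators is still the
    rank. *)
Lemma path_split H w z r : (forall g, H g <-> gens z g) -> H w -> grank H r ->
  exists y0 y1, [/\ (size y0 + size y1 = r)%N, forall g, H g <-> gens (y0 ++ y1) g &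
    forall g, path_gens H w g <-> gens y0 g].
Proof.
move=> zP Hw gr; pose z' := w :: z.
have zP' g : H g <-> gens z' g.
  split; first by move/zP; apply: gen_sub => h hz; apply: gen_in; rewrite inE hz orbT.
  move=> gz'; apply/zP; move: gz'; apply: gen_sub => h; rewrite inE => /orP[/eqP->|hz].
    by apply/zP.
  exact: gen_in.
have sH : subgrp H.
  have [h1 h2 h3] := gen_subgrp (fun g => g \in z).
  split; [by apply/zP | by move=> g h /zP gz /zP hz; apply/zP; apply: h2|].
  by move=> g /zP gz; apply/zP; apply: h3.
pose s := flatten [seq fgword g | g <- z'].
have fo := pfold_org (s := s) sH; have ft := pfold_tgt (s := s) sH.
have cn := pwalk_conn (s := s) sH; have eP := pprel_eq (s := s) sH.
pose m := size (fgword w).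
have ms : (m <= size s)%N by rewrite /s /= size_cat leq_addr.
have preE t : (t <= m)%N -> ppre s t = ppre (fgword w) t.
  by move=> tm; rewrite /ppre /s /= takel_cat.
have Iord t : (t <= m)%N -> (inord t : 'I_(size s).+1) = t :> nat.
  by move=> tm; rewrite inordK // ltnS (leq_trans tm).
have piH t t' : (t <= m)%N -> (t' <= m)%N ->
    (pi (@prel _ s H) (inord t) == pi (@prel _ s H) (inord t')) =
    `[< H (ppre (fgword w) t * (ppre (fgword w) t')^-1) >].
  by move=> tm tm'; rewrite piE // /prel !Iord // !preE.
have pi0 : (inord 0 : 'I_(size s).+1) = ord0 by apply: val_inj; rewrite /= inordK.
pose E0 : {set quo (@pedge _ s H)} := [set pi _ j | j : 'I_(size s) & (j < m)%N].
pose B0 : {set quo (@prel _ s H)} := [set v | [exists j : 'I_m.+1, v == pi _ (inord j)]].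
have B0i t : (t <= m)%N -> pi (@prel _ s H) (inord t) \in B0.
  by move=> tm; rewrite inE; apply/existsP; exists (Ordinal (tm : (t < m.+1)%N)).
have E0P e : e \in E0 -> exists a b x, [/\ (a <= m)%N, (b <= m)%N,
    pqorg e = pi _ (inord a) /\ pqtgt e = pi _ (inord b), fgl (pqgen e, false) = x &
    ppre (fgword w) b = ppre (fgword w) a * x].
  case/imsetP => j; rewrite inE => jm ->; have [o t g] := pq_rep sH j.
  have := ppre_chord j; rewrite o t g /porg /ptgt /pend.
  have j1 : (j <= m)%N by apply: ltnW.
  case: (plet j).2 => /=; rewrite !Iord // !preE // => ch.
    by exists j.+1, (nat_of_ord j), (fgl ((plet j).1, false)).
  by exists (nat_of_ord j), j.+1, (fgl ((plet j).1, false)).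
have wpre t : (t <= m)%N -> walk (pqorg (s := s) (H := H)) (pqtgt (s := s) (H := H))
    (fun e => fgl (pqgen e, false)) E0 (pi (@prel _ s H) ord0) (pi (@prel _ s H) (inord t))
    (ppre (fgword w) t).
  move=> tm; have := @pwalk_pre _ s H sH E0 t 0 (leq0n _) (leq_trans tm ms).
  rewrite pi0 [ppre s 0]/ppre take0 big_nil invg1 mul1g preE //; apply=> j jt.
  by apply/imsetP; exists j; rewrite // inE (leq_trans jt).
have B0P v : reflect (exists g, walk (pqorg (s := s) (H := H)) (pqtgt (s := s) (H := H))
    (fun e => fgl (pqgen e, false)) E0 (pi (@prel _ s H) ord0) v g) (v \in B0).
  apply: (iffP idP) => [|[g]].
    rewrite inE => /existsP[j /eqP->]; exists (ppre (fgword w) j); apply: wpre.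
    by rewrite -ltnS.
  elim=> [|e x /E0P[a [b [y [am bm [o t] _ _]]]] _ _|e x /E0P[a [b [y [am bm [o t] _ _]]]] _ _].
  - by rewrite -pi0; apply: B0i.
  - by rewrite t; apply: B0i.
  by rewrite o; apply: B0i.
have E0B e : e \in E0 -> (pqorg e \in B0) && (pqtgt e \in B0).
  by move=> /E0P[a [b [y [am bm [-> ->] _ _]]]]; rewrite !B0i.
have [y0 [y1 [s0 s1 w0 w1]]] := walk_gens_rel (subsetT E0) B0P E0B cn.
have yP g : H g <-> gens (y0 ++ y1) g by rewrite -w1; apply: pwalk_gens.
have gr' : grank H (size y0 + size y1).
  apply: (grank_eq (fun g => iff_sym (pwalk_gens zP' g))); apply: folded_grank => //.
  have aux (a b b0 v e0 e : nat) : (a + b0)%N = e0.+1 -> (b + v + e0)%N = (e + b0)%N ->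
    (a + b + v)%N = e.+1 by clear; lia.
  by apply: (aux _ _ _ _ _ _ s0); rewrite s1 cardsT.
exists y0, y1; split=> // [|g]; first exact: grank_uniq gr' gr.
rewrite -w0; split.
  apply: gen_min; first exact: walk_subgrp.
  move=> {}g [->|[i [j [im jm Hij ->]]]].
    have /eqP e : pi (@prel _ s H) (inord m) == pi (@prel _ s H) (inord 0).
      rewrite piH // /ppre take0 big_nil take_size -fg_prod invg1 mulg1.
      exact/asboolP.
    have := wpre m (leqnn m); rewrite e pi0.
    by rewrite /ppre take_size -fg_prod.
  apply: walk_trans (walk_sym (wpre j jm)).
  have /eqP <- : pi (@prel _ s H) (inord i) == pi (@prel _ s H) (inord j).
    by rewrite piH //; apply/asboolP.
  exact: wpre.
have [h1 h2 h3] : subgrp (path_gens H w) by apply: gen_subgrp.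
have ext a b : (a <= m)%N -> (b <= m)%N -> pi (@prel _ s H) (inord a) = pi (@prel _ s H) (inord b) ->
    path_gens H w (ppre (fgword w) a * (ppre (fgword w) b)^-1).
  move=> am bm /eqP; rewrite piH // => /asboolP h; apply: gen_in; right.
  by exists a, b.
move=> wg.
suff K v : walk (pqorg (s := s) (H := H)) (pqtgt (s := s) (H := H))
    (fun e => fgl (pqgen e, false)) E0 (pi (@prel _ s H) ord0) v g ->
    exists2 t, (t <= m)%N & v = pi _ (inord t) /\ path_gens H w (g * (ppre (fgword w) t)^-1).
  have [t tm [/esym e h]] := K _ wg; rewrite -pi0 in e.
  have := h2 _ _ h (ext _ _ tm (leq0n _) e).
  by rewrite mulgA mulgKV /ppre take0 big_nil invg1 mulg1.
elim=> [|e x /E0P[a [b [y [am bm [o t] -> pe]]]] _ [c cm [oc h]]|e x /E0P[a [b [y [am bm [o t] -> pe]]]] _ [c cm [oc h]]].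
- by exists 0%N; rewrite // pi0 /ppre take0 big_nil invg1 mulg1.
- exists b => //; split=> //; rewrite o in oc.
  have := h2 _ _ h (ext _ _ cm am (esym oc)).
  by rewrite pe invMg !mulgA mulgKV mulgK.
exists a => //; split=> //; rewrite t in oc.
have := h2 _ _ h (ext _ _ cm bm (esym oc)).
by rewrite pe invMg !mulgA mulgKV.
Qed.

End FreeRank.

Section Rank.
Import classical_sets.
Variable G : groupType.
Implicit Types (H : classical_sets.set G).

Lemma is_basisP (J : choiceType) (x : J -> G) H :
  is_basis x H <-> injective (weval x) /\ forall g, H g <-> exists u, g = weval x u.
Proof.
split=> -[ix h]; split=> //.
  by move=> g; rewrite -h; split=> [[u _ <-]|[u ->]]; exists u.
apply: funext => g; apply: propext; rewrite h.
by split=> [[u _ <-]|[u ->]]; exists u.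
Qed.

Lemma is_subgroupP H : is_subgroup H <-> subgrp H.
Proof.
have inH g : (g \in [in H]) <-> H g.
  by rewrite /in_mem /= -/(g \in H) in_setE.
split=> [[h1 hD]|[h1 hM hV]].
  have H1 : H 1%g by apply/inH.
  have HD g h : H g -> H h -> H (g / h)%g by move=> /inH Hg /inH Hh; apply/inH; apply: hD.
  have HV g : H g -> H (g^-1)%g by move=> Hg; rewrite -(mul1g (g^-1)%g); apply: HD.
  by split=> // g h Hg Hh; rewrite -(invgK h); apply: HD => //; apply: HV.
split; first by apply/inH.
by move=> g h /inH Hg /inH Hh; apply/inH; apply: hM => //; apply: hV.
Qed.

Lemma nat_infP (P : classical_sets.set nat) n :
  nat_inf P = Some n <-> P n /\ forall m, P m -> (n <= m)%N.
Proof.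
rewrite /nat_inf; case: pselect => [exP|nP]; last first.
  by split=> // -[Pn _]; case: nP; exists n; apply/asboolP.
case: ex_minnP => m /asboolP Pm min; split=> [[<-]|[Pn le]].
  by split=> // k Pk; apply: min; apply/asboolP.
by congr Some; apply/eqP; rewrite eqn_leq le // min //; apply/asboolP.
Qed.

Lemma nat_inf_None (P : classical_sets.set nat) : nat_inf P = None -> forall n, ~ P n.
Proof. by rewrite /nat_inf; case: pselect => // nP _ n Pn; apply: nP; exists n; apply/asboolP. Qed.

End Rank.

Section FreeRank2.
Variable I : choiceType.
Local Open Scope group_scope.
Implicit Types (H K : freeGroup I -> Prop) (y z : seq (freeGroup I)) (w : freeGroup I).

Lemma gens_nth y g : gens y g <-> exists u : freeGroup 'I_(size y), g = weval (fun i => nth 1 y (nat_of_ord i)) u.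
Proof. by rewrite -{1}(codom_nth y) gens_weval. Qed.

Lemma wgen_prim H w r : grank H r -> wgen_le H w r -> primitive_in H w.
Proof.
move=> [_ min bas] [z [sz zP]]; have sr : size (w :: z) = r.
  by apply/eqP; rewrite eqn_leq min // andbT.
exists 'I_(size (w :: z)), (fun i => nth 1 (w :: z) (nat_of_ord i)); split.
  apply/is_basisP; split; first exact: (bas _ sr zP).
  by move=> g; rewrite zP gens_nth.
by exists ord0.
Qed.

Lemma rank_grank H r : grank H r -> rank H = Some r.
Proof.
move=> [[y [sy yP]] min bas]; apply/nat_infP; split.
  rewrite -sy; exists (fun i : 'I_(size y) => nth 1 y i); apply/is_basisP.
  by split; [apply: bas | move=> g; rewrite yP gens_nth].
move=> m [x /is_basisP[_ xP]]; have := min (codom x).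
rewrite size_codom card_ord; apply=> g; by rewrite xP gens_weval.
Qed.

(** The index type [J] of the basis is arbitrary. The finite set [S] of members occurring in the
    generators [y], with [w] added, already generates [H]; a map from [S] to a group of order 2 is
    determined by its values on [y], whence [S] has at most [r] elements. *)
Lemma prim_wgen H w r : grank H r -> primitive_in H w -> wgen_le H w r.
Proof.
move=> [[y [sy yP]] min _] [J [x [/is_basisP[ix xP] [j0 _ xj0]]]].
have yx i : exists u, nth 1 y i = weval x u.
  have [iy|iy] := ltnP i (size y); first by apply/xP/yP/gen_in/mem_nth.
  by exists 1; rewrite nth_default // weval1.
have [u uE] := choice yx.
pose S := undup (j0 :: flatten [seq [seq l.1 | l <- fgword (u i)] | i <- iota 0 (size y)]).
have uS : uniq S by apply: undup_uniq.
have j0S : j0 \in S by rewrite mem_undup inE eqxx.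
have SP g : H g <-> gens [seq x j | j <- S] g.
  rewrite yP; split.
    apply: gen_sub => h /(nthP 1)[i iy <-]; rewrite uE /weval.
    have lS l : l \in fgword (u i) -> l.1 \in S.
      move=> lu; rewrite mem_undup inE; apply/orP; right; apply/flatten_mapP.
      by exists i; [rewrite mem_iota | apply: map_f].
    elim: (fgword (u i)) lS => [|l t IHt] lS; first by rewrite big_nil; apply: gen1.
    rewrite big_cons; apply: gen_mul; last first.
      by apply: IHt => l' l't; apply: lS; rewrite inE l't orbT.
    have hx : gens [seq x j | j <- S] (x l.1).
      by apply: gen_in; apply: map_f; apply: lS; rewrite inE eqxx.
    by rewrite /leval; case: l.2 => //; apply: gen_inv.
  apply: gen_sub => h /mapP[j _ ->]; apply/yP/xP; exists (fgl (j, false)).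
  by rewrite weval_fgl.
have sSr : (size S <= r)%N.
  pose T := 'S_2.
  pose ext (a : {ffun 'I_(size S) -> T}) (j : J) : T :=
    if insub (index j S) is Some i then a i else 1%g.
  pose f (a : {ffun 'I_(size S) -> T}) : {ffun 'I_(size y) -> T} :=
    [ffun i : 'I_(size y) => weval (ext a) (u i)].
  have fi : injective f.
    move=> a a' /ffunP e; apply/ffunP => i.
    pose j := nth j0 S i.
    have /yP/gens_nth[v vE] : H (x j) by apply/xP; exists (fgl (j, false)); rewrite weval_fgl.
    have jv : fgl (j, false) = weval (fun i : 'I_(size y) => u i) v.
      apply: ix; rewrite weval_fgl /leval /= vE weval_weval.
      by rewrite /weval; apply: eq_bigr => l _; rewrite /leval uE.
    have aE (b : {ffun 'I_(size S) -> T}) : b i = weval (ext b) (fgl (j, false)).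
      rewrite weval_fgl /leval /= /ext /j index_uniq // insubT /= ?ltn_ord // => h.
      by congr (b _); apply: val_inj.
    rewrite !aE jv !weval_weval /weval; apply: eq_bigr => l _.
    by have := e l.1; rewrite !ffunE /weval /leval /= => ->.
  have := leq_card f fi; rewrite !card_ffun !card_ord -sy.
  by rewrite card_Sn leq_exp2l.
exists [seq x j | j <- rem j0 S]; split.
  by rewrite size_map size_rem // (leq_trans _ sSr) // prednK //; case: (S) j0S.
move=> g; rewrite SP; have pS := perm_to_rem j0S.
split; apply: gen_sub => h hS; apply: gen_in; move: hS;
  by rewrite -xj0 -map_cons (perm_mem (perm_map x pS)).
Qed.

Definition prim_bound n w := forall H m, subgrp H -> rank H = Some m -> H w ->
  ~ primitive_in H w -> (n <= m)%N.

Lemma prim_bound_pi_hyp n w : prim_bound n w -> pi_hyp n w.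
Proof.
move=> pb H k kn [z [sz zP]] Hw; have [r gr rz] := grank_ex zP.
have [h1 h2 h3] := gen_subgrp (fun g => g \in z).
have sH : subgrp H.
  split; [by apply/zP | by move=> g h /zP gz /zP hz; apply/zP; apply: h2|].
  by move=> g /zP gz; apply/zP; apply: h3.
have rk := leq_trans rz sz.
apply: (wgen_le_mono rk); apply: prim_wgen => //.
apply: contrapT => np; have := pb H r sH (rank_grank gr) Hw np.
by rewrite leqNgt (leq_ltn_trans rk kn).
Qed.

End FreeRank2.

Section FreeRank3.
Variable I : choiceType.
Local Open Scope group_scope.
Implicit Types (H K : freeGroup I -> Prop) (y z : seq (freeGroup I)) (w : freeGroup I).

Lemma grank_rank H m : rank H = Some m -> grank H m.
Proof.
move=> rk; have /nat_infP[[x /is_basisP[_ xP]] _] := rk.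
have [r gr _] := grank_ex (fun g => iff_trans (xP g) (iff_sym (gens_weval x g))).
by have := rank_grank gr; rewrite rk => -[->].
Qed.

Lemma grank_subgrp H r : grank H r -> subgrp H.
Proof.
move=> [[z [_ zP]] _ _]; have [h1 h2 h3] := gen_subgrp (fun g => g \in z).
split; [by apply/zP | by move=> g h /zP gz /zP hz; apply/zP; apply: h2|].
by move=> g /zP gz; apply/zP; apply: h3.
Qed.

Lemma gens_nil (G : groupType) (g : G) : gens [::] g -> g = 1.
Proof. by elim=> // x h; rewrite inE. Qed.

(** In a basis of [H] that contains [w], [w] is a single letter. The part of the Stallings graph of
    [K] it covers is one loop, so [w] completes the remaining generators of [K]. *)
Lemma wgen_sub H K w r k : grank H r -> wgen_le H w r -> (forall g, K g -> H g) ->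
  K w -> grank K k -> wgen_le K w k.
Proof.
move=> [_ min bas] [z [sz zP]] KH Kw gK; pose y := w :: z.
have sr : size y = r by apply/eqP; rewrite eqn_leq min // andbT.
pose f := weval (fun i : 'I_(size y) => nth 1 y (nat_of_ord i)).
have fi : injective f by apply: bas.
have fM : {morph f : a b / a * b} := wevalM _; have f1 : f 1 = 1 := weval1 _.
pose K' u := K (f u).
have [[yk [syk ykP]] _ _] := gK.
have fH g : H g -> exists u, g = f u by move/zP/gens_nth.
have ykf i : exists u, nth 1 yk i = f u.
  have [iy|iy] := ltnP i (size yk); first by apply/fH/KH/ykP/gen_in/mem_nth.
  by exists 1; rewrite nth_default.
have [v vE] := choice ykf; pose vs := mkseq v (size yk).
have vsE : [seq f u | u <- vs] = yk.
  rewrite -[RHS](mkseq_nth 1) /vs /mkseq -map_comp; apply: eq_map => i /=.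
  by rewrite vE.
have vsP u : K' u <-> gens vs u.
  rewrite /K' ykP -vsE gens_morph //; split=> [[u' gu' /fi->]//|gu].
  by exists u.
have [r' gr' rk'] := grank_ex vsP.
pose x0 : freeGroup 'I_(size y) := fgl (ord0, false).
have fx0 : f x0 = w by rewrite /f weval_fgl.
have Kx0 : K' x0 by rewrite /K' fx0.
have [y0 [y1 [s01 y01P y0P]]] := path_split vsP Kx0 gr'.
have pp i : (i <= size (fgword x0))%N -> gens [:: x0] (ppre (fgword x0) i).
  case: i => [|[|//]] _; first by rewrite /ppre take0 big_nil; apply: gen1.
  by rewrite /ppre /= big_seq1; apply: gen_in; rewrite inE.
have y0E g : gens y0 g <-> gens [:: x0] g.
  rewrite -y0P; split; apply: gen_sub => h.
    move=> [->|[i [j [im jm _ ->]]]]; first by apply: gen_in; rewrite inE.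
    by apply: gen_mul; [apply: pp | apply/gen_inv/pp].
  by rewrite inE => /eqP->; apply: gen_in; left.
have y0n : (0 < size y0)%N.
  rewrite lt0n; apply/negP => /eqP/size0nil y00; have : gens y0 x0.
    by apply/y0E/gen_in; rewrite inE.
  by rewrite y00 => /gens_nil/(congr1 (@fgword _)).
have K'P u : K' u <-> gens (x0 :: y1) u.
  rewrite y01P; split; apply: gen_sub => h.
    rewrite mem_cat => /orP[hy|hy]; last by apply: gen_in; rewrite inE hy orbT.
    have /y0E : gens y0 h by apply: gen_in.
    by apply: gen_sub => h' ; rewrite inE => /eqP->; apply: gen_in; rewrite inE eqxx.
  rewrite inE => /orP[/eqP->|hy]; last by apply: gen_in; rewrite mem_cat hy orbT.
  have /y0E : gens [:: x0] x0 by apply: gen_in; rewrite inE.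
  by apply: gen_sub => h' hy; apply: gen_in; rewrite mem_cat hy.
exists [seq f u | u <- y1]; split.
  rewrite size_map; apply: leq_trans (leq_trans rk' _); first by rewrite -s01 -add1n leq_add2r.
  by rewrite /vs size_mkseq syk.
move=> g; rewrite -fx0 -map_cons gens_morph //; split=> [Kg|[u /K'P Ku ->] //].
by have [u ug] := fH g (KH g Kg); exists u => //; apply/K'P; rewrite /K' -ug.
Qed.

Lemma gens1 (z g : freeGroup I) : gens [:: z] g -> exists m, g = z ^+ m \/ g = (z ^+ m)^-1.
Proof.
elim=> [|x h|x h]; first by exists 0%N; left.
  rewrite inE => /eqP-> _ [[|m] [->|->]].
  - by exists 1%N; left; rewrite mulg1.
  - by exists 1%N; left; rewrite invg1 mulg1.
  - by exists m.+2; left; rewrite -expgS.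
  - by exists m; right; rewrite expgSr invMg mulVKg.
rewrite inE => /eqP-> _ [[|m] [->|->]].
- by exists 1%N; right; rewrite mulg1.
- by exists 1%N; right; rewrite invg1 mulg1.
- by exists m; left; rewrite expgS mulKg.
by exists m.+2; right; rewrite -invMg -expgSr.
Qed.

Lemma non_power_neq1 w : non_power w -> w <> 1.
Proof. by move=> np w1; apply: (np 1 2%N) => //; rewrite expg1n. Qed.

Lemma non_power_gens1 w (z g : freeGroup I) : non_power w -> gens [:: z] w -> gens [:: z] g <-> gens [:: w] g.
Proof.
move=> np zw; have [m wE] := gens1 zw.
have m1 : m = 1%N.
  case: m wE => [|[|m]] // wE; exfalso.
    by apply: (non_power_neq1 np); case: wE => ->; rewrite ?invg1.
  case: wE => wE; first exact: (np z m.+2).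
  by apply: (np z^-1 m.+2) => //; rewrite expVgn.
rewrite m1 expg1 in wE.
split; apply: gen_sub => h; rewrite inE => /eqP->; last by [].
case: wE => ->; last rewrite -{2}(invgK z); last apply: gen_inv; by apply: gen_in; rewrite inE.
Qed.

(** A subgroup of rank at most one that contains a non-power is generated by it. *)
Lemma prim_bound2 w : non_power w -> prim_bound 2 w.
Proof.
move=> np H m sH rk Hw nprim; rewrite ltnNge; apply/negP => m1; apply: nprim.
have gr := grank_rank rk; have [[y [sy yP]] _ _] := gr.
have [z zP] : exists z : freeGroup I, forall g, H g <-> gens [:: z] g.
  case: y sy yP => [|z [|z' t]] sy yP; [|by exists z|by rewrite -sy in m1].
  exists 1 => g; rewrite yP; split; apply: gen_sub => h //.
  by rewrite inE => /eqP->; apply: gen1.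
have wP g : H g <-> gens [:: w] g.
  by rewrite zP; apply: non_power_gens1 => //; apply/zP.
have m0 : m = 1%N.
  apply/eqP; rewrite eqn_leq m1 lt0n; apply/negP => /eqP mm; move: sy; rewrite mm => /size0nil y0.
  by have := Hw; rewrite yP y0 => /gens_nil; apply: non_power_neq1.
by apply: (wgen_prim gr); exists [::]; rewrite m0.
Qed.

End FreeRank3.

Section CritGraph.
Local Open Scope group_scope.
Variables (I : choiceType) (w : freeGroup I) (L : nat) (c : 'I_L.+1 -> I * bool).
Hypothesis wE : fgword w = [seq c i | i <- enum 'I_L.+1].

Lemma ppre_pre t : (t <= L.+1)%N -> ppre (fgword w) t = pre c t.
Proof.
elim: t => [|t IHt] tL; first by rewrite /ppre take0 big_nil.
have sw : size (fgword w) = L.+1 by rewrite wE size_map size_enum_ord.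
rewrite /= -IHt ?(ltnW tL) // /ppre (take_nth (c ord0)) ?sw // -cats1 big_cat big_seq1 /=.
congr (_ * fgl _); rewrite wE (nth_map ord0) ?size_enum_ord //; congr c.
apply: ord_inj; rewrite nth_enum_ord // val_iter_ordS add0n modn_small //.
Qed.

Lemma cycword_word : cycword c = w.
Proof.
have sw : size (fgword w) = L.+1 by rewrite wE size_map size_enum_ord.
by rewrite /cycword -ppre_pre // /ppre -sw take_size -fg_prod.
Qed.

(** If the path of [w] missed part of the Stallings graph of [H], the covered part would have rank
    below [n]; [w] would be primitive in it by the bound, hence in [H]. So [H] is carried by the
    cycle of [w] with positions identified modulo [H]. *)
Lemma crit_prg H n : prim_bound n w -> grank H n -> H w -> ~ primitive_in H w ->
  exists Q : rel (unit * 'I_L.+1), ccl c id Q /\ forall g, H g <-> prg c Q g.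
Proof.
move=> pb gr Hw np; have [[z [sz zP]] _ _] := gr; have sH := grank_subgrp gr.
have [h1 h2 h3] := sH.
have HW : H (cycword c) by rewrite cycword_word.
have sw : size (fgword w) = L.+1 by rewrite wE size_map size_enum_ord.
pose Q := pot H (fun y : unit * 'I_L.+1 => pre c y.2); exists Q.
have cQ : ccl c id Q by apply: pot_pre.
have [y0 [y1 [s01 y01P y0P]]] := path_split zP Hw gr.
have QP g : path_gens H w g <-> prg c Q g.
  split.
    apply: gen_min; first exact: prg_subgrp.
    move=> {}g [->|[i [j [iL jL]]]]; first by rewrite -cycword_word; apply: prg_W.
    rewrite sw in iL jL; rewrite !ppre_pre // => Hij ->.
    (* The final point of the path is no position of the cycle; it is position 0 up to the factor
       [cycword c]. *)
    have dec k : (k <= L.+1)%N -> exists k' : 'I_L.+1, exists e,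
        [/\ prg c Q e, H e & pre c k = e * pre c k'].
      rewrite leq_eqVlt => /orP[/eqP->|kL].
        by exists ord0, (cycword c); split; [exact: prg_W | by [] | rewrite /= mulg1].
      by exists (Ordinal kL), 1; split; [exact: gen1 | by [] | rewrite mul1g].
    have [i' [e [Qe He ei]]] := dec i iL; have [j' [e' [Qe' He' ej]]] := dec j jL.
    have [q1 q2 q3] := prg_subgrp c Q.
    rewrite ei ej invMg mulgA; apply: (q2); last exact: q3.
    rewrite -mulgA; apply: (q2) => //; apply: (@prg_in _ _ c _ Q (tt, i') (tt, j')).
    apply/asboolP; have := h2 _ _ (h2 _ _ (h3 _ He) Hij) He'.
    by rewrite ei ej invMg !mulgA mulVg mul1g mulgKV.
  apply: prg_min; first exact: gen_subgrp.
    by apply: gen_in; left; rewrite cycword_word.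
  move=> a b /asboolP Hab; apply: gen_in; right; exists a.2, b.2.
  have la : (a.2 <= L.+1)%N by apply/ltnW/ltn_ord.
  have lb : (b.2 <= L.+1)%N by apply/ltnW/ltn_ord.
  by rewrite sw (ppre_pre la) (ppre_pre lb).
have y10 : y1 = [::].
  apply/size0nil/eqP; rewrite -leqn0 leqNgt; apply/negP => y1n; apply: np.
  have [z' [sz' z'P]] : wgen_le (path_gens H w) w (size y0).
    apply: (prim_bound_pi_hyp pb); first by rewrite -s01 -addn1 leq_add2l.
      by exists y0.
    by apply: gen_in; left.
  apply: (wgen_prim gr); exists (z' ++ y1); split; first by rewrite size_cat -s01 ltn_add2r.
  move=> g; rewrite y01P !gens_cat -cat_cons gens_cat.
  by split; apply: gen_sub => h; [case; [move=> /y0P/z'P ? | move=> ?] | case; [move=> /z'P/y0P ? | move=> ?]];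
    apply: gen_in; auto.
split=> // g; rewrite y01P y10 cats0 -y0P; exact: QP.
Qed.

End CritGraph.

(** * Counting lifts and expanding in 1/N *)

Section Counting.
Local Open Scope nat_scope.
Implicit Types (A : finType).

Lemma prod_rank A (S : {set A}) (r : A -> nat) (g : nat -> nat) : injective r ->
  \prod_(q in S) g #|[set q' in S | r q' < r q]| = \prod_(j < #|S|) g j.
Proof.
move=> ri; move cS: #|S| => n; elim: n S cS => [|n IHn] S cS.
  by rewrite (cards0_eq cS) big_set0 big_ord0.
have /card_gt0P[q0 q0S] : 0 < #|S| by rewrite cS.
case: (arg_maxnP r q0S) => m mS0 mmax0.
have mS : m \in S := mS0; have mmax q : q \in S -> r q <= r m := mmax0 q; clear mS0 mmax0.
have cSm : #|S :\ m| = n by move: cS; rewrite (cardsD1 m) mS => -[].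
rewrite big_ord_recr /= -(IHn _ cSm) (big_setD1 m mS) /= mulnC; congr (_ * g _).
  apply: eq_bigr => q /setD1P[qm qS]; congr g; apply: eq_card => q'; rewrite !inE.
  have [->|//] := eqVneq q' m; rewrite mS /=; apply/negbTE; rewrite -leqNgt.
  exact: mmax.
rewrite -cSm; apply: eq_card => q; rewrite !inE; case: eqVneq => [->|qm].
  by rewrite ltnn andbF.
case qS : (q \in S) => //=; rewrite ltn_neqAle mmax // andbT.
by rewrite (inj_eq ri).
Qed.

Section ColorInjective.
Variables (A : finType) (R : rel A) (N : nat).
Hypothesis eR : equivalence_rel R.

Definition colinj (S : {set A}) (f : {ffun A -> 'I_N.+1}) :=
  [forall a in S, forall b in S, R a b ==> (f a == f b) ==> (a == b)] &&
  [forall a, (a \notin S) ==> (f a == ord0)].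

Lemma colinjP (S : {set A}) (f : {ffun A -> 'I_N.+1}) : reflect
  ({in S &, forall a b, R a b -> f a = f b -> a = b} /\ forall a, a \notin S -> f a = ord0)
  (colinj S f).
Proof.
apply: (iffP andP) => [[/forall_inP h1 /forallP h2]|[h1 h2]].
  split=> [a b aS bS Rab fab|a aS]; last by apply/eqP; have := h2 a; rewrite aS.
  by have /forall_inP/(_ b bS) := h1 a aS; rewrite Rab fab eqxx => /eqP.
split; last by apply/forallP => a; apply/implyP => /h2->.
apply/forall_inP => a aS; apply/forall_inP => b bS; apply/implyP => Rab.
by apply/implyP => /eqP/(h1 a b aS bS Rab)->.
Qed.

Definition upd (g : {ffun A -> 'I_N.+1}) a v : {ffun A -> 'I_N.+1} :=
  [ffun b => if b == a then v else g b].

Lemma colinj_step (S : {set A}) a : a \notin S ->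
  #|[set f | colinj (a |: S) f]| =
  #|[set f | colinj S f]| * (N.+1 - #|[set b in S | R b a]|).
Proof.
move=> aS; rewrite -sum1_card (partition_big (fun f => upd f a ord0)
  (mem [set f | colinj S f])) /=; last first.
  move=> f; rewrite !inE => /colinjP[h1 h2]; apply/colinjP; split=> [b b' bS b'S|b bS].
    rewrite !ffunE; have ba : b != a by apply: contraNneq aS => <-.
    have b'a : b' != a by apply: contraNneq aS => <-.
    by rewrite (negPf ba) (negPf b'a); apply: h1; rewrite !inE ?bS ?b'S orbT.
  rewrite ffunE; case: eqVneq => // ba; apply: h2.
  by rewrite !inE (negPf ba).
rewrite -sum_nat_const; apply: eq_bigr => g; rewrite inE => /colinjP[g1 g2].
pose B := [set g b | b in [set b in S | R b a]].
have cB : #|B| = #|[set b in S | R b a]|.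
  apply: card_in_imset => b b'; rewrite !inE => /andP[bS ba] /andP[b'S b'a].
  by apply: g1 => //; apply: (eqr_trans eR ba); rewrite (eqr_sym eR).
have <- : #|~: B| = N.+1 - #|[set b in S | R b a]|.
  by rewrite -cB -[X in X - _](card_ord N.+1) -(cardsC B) addKn.
rewrite sum1_card -(card_imset (mem (~: B)) (f := upd g a)); last first.
  by move=> v v' /ffunP/(_ a); rewrite !ffunE eqxx.
apply: eq_card => f; rewrite [LHS]unfold_in /= inE; apply/andP/imsetP.
  move=> [/colinjP[f1 f2] /eqP fg]; exists (f a).
    rewrite !inE; apply/imsetP => -[b]; rewrite inE => /andP[bS ba].
    have bna : b != a by apply: contraNneq aS => <-.
    rewrite -fg ffunE (negPf bna) => e; have := f1 a b; rewrite !inE eqxx bS orbT.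
    move=> /(_ isT isT); rewrite (eqr_sym eR) ba => /(_ isT e) e'.
    by rewrite e' eqxx in bna.
  by apply/ffunP => b; rewrite -fg !ffunE; case: eqVneq => [->|].
move=> [v]; rewrite !inE => vB ->; split.
  apply/colinjP; split=> [b b'|b]; last first.
    by rewrite !inE negb_or ffunE => /andP[/negPf-> /g2].
  rewrite !inE !ffunE; case: (eqVneq b a) => [->|ba] /= bS; case: (eqVneq b' a) => [->|b'a] //= b'S.
  - move=> r e; case/imsetP: vB; exists b' => //; rewrite inE b'S.
    by rewrite (eqr_sym eR).
  - move=> r e; case/imsetP: vB; exists b => //; by rewrite inE bS.
  by apply: g1.
apply/eqP/ffunP => b; rewrite !ffunE; case: eqVneq => // ->.
by rewrite g2.
Qed.

Lemma card_colinj :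
  #|[set f : {ffun A -> 'I_N.+1} | [forall a, forall b, R a b ==> (f a == f b) ==> (a == b)]]| =
  \prod_a (N.+1 - #|[set b | (enum_rank b < enum_rank a) && R b a]|).
Proof.
pose S m : {set A} := [set a | enum_rank a < m].
have step m : m <= #|A| -> #|[set f | colinj (S m) f]| =
    \prod_(j < #|A| | j < m) (N.+1 - #|[set b | (enum_rank b < j) && R b (enum_val j)]|).
  elim: m => [_|m IHm mA].
    rewrite big_pred0 // (_ : [set f | _] = [set [ffun=> ord0]]) ?cards1 //.
    apply/setP => f; rewrite !inE; apply/colinjP/eqP => [[_ h]|->].
      by apply/ffunP => a; rewrite ffunE h // inE.
    by split=> [a b|a _]; rewrite ?inE // ffunE.
  pose a : A := enum_val (Ordinal mA).
  have SE : S m.+1 = a |: S m.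
    apply/setP => b; rewrite !inE ltnS leq_eqVlt; congr (_ || _).
    apply/eqP/eqP => [e|->]; last by rewrite enum_valK.
    by rewrite /a -[b]enum_rankK; congr enum_val; apply: val_inj.
  rewrite SE colinj_step; last by rewrite inE enum_valK ltnn.
  rewrite [RHS](bigD1 (Ordinal mA)) /= ?ltnSn // [RHS]mulnC (IHm (ltnW mA)); congr (_ * _).
    by apply: eq_bigl => j; rewrite ltnS ltn_neqAle andbC.
  by congr (_ - _); apply: eq_card => b; rewrite !inE.

have := step #|A| (leqnn _).
rewrite [X in _ = X -> _](eq_bigl (fun=> true)); last by move=> j; exact: ltn_ord.
rewrite (reindex enum_rank) /=; last by apply: onW_bij; apply: enum_rank_bij.
move=> e; rewrite -[LHS](_ : #|[set f | colinj (S #|A|) f]| = _).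
  by rewrite e; apply: eq_bigr => a _; rewrite enum_rankK.
apply: eq_card => f; rewrite !inE; apply/colinjP/forallP => [[h _] a|h].
  apply/forallP => b; apply/implyP => Rab; apply/implyP => /eqP fab.
  by apply/eqP; apply: h; rewrite // inE ltn_ord.
split=> [a b _ _ Rab fab|a]; last by rewrite inE ltn_ord.
by have /forallP/(_ b) := h a; rewrite Rab fab eqxx => /eqP.
Qed.

End ColorInjective.
End Counting.

(** * Counting lifts over a quotient of the single cycle *)

Section Lifts.
Variables (I : choiceType) (L : nat) (c : 'I_L.+1 -> I * bool).
Variables (X : finType) (tau : X -> X).
Local Notation Y := (X * 'I_L.+1)%type.
Local Notation Y1 := (unit * 'I_L.+1)%type.
Variables (C : finType) (e : 'I_L.+1 -> C) (J : rel Y1).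
Hypotheses (cJ : ccl c id J).
Hypothesis eP : forall i j, (e i == e j) = cedge c id J (tt, i) (tt, j).
Variable N : nat.
Implicit Types (s : {ffun C -> 'S_N.+1}) (f : {ffun Y -> 'I_N.+1}).

Definition prj (y : Y) : Y1 := (tt, y.2).
Definition act s i : 'S_N.+1 := if (c i).2 then ((s (e i))^-1)%g else s (e i).
Fixpoint pact s t : 'S_N.+1 :=
  if t is t'.+1 then (pact s t' * act s (iter t' (@ordS _) ord0))%g else 1%g.

Definition compat s f := [forall y, f (cnext tau y) == act s y.2 (f y)].

Lemma prj_org y : prj (corg c tau y) = corg c id (prj y).
Proof. by rewrite /prj /corg /cnext /= if_same; case: (c _).2. Qed.

Lemma prj_tgt y : prj (ctgt c tau y) = ctgt c id (prj y).
Proof. by rewrite /prj /ctgt /cnext /= if_same; case: (c _).2. Qed.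

(** A map on base points extends uniquely along the copies by following the letters. *)
Lemma card_marks s :
  #|[set h : {ffun X -> 'I_N.+1} | [forall x, h (tau x) == pact s L.+1 (h x)]]| =
  #|[set f | compat s f]|.
Proof.
pose F (h : {ffun X -> 'I_N.+1}) : {ffun Y -> 'I_N.+1} := [ffun y : Y => pact s y.2 (h y.1)].
have Fi : injective F.
  move=> h h' /ffunP E; apply/ffunP => x; have := E (x, ord0).
  by rewrite !ffunE /= !perm1.
have it (i : 'I_L.+1) : iter i (@ordS _) ord0 = i.
  by apply: ord_inj; rewrite val_iter_ordS add0n modn_small.
have pS (i : 'I_L.+1) u : act s i (pact s i u) = pact s i.+1 u by rewrite /= permM it.
have nx (y : Y) : (nat_of_ord y.2 = L /\ cnext tau y = (tau y.1, ord0)) \/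
    (nat_of_ord (ordS y.2) = y.2.+1 /\ cnext tau y = (y.1, ordS y.2)).
  rewrite /cnext; case: eqP => [->|ne]; [left|right]; split=> //.
    by congr pair; apply: ord_inj; rewrite /= modnn.
  rewrite /= modn_small // ltnS ltn_neqAle -ltnS ltn_ord andbT.
  by apply/eqP => h; apply: ne; apply: ord_inj.
rewrite -(card_imset _ Fi); apply: eq_card => f; rewrite [RHS]inE.
apply/imsetP/forallP => [[h]|fc].
  rewrite inE => /forallP hc -> y; rewrite !ffunE pS.
  have [[yL ->]|[yS ->]] := nx y; last by rewrite yS.
  by rewrite /= perm1 -/(pact s y.2.+1) yL.
have fE x t (tL : t < L.+1) : f (x, Ordinal tL) = pact s t (f (x, ord0)).
  elim: t tL => [|t IHt] tL.
    by rewrite /= perm1; congr (f (_, _)); apply: ord_inj.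
  have := fc (x, Ordinal (ltnW tL)); rewrite (IHt (ltnW tL)) (pS (Ordinal (ltnW tL))).
  have [[/= yL _]|[yS ->]] := nx (x, Ordinal (ltnW tL)); first by exfalso; have := tL; rewrite ltnS yL ltnn.
  by move=> /eqP <-; congr (f (_, _)); apply: ord_inj; rewrite /= modn_small.
exists [ffun x => f (x, ord0)].
  rewrite inE; apply/forallP => x; rewrite !ffunE.
  have := fc (x, ord_max); have [[_ ->]|[/= yS _]] := nx (x, ord_max); last first.
    by move: yS; rewrite modnn.
  have fm : f (x, ord_max) = pact s L (f (x, ord0)) by exact: fE.
  by move=> /eqP h; rewrite [f (tau x, _)]h fm; apply/eqP; exact: (pS ord_max).
apply/ffunP => -[x [t tL]]; rewrite !ffunE /=; exact: fE.
Qed.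

Lemma compat_edges s f : compat s f = [forall y, s (e y.2) (f (corg c tau y)) == f (ctgt c tau y)].
Proof.
apply: eq_forallb => y; rewrite /act /corg /ctgt; case: (c y.2).2; last by rewrite eq_sym.
by rewrite -[LHS](inj_eq (@perm_inj _ (s (e y.2)))) permKV.
Qed.

Definition rset (S : {set Y * Y}) : rel Y := fun a b => (a, b) \in S.
(** Values are compared only within a fibre of [J]: each vertex of the quotient by [J] carries its
    own copy of the $N+1$ points. *)
Definition fker f : {set Y * Y} :=
  [set p | J (prj p.1) (prj p.2) && (f p.1 == f p.2)].

Definition edge_count (S : {set Y * Y}) a :=
  #|[set q : quo (cedge c tau (rset S)) | e (qrep q).2 == a]|.

Lemma fker_equiv f : equivalence_rel (rset (fker f)).
Proof.
apply: equivalence_relT => [y|y y'|y y' y'']; rewrite /rset !inE /=.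
- by rewrite (eqr_refl cJ.1) eqxx.
- by rewrite (eqr_sym cJ.1) eq_sym.
by move=> /andP[h1 /eqP->] /andP[h2 ->]; rewrite (eqr_trans cJ.1 h1).
Qed.

Lemma colour_edge y y' : e y.2 = e y'.2 ->
  [/\ cgen c y = cgen c y', J (prj (corg c tau y)) (prj (corg c tau y')) &
      J (prj (ctgt c tau y)) (prj (ctgt c tau y'))].
Proof.
move/eqP; rewrite eP => /andP[/eqP g r]; rewrite !prj_org !prj_tgt; split=> //.
by rewrite -cJ.2.
Qed.

Lemma fker_ccl s f : compat s f -> ccl c tau (rset (fker f)).
Proof.
rewrite compat_edges => /forallP sf; split; first exact: fker_equiv.
move=> y y' g; rewrite /rset !inE /=.
have -> : J (prj (corg c tau y)) (prj (corg c tau y')) = J (prj (ctgt c tau y)) (prj (ctgt c tau y')).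
  by rewrite !prj_org !prj_tgt cJ.2.
case Jt: (J _ _) => //=.
have ee : e y.2 = e y'.2.
  apply/eqP; rewrite eP /cedge; apply/andP; split; first exact/eqP.
  by move: Jt; rewrite !prj_tgt -cJ.2.
rewrite -(eqP (sf y)) -(eqP (sf y')) ee (inj_eq perm_inj) //.
Qed.

(** For fixed [f], the permutation of a colour is prescribed on as many points as there are edge
    classes of this colour, and foldedness makes the prescription injective. *)
Lemma card_compat f : ccl c tau (rset (fker f)) ->
  #|[set s | compat s f]| = \prod_a (N.+1 - edge_count (fker f) a)`!.
Proof.
move=> cM; pose D a : {set 'I_N.+1} := [set f (corg c tau y) | y : Y & e y.2 == a].
pose g a u := if [pick y : Y | (e y.2 == a) && (f (corg c tau y) == u)] is Some y
  then f (ctgt c tau y) else u.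
have ends y y' : e y.2 = e y'.2 ->
    (f (corg c tau y) == f (corg c tau y')) = (f (ctgt c tau y) == f (ctgt c tau y')).
  move=> ee; have [gg Jo Jt] := colour_edge ee.
  by have := cM.2 y y' gg; rewrite /rset !inE /= Jo Jt.
have gE y : g (e y.2) (f (corg c tau y)) = f (ctgt c tau y).
  rewrite /g; case: pickP => [y' /andP[/eqP ee fo]|/(_ y)]; last by rewrite !eqxx.
  by apply/eqP; rewrite -ends.
have gi a : {in D a &, injective (g a)}.
  move=> _ _ /imsetP[y yE ->] /imsetP[y' yE' ->]; rewrite !inE in yE yE'.
  rewrite -{1}(eqP yE) -(eqP yE') !gE => h; apply/eqP; rewrite ends ?h //.
  by rewrite (eqP yE) (eqP yE').
have cD a : #|D a| = edge_count (fker f) a.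
  have -> : D a = [set f (corg c tau (qrep q)) | q in
      [set q : quo (cedge c tau (rset (fker f))) | e (qrep q).2 == a]].
    apply/setP => u; apply/imsetP/imsetP => [[y ya ->]|[q qa ->]]; last first.
      by exists (qrep q) => //; move: qa; rewrite !inE.
    rewrite inE in ya; have r := qrepP (cedge_equiv c tau (fker_equiv f)) y.
    have /andP[/eqP g1] := r; rewrite /rset inE /= => /andP[J1 /eqP f1].
    exists (pi _ y) => //; rewrite inE -(eqP ya) eq_sym eP.
    by rewrite /cedge; move: g1 J1; rewrite !prj_org /cgen /= => -> ->; rewrite eqxx.
  apply: card_in_imset => q q'; rewrite !inE => qa qa' ff.
  have ee : e (qrep q).2 = e (qrep q').2 by rewrite (eqP qa) (eqP qa').
  have [gg Jo _] := colour_edge ee.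
  rewrite -(qrepK q) -(qrepK q'); apply/eqP; rewrite piE; last exact: (cedge_equiv c tau (fker_equiv f)).
  by rewrite /cedge gg eqxx /rset inE /= Jo ff eqxx.
transitivity (\prod_a #|[set p : 'S_N.+1 | [forall u in D a, p u == g a u]]|); last first.
  by apply: eq_bigr => a _; rewrite card_extend_perm ?cD ?card_ord.
pose Q a := mem [set p : 'S_N.+1 | [forall u in D a, p u == g a u]].
transitivity #|family Q|; last by rewrite card_family foldrE big_map big_enum.
apply: eq_card => s; rewrite inE compat_edges; apply/forallP/familyP => [h a|h y].
  rewrite inE; apply/forall_inP => _ /imsetP[y ya ->]; rewrite inE in ya.
  by rewrite -(eqP ya) gE.
have := h (e y.2); rewrite inE => /forall_inP/(_ (f (corg c tau y))).
by rewrite gE; apply; apply/imsetP; exists y; rewrite ?inE.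
Qed.

Definition lift_ok (M : {set Y * Y}) :=
  `[< ccl c tau (rset M) >] && [forall p in M, J (prj p.1) (prj p.2)].
Definition kV (M : {set Y * Y}) (q : quo (rset M)) :=
  #|[set q' : quo (rset M) | (enum_rank q' < enum_rank q) && J (prj (qrep q')) (prj (qrep q))]|.
Definition kE (M : {set Y * Y}) (q : quo (cedge c tau (rset M))) :=
  #|[set q' : quo (cedge c tau (rset M)) |
     (enum_rank q' < enum_rank q) && cedge c id J (prj (qrep q')) (prj (qrep q))]|.

Lemma lift_okP M : reflect (ccl c tau (rset M) /\ forall a b, rset M a b -> J (prj a) (prj b)) (lift_ok M).
Proof.
apply: (iffP andP) => [[/asboolP h1 /forall_inP h2]|[h1 h2]]; split.
- by [].
- by move=> a b /h2.
- exact/asboolP.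
by apply/forall_inP => -[a b]; apply: h2.
Qed.

Lemma card_fker M : lift_ok M -> #|[set f | fker f == M]| = \prod_q (N.+1 - @kV M q).
Proof.
move=> /lift_okP[[eM cM] MJ].
have eR : equivalence_rel (fun q q' : quo (rset M) => J (prj (qrep q)) (prj (qrep q'))).
  apply: equivalence_relT => [y|y y'|y y' y''].
  - exact: (eqr_refl cJ.1).
  - exact: (eqr_sym cJ.1).
  - exact: (eqr_trans cJ.1).
rewrite /kV -(card_colinj N eR).
pose G (h : {ffun quo (rset M) -> 'I_N.+1}) : {ffun Y -> 'I_N.+1} := [ffun y => h (pi (rset M) y)].
have Gi : injective G.
  move=> h h' /ffunP E; apply/ffunP => q; have [y /eqP->] := pi_surj q.
  by have := E y; rewrite !ffunE.
have Jr a : J (prj (qrep (pi (rset M) a))) (prj a).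
  by rewrite (eqr_sym cJ.1); apply: MJ; apply: qrepP.
rewrite -(card_imset _ Gi); apply: eq_card => f; rewrite inE.
apply/eqP/imsetP => [fM|[h]].
  have fpi a b : rset M a b -> f a = f b.
    by rewrite -fM /rset inE => /andP[_ /eqP].
  have fh : f = G [ffun q => f (qrep q)].
    by apply/ffunP => y; rewrite !ffunE; apply: fpi; apply: qrepP.
  exists [ffun q => f (qrep q)] => //; rewrite inE.
  apply/forallP => q; apply/forallP => q'; apply/implyP => Jq; apply/implyP.
  have MM a b : rset M a b = J (prj a) (prj b) && (f a == f b) by rewrite /rset -{1}fM inE.
  by rewrite !ffunE => ff; rewrite -(qrepK q) -(qrepK q') piE // MM Jq ff.
rewrite inE => /forallP hc ->; apply/setP => -[a b]; rewrite inE /= !ffunE.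
apply/andP/idP => [[Jab /eqP hab]|Mab].
  have /forallP/(_ (pi (rset M) b)) := hc (pi (rset M) a); rewrite hab eqxx /=.
  rewrite piE // => /implyP; apply.
  apply: (eqr_trans cJ.1 (Jr a)); apply: (eqr_trans cJ.1 Jab).
  by rewrite (eqr_sym cJ.1).
split; first exact: MJ.
by have /eqP-> : pi (rset M) a == pi (rset M) b by rewrite piE.
Qed.

Lemma sum_lifts : \sum_(s : {ffun C -> 'S_N.+1})
  #|[set h : {ffun X -> 'I_N.+1} | [forall x, h (tau x) == pact s L.+1 (h x)]]| =
  \sum_(M | lift_ok M) (\prod_q (N.+1 - @kV M q)) * \prod_a (N.+1 - edge_count M a)`!.
Proof.
transitivity (\sum_f #|[set s | compat s f]|).
  transitivity (\sum_s \sum_f (compat s f : nat)).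
    apply: eq_bigr => s _; rewrite card_marks -sum1_card big_mkcond.
    by apply: eq_bigr => f _; rewrite inE; case: compat.
  rewrite exchange_big; apply: eq_bigr => f _; rewrite -sum1_card [RHS]big_mkcond.
  by apply: eq_bigr => s _; rewrite inE; case: compat.
rewrite (bigID (fun f => lift_ok (fker f))) /= [X in _ + X]big1 ?addn0; last first.
  move=> f nok; apply/eqP; rewrite cards_eq0; apply/eqP/setP => s; rewrite !inE.
  apply: contraNF nok => sf; apply/lift_okP; split; first exact: fker_ccl sf.
  by move=> a b; rewrite /rset inE => /andP[].
rewrite (partition_big fker lift_ok) //=; apply: eq_bigr => M okM.
rewrite -card_fker // -sum1_card big_distrl /=.
apply: eq_big => [f|f /andP[_ /eqP fM]].
  by rewrite inE; apply: andb_idl => /eqP->.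
by rewrite mul1n card_compat ?fM //; case/lift_okP: okM.
Qed.

(** For each colour, the factorial is completed to [(N.+1)!] by a falling factorial, whose factors
    are attached to the edge classes in their order of enumeration, in the same form as the vertex
    factors. *)
Lemma prod_edge_count M : #|{: Y}| <= N.+1 ->
  (\prod_a (N.+1 - edge_count M a)`!) * (\prod_q (N.+1 - @kE M q)) = (N.+1)`! ^ #|C|.
Proof.
move=> YN; pose col (q : quo (cedge c tau (rset M))) := e (qrep q).2.
rewrite (partition_big col predT) //= -big_split /= -prod_nat_const.
apply: eq_bigr => a _.
have aN : edge_count M a <= N.+1.
  apply: leq_trans (max_card _) (leq_trans _ YN).
  by rewrite -(card_codom (can_inj (@qrepK _ _))) max_card.
rewrite mulnC -(ffact_fact aN); congr (_ * _).
pose S := [set q : quo (cedge c tau (rset M)) | e (qrep q).2 == a].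
have ri : injective (fun q : quo (cedge c tau (rset M)) => nat_of_ord (enum_rank q)).
  by move=> q q' /ord_inj/enum_rank_inj.
rewrite ffact_prod -(prod_rank S (fun j => N.+1 - j) ri).
apply: eq_big => [q|q /eqP qa]; first by rewrite inE.
congr (_ - _); apply: eq_card => q'; rewrite !inE andbC; congr (_ && _).
by rewrite -qa eP.
Qed.

End Lifts.
From mathcomp Require Import ring lra.

(** * Expansions in $1/(N+1)$ indexed by sets of pairs *)

Section Expansion.
Local Open Scope ring_scope.
Variable R : realFieldType.
Implicit Types (f g : nat -> R).

Definition nu (N : nat) : R := (N.+1%:R)^-1.

Definition nuO f p := exists K N0, forall N : nat, (N0 <= N)%N -> `|f N| <= K * nu N ^+ p.

Lemma nu_gt0 N : 0 < nu N. Proof. by rewrite invr_gt0 ltr0n. Qed.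

Lemma nu_ge0 N : 0 <= nu N. Proof. exact/ltW/nu_gt0. Qed.

Lemma nu_le1 N : nu N <= 1. Proof. by rewrite invf_le1 ?ltr0n // ler1n. Qed.

Lemma nuO_eq f g p N0 : (forall N, (N0 <= N)%N -> f N = g N) -> nuO f p -> nuO g p.
Proof.
move=> fg [K [N1 h]]; exists K, (maxn N0 N1) => N; rewrite geq_max => /andP[n0 n1].
by rewrite -fg // h.
Qed.

Lemma nuO0 p : nuO (fun=> 0) p.
Proof. by exists 0, 0%N => N _; rewrite normr0 mul0r. Qed.

Lemma nuO_add f g p : nuO f p -> nuO g p -> nuO (fun N => f N + g N) p.
Proof.
move=> [K [N0 h]] [K' [N1 h']]; exists (K + K'), (maxn N0 N1) => N; rewrite geq_max => /andP[n0 n1].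
by rewrite mulrDl; apply: le_trans (ler_normD _ _) _; apply: lerD; [apply: h | apply: h'].
Qed.

Lemma nuO_sum (T : Type) (s : seq T) (P : pred T) (F : T -> nat -> R) p :
  (forall t, P t -> nuO (F t) p) -> nuO (fun N => \sum_(t <- s | P t) F t N) p.
Proof.
move=> FO; elim: s => [|t s IHs].
  by apply: (nuO_eq (N0 := 0%N) _ (nuO0 p)) => N _; rewrite big_nil.
have [Pt|nPt] := boolP (P t); last first.
  by apply: (nuO_eq (N0 := 0%N) _ IHs) => N _; rewrite big_cons (negPf nPt).
apply: (nuO_eq (N0 := 0%N) _ (nuO_add (FO t Pt) IHs)) => N _.
by rewrite big_cons Pt.
Qed.

Lemma nuO_mul f g p q : nuO f p -> nuO g q -> nuO (fun N => f N * g N) (p + q)%N.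
Proof.
move=> [K [N0 h]] [K' [N1 h']]; exists (K * K'), (maxn N0 N1) => N; rewrite geq_max => /andP[n0 n1].
by rewrite normrM exprD mulrACA ler_pM // ?h // ?h'.
Qed.

Lemma nuO_nu p : nuO (fun N => nu N ^+ p) p.
Proof. by exists 1, 0%N => N _; rewrite mul1r ger0_norm // exprn_ge0 ?nu_ge0. Qed.

Lemma nuO_cst a : nuO (fun=> a) 0.
Proof. by exists `|a|, 0%N => N _; rewrite expr0 mulr1. Qed.

Lemma nuO_mono f p q : (p <= q)%N -> nuO f q -> nuO f p.
Proof.
move=> pq [K [N0 h]]; exists `|K|, N0 => N n0; apply: le_trans (h N n0) _.
apply: (le_trans (y := `|K| * nu N ^+ q)).
  by apply: ler_wpM2r; [apply/exprn_ge0/nu_ge0 | apply: ler_norm].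
rewrite ler_wpM2l // -(subnK pq) exprD ler_piMl ?exprn_ge0 ?nu_ge0 //.
by rewrite exprn_ile1 ?nu_ge0 ?nu_le1.
Qed.

Variable P : finType.
Implicit Types (G : {set P} -> nat -> R) (D J : {set P}).

Definition adm (a : R) G := exists (h : {set P} -> nat -> R) N0, [/\
  forall J N, (N0 <= N)%N -> G J N = \sum_(D : {set P} | D \subset J) h D N,
  forall D, nuO (h D) #|D| & nuO (fun N => h set0 N - a) 1].

Lemma adm_eq a G G' N0 : (forall J N, (N0 <= N)%N -> G J N = G' J N) -> adm a G -> adm a G'.
Proof.
move=> e [h [N1 [hG hO h0]]]; exists h, (maxn N0 N1); split=> // J N.
by rewrite geq_max => /andP[n0 n1]; rewrite -e // hG.
Qed.

Lemma adm_cst a : adm a (fun _ _ => a).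
Proof.
exists (fun D _ => if D == set0 then a else 0), 0%N; split=> [J N _|D|].
- by rewrite (bigD1 set0) ?sub0set //= eqxx big1 ?addr0 // => D /andP[_ /negPf->].
- by case: eqP => [->|_]; [rewrite cards0; apply: nuO_cst | apply: nuO0].
- by apply: (nuO_eq (N0 := 0%N) _ (nuO0 1)) => N _; rewrite eqxx subrr.
Qed.

Lemma adm_pair p : adm 0 (fun J N => (p \in J)%:R * nu N).
Proof.
exists (fun D N => if D == [set p] then nu N else 0), 0%N; split=> [J N _|D|].
- rewrite -big_mkcondr /=; have [pJ|pJ] := boolP (p \in J).
    rewrite (eq_bigl (pred1 [set p])) ?big_pred1_eq ?mul1r // => D /=.
    by apply: andb_idl => /eqP->; rewrite sub1set.
  rewrite mul0r big_pred0 // => D; apply/negP => /andP[+ /eqP e].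
  by rewrite e sub1set (negPf pJ).
- case: eqP => [->|_]; last exact: nuO0.
  by rewrite cards1; apply: (nuO_nu 1).
- apply: (nuO_eq (N0 := 0%N) _ (nuO0 1)) => N _; case: eqP => [e|_]; last by rewrite subrr.
  by have := set11 p; rewrite -e inE.
Qed.

Lemma adm_add a b G G' : adm a G -> adm b G' -> adm (a + b) (fun J N => G J N + G' J N).
Proof.
move=> [h [N1 [hG hO h0]]] [h' [N1' [hG' hO' h0']]].
exists (fun D N => h D N + h' D N), (maxn N1 N1'); split=> [J N|D|].
- by rewrite geq_max => /andP[n0 n1]; rewrite hG // hG' // big_split.
- exact: nuO_add.
by apply: (nuO_eq (N0 := 0%N) _ (nuO_add h0 h0')) => N _; rewrite opprD addrACA.
Qed.

Lemma adm_mul a b G G' : adm a G -> adm b G' -> adm (a * b) (fun J N => G J N * G' J N).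
Proof.
move=> [h [N1 [hG hO h0]]] [h' [N1' [hG' hO' h0']]].
exists (fun D N => \sum_(p : {set P} * {set P} | p.1 :|: p.2 == D) h p.1 N * h' p.2 N), (maxn N1 N1').
split=> [J N|D|].
- rewrite geq_max => /andP[n0 n1]; rewrite hG // hG' // big_distrlr /= pair_big /=.
  rewrite [RHS](exchange_big_dep predT) //= [LHS]big_mkcond; apply: eq_bigr => -[D D'] _ /=.
  rewrite -subUset; case: ifP => DJ; last first.
    by rewrite big_pred0 // => E; apply/negP => /andP[+ /eqP e]; rewrite -e DJ.
  rewrite (eq_bigl (pred1 (D :|: D'))) ?big_pred1_eq // => E /=.
  by rewrite eq_sym; apply: andb_idl => /eqP->.
- apply: nuO_sum => -[D1 D2] /= /eqP <-; apply: nuO_mono (nuO_mul (hO D1) (hO' D2)).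
  exact: leq_card_setU.
apply: (nuO_eq (f := fun N => (h set0 N - a) * h' set0 N + a * (h' set0 N - b)) (N0 := 0%N)).
  move=> N _; rewrite (eq_bigl (pred1 (set0, set0))) => [|[D D']] /=.
    by rewrite big_pred1_eq /=; ring.
  by rewrite setU_eq0 xpair_eqE.
apply: nuO_add.
  by have := nuO_mul h0 (hO' set0); rewrite cards0 addn0.
exact: (nuO_mul (nuO_cst a) h0').
Qed.

(** Moebius inversion, by induction on the cardinal, gives coefficients of order [m], which is at
    least the size of any subset of [P]. *)
Lemma adm_small G m : (#|P| <= m)%N -> (0 < m)%N ->
  (forall J, nuO (G J) m) -> adm 0 G.
Proof.
move=> Pm m0 GO.
suff [h [hG hO]] : exists h : {set P} -> nat -> R,
    (forall J, (#|J| < #|P|.+1)%N -> forall N, G J N = \sum_(D : {set P} | D \subset J) h D N) /\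
    forall D, nuO (h D) m.
  exists h, 0%N; split=> [J N _|D|]; first by apply: hG; rewrite ltnS max_card.
    by apply: nuO_mono (hO D); apply: leq_trans (max_card _) Pm.
  by apply: (nuO_eq (N0 := 0%N) _ (nuO_mono m0 (hO set0))) => N _; rewrite subr0.
elim: #|P|.+1 => [|k [h [hG hO]]].
  by exists (fun _ _ => 0); split=> // D; apply: nuO0.
exists (fun (D : {set P}) N => if (#|D| == k) then G D N - \sum_(E : {set P} | E \proper D) h E N else h D N).
split=> [J Jk N|D]; last first.
  case: eqP => // _; apply: nuO_add; first exact: GO.
  apply: (nuO_eq (f := fun N => -1 * \sum_(E : {set P} | E \proper D) h E N) (N0 := 0%N)).
    by move=> M _; rewrite mulN1r.
  by apply: (nuO_mul (nuO_cst (-1)) (q := m)); apply: nuO_sum.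
have lt D : D \proper J -> (#|D| < k)%N.
  by move=> /proper_card DJ; apply: leq_trans DJ _; rewrite -ltnS.
rewrite (bigD1 J) //= [X in _ = _ + X](eq_big (fun D : {set P} => D \proper J) (fun D => h D N));
  [|by move=> D; rewrite properEneq andbC
   |by move=> D; rewrite andbC -properEneq => DJ; rewrite ltn_eqF // lt].
case: eqP => [_|/eqP Jk']; first by rewrite subrK.
rewrite hG; last by rewrite ltn_neqAle Jk' -ltnS.
rewrite (bigD1 J) //=; congr (_ + _); apply: eq_bigl => D.
by rewrite properEneq andbC.
Qed.

(** The geometric series is truncated at an order exceeding the cardinal of [P]; the remainder is
    then admissible by its size alone. *)
Lemma adm_inv G (k : {set P} -> nat) : adm 0 G ->
  (forall J N, G J N = (k J)%:R * nu N) -> adm 1 (fun J N => (1 - G J N)^-1).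
Proof.
move=> aG Gk; pose m := #|P|.+1; pose K := (\max_(J : {set P}) k J)%N.
have kK J : (k J <= K)%N by apply: leq_bigmax.
pose S j := fun J N => \sum_(i < j) G J N ^+ i.
have aS j : adm 1 (S j.+1).
  elim: j => [|j IHj].
    by apply: (adm_eq (N0 := 0%N) _ (adm_cst 1)) => J N _; rewrite /S big_ord1 expr0.
  rewrite -[1]addr0 -(mul0r 1).
  apply: (adm_eq (N0 := 0%N) _ (adm_add (adm_cst 1) (adm_mul aG IHj))) => J N _.
  rewrite /S [RHS]big_ord_recl expr0 mulr_sumr; congr (_ + _).
  by apply: eq_bigr => i _; rewrite -exprS.
have lt1 J N : (K.*2 <= N)%N -> G J N <= 2^-1.
  move=> KN; rewrite Gk ler_pdivrMr ?ltr0n // mulrC ler_pdivlMr ?ltr0n //.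
  rewrite -natrM ler_nat muln2; apply: leq_trans (leq_trans KN (leqnSn N)).
  by rewrite leq_double.
have Gpos J N : 0 <= G J N by rewrite Gk mulr_ge0 ?ler0n ?nu_ge0.
have pos J N : (K.*2 <= N)%N -> 2^-1 <= 1 - G J N.
  by move=> KN; have := lt1 J N KN; lra.
have aR : adm 0 (fun J N => G J N ^+ m * (1 - G J N)^-1).
  apply: (@adm_small _ m); rewrite /m // => J.
  exists (K%:R ^+ m * 2), K.*2 => N KN.
  have h2 := pos J N KN; have h0 : 0 < 1 - G J N by apply: lt_le_trans h2; rewrite invr_gt0.
  rewrite ger0_norm; last by rewrite mulr_ge0 ?exprn_ge0 // invr_ge0 ltW.
  rewrite mulrAC ler_pM ?exprn_ge0 // ?invr_ge0 ?(ltW h0) //.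
    rewrite -exprMn lerXn2r ?nnegrE //; first by rewrite mulr_ge0 ?ler0n ?nu_ge0.
    by rewrite Gk ler_wpM2r ?nu_ge0 // ler_nat.
  by rewrite -[2]invrK lef_pV2 ?posrE // invr_gt0.
rewrite -[X in adm X _](addr0 1); apply: (adm_eq (N0 := K.*2) _ (adm_add (aS #|P|) aR)) => J N KN.
have h0 : 1 - G J N != 0.
  by rewrite gt_eqF //; apply: lt_le_trans (pos J N KN); rewrite invr_gt0.
apply: (mulIf h0); rewrite mulVf // mulrDl mulfVK //.
have -> : G J N ^+ m = (G J N - 1) * S m J N + 1 by rewrite -subrX1 subrK.
by rewrite -/m; ring.
Qed.

End Expansion.

Section AdmProducts.
Local Open Scope ring_scope.
Variables (R : realFieldType) (P : finType).

Lemma adm_prod (T : Type) (s : seq T) (G : T -> {set P} -> nat -> R) :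
  (forall t, adm 1 (G t)) -> adm 1 (fun J N => \prod_(t <- s) G t J N).
Proof.
move=> aG; elim: s => [|t s IHs].
  by apply: (adm_eq (N0 := 0%N) _ (adm_cst P 1)) => J N _; rewrite big_nil.
rewrite -[X in adm X _](mulr1 1).
by apply: (adm_eq (N0 := 0%N) _ (adm_mul (aG t) IHs)) => J N _; rewrite big_cons.
Qed.

Lemma adm_card (T : finType) (Q : pred T) (f : T -> P) :
  adm 0 (fun (J : {set P}) N => #|[set t | Q t && (f t \in J)]|%:R * nu R N).
Proof.
have aS (s : seq T) : adm 0 (fun (J : {set P}) N => \sum_(t <- s) (Q t && (f t \in J))%:R * nu R N).
  elim: s => [|t s IHs].
    by apply: (adm_eq (N0 := 0%N) _ (adm_cst P 0)) => J N _; rewrite big_nil.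
  have [Qt|Qt] := boolP (Q t); last first.
    apply: (adm_eq (N0 := 0%N) _ IHs) => J N _.
    by rewrite big_cons (negPf Qt) mul0r add0r.
  rewrite -[X in adm X _](addr0 0).
  apply: (adm_eq (N0 := 0%N) _ (adm_add (adm_pair R (f t)) IHs)) => J N _.
  by rewrite big_cons Qt.
apply: (adm_eq (N0 := 0%N) _ (aS (index_enum T))) => J N _.
rewrite -mulr_suml -natr_sum; congr (_%:R * _).
by rewrite -sum1_card [RHS]big_mkcond; apply: eq_bigr => t _; rewrite inE; case: andb.
Qed.

Lemma adm_subr (G : {set P} -> nat -> R) : adm 0 G -> adm 1 (fun J N => 1 - G J N).
Proof.
move=> aG; have := adm_add (adm_cst P 1) (adm_mul (adm_cst P (-1)) aG).
by rewrite mulr0 addr0; apply: (adm_eq (N0 := 0%N)) => J N _; rewrite mulN1r.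
Qed.

End AdmProducts.

(** * Regrouping the lifts by quotients of the single cycle *)

Section MainExpansion.
Local Open Scope ring_scope.
Variables (I : choiceType) (L : nat) (c : 'I_L.+1 -> I * bool) (cw : cyc_reduced c).
Variables (R : realFieldType) (X : finType) (tau : X -> X).
Local Notation Y := (X * 'I_L.+1)%type.
Local Notation Y1 := (unit * 'I_L.+1)%type.
Implicit Types (M : {set Y * Y}) (Q J D : {set Y1 * Y1}).

Definition Phi (C : finType) (e : 'I_L.+1 -> C) N : R :=
  (\sum_(s : {ffun C -> 'S_N.+1})
    #|[set h : {ffun X -> 'I_N.+1} | [forall x, h (tau x) == pact c e s L.+1 (h x)]]|)%:R /
  ((N.+1)`! ^ #|C|)%:R.

Definition lV M : nat := #|{: quo (rset M)}|.
Definition lE M : nat := #|{: quo (cedge c tau (rset M))}|.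
Definition ldef M : nat := (lE M - lV M)%N.

(** The falling factorials of vertices over those of edges, with the powers of $N+1$ removed. [J]
    enters only through the membership of pairs of points, as [adm] requires; for edges these are
    the pairs of origins. *)
Definition lterm M J N : R :=
  (\prod_(q : quo (rset M)) (1 - #|[set q' : quo (rset M) | (enum_rank q' < enum_rank q)%N &&
     ((prj (qrep q'), prj (qrep q)) \in J)]|%:R * nu R N)) *
  (\prod_(q : quo (cedge c tau (rset M)))
     (1 - #|[set q' : quo (cedge c tau (rset M)) | ((enum_rank q' < enum_rank q)%N &&
        (cgen c (qrep q') == cgen c (qrep q))) &&
     ((corg c id (prj (qrep q')), corg c id (prj (qrep q))) \in J)]|%:R * nu R N)^-1).

Hypothesis W1 : cycword c != 1%g.

Lemma lterm_adm M : adm 1 (lterm M).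
Proof.
rewrite -[X in adm X _](mulr1 1); apply: adm_mul; apply: adm_prod => q.
  by apply: adm_subr; apply: adm_card.
by apply: adm_inv => //; apply: adm_card.
Qed.

Lemma prod_fallingE (T : finType) (k : T -> nat) N : (forall t, (k t <= N)%N) ->
  (\prod_t (N.+1 - k t)%N)%:R = (nu R N)^-1 ^+ #|T| * \prod_t (1 - (k t)%:R * nu R N) :> R.
Proof.
move=> kN; rewrite natr_prod -prodr_const -big_split /=; apply: eq_bigr => t _.
rewrite natrB ?(leq_trans (kN t)) // /nu invrK mulrBr mulr1 mulrCA mulfV ?mulr1 //.
by rewrite pnatr_eq0.
Qed.

Lemma card_quo_le (T : finType) (r : rel T) : (#|{: quo r}| <= #|T|)%N.
Proof. by rewrite -(card_codom (can_inj (@qrepK T r))) max_card. Qed.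

Lemma PhiE (C : finType) (e : 'I_L.+1 -> C) J N : ccl c id (rset J) ->
  (forall i j, (e i == e j) = cedge c id (rset J) (tt, i) (tt, j)) ->
  (#|{: Y}| <= N)%N ->
  Phi e N = \sum_(M | lift_ok c tau (rset J) M) nu R N ^+ ldef M * lterm M J N.
Proof.
move=> cJ eP YN.
rewrite /Phi (sum_lifts tau cJ eP) natr_sum mulr_suml; apply: eq_bigr => M okM.
have /lift_okP[[eM cM] MJ] := okM.
have kVN q : (@kV L X (rset J) M q <= N)%N.
  by apply: leq_trans (max_card _) (leq_trans (card_quo_le _) YN).
have kEN q : (@kE I L c X tau (rset J) M q <= N)%N.
  by apply: leq_trans (max_card _) (leq_trans (card_quo_le _) YN).
have n0 : (nu R N)^-1 != 0 by rewrite invr_eq0 gt_eqF // nu_gt0.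
have pE : (\prod_(q : quo (cedge c tau (rset M))) (N.+1 - @kE I L c X tau (rset J) M q)%N)%:R != 0 :> R.
  rewrite pnatr_eq0 -lt0n prodn_gt0 // => q; by rewrite subn_gt0 ltnS.
have pF : (\prod_a ((N.+1 - edge_count c tau e M a)`!)%N)%:R != 0 :> R.
  by rewrite pnatr_eq0 -lt0n prodn_gt0 // => a; rewrite fact_gt0.
rewrite -(prod_edge_count tau eP M (leqW YN)) natrM natrM invfM [X in X * _]mulrC mulrACA mulfV // mul1r.
rewrite !prod_fallingE // invfM mulrACA; congr (_ * _).
  have VE : (lV M <= lE M)%N by apply: (card_V_E cw (conj eM cM) W1).
  rewrite -[X in X / _]/((nu R N)^-1 ^+ lV M) -[X in _ / X]/((nu R N)^-1 ^+ lE M).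
  have -> : lE M = (ldef M + lV M)%N by rewrite subnK.
  by rewrite exprD invfM mulrCA mulfV ?expf_neq0 // mulr1 -exprVn invrK.
rewrite /lterm; congr (_ * _); rewrite -prodfV; apply: eq_bigr => q _.
congr ((1 - _%:R * _)^-1); apply: eq_card => q'; rewrite !inE andbA //.
Qed.

Definition lexp M : {set Y1 * Y1} -> nat -> R := sval (cid (lterm_adm M)).

Lemma lexpP M : exists N0, [/\
  forall J N, (N0 <= N)%N -> lterm M J N = \sum_(D : {set Y1 * Y1} | D \subset J) lexp M D N,
  forall D, nuO (lexp M D) #|D| & nuO (fun N => lexp M set0 N - 1) 1].
Proof. exact: svalP (cid (lterm_adm M)). Qed.

Definition gclos M D : {set Y1 * Y1} := [set p | cclos c id (fun a b =>
  (exists x y, [/\ rset M x y, a = prj x & b = prj y]) \/ (a, b) \in D) p.1 p.2].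

Definition clo Q := `[< ccl c id (rset Q) >].

Lemma rset_gclos M D : rset (gclos M D) = cclos c id (fun a b =>
  (exists x y, [/\ rset M x y, a = prj x & b = prj y]) \/ (a, b) \in D).
Proof. by apply: funext => a; apply: funext => b; rewrite /rset inE. Qed.

Lemma gclos_clo M D : clo (gclos M D).
Proof. by apply/asboolP; rewrite rset_gclos; apply: cclosP. Qed.

Lemma gclos_sub M D J : clo J -> (gclos M D \subset J) =
  [forall p in M, rset J (prj p.1) (prj p.2)] && (D \subset J).
Proof.
move=> /asboolP cJ; apply/subsetP/andP => [h|[/forall_inP hM /subsetP hD] [a b]].
  split; first apply/forall_inP => -[x y] Mxy.
    by apply: h; rewrite inE; apply: cclos_in; left; exists x, y.
  apply/subsetP => -[a b] Dab; apply: h; rewrite inE.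
  by apply: cclos_in; right.
rewrite inE /= => h; apply: (cclos_min cJ _ h) => {h} {}a {}b [[x [y [Mxy -> ->]]]|Dab].
  exact: (hM (x, y)).
exact: hD.
Qed.

(** A term [(M, D)] occurs over [J] exactly when [gclos M D] is contained in [J]. Collecting the
    terms by this closure gives contributions independent of [J], so that averages over different
    [J] can be compared. *)
Definition RQ Q N : R := \sum_(p : {set Y * Y} * {set Y1 * Y1} |
  `[< ccl c tau (rset p.1) >] && (gclos p.1 p.2 == Q)) nu R N ^+ ldef p.1 * lexp p.1 p.2 N.

Lemma Phi_sum : exists N1, forall N, (N1 <= N)%N -> forall (C : finType) (e : 'I_L.+1 -> C) J,
  clo J -> (forall i j, (e i == e j) = cedge c id (rset J) (tt, i) (tt, j)) ->
  Phi e N = \sum_(Q | clo Q && (Q \subset J)) RQ Q N.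
Proof.
have [N0 N0P] := choice lexpP.
exists (maxn #|{: Y}| (\max_M N0 M)) => N; rewrite geq_max => /andP[YN mN] C e J cJ eP.
have lE' M : lterm M J N = \sum_(D : {set Y1 * Y1} | D \subset J) lexp M D N.
  have [h _ _] := N0P M; apply: h; apply: leq_trans mN; exact: leq_bigmax.
rewrite (PhiE (asboolW cJ) eP YN) (eq_bigr (fun M => \sum_(D : {set Y1 * Y1} | D \subset J)
  nu R N ^+ ldef M * lexp M D N)); last by move=> M _; rewrite lE' mulr_sumr.
rewrite pair_big /= /RQ (exchange_big_dep predT) //=.
rewrite [RHS](bigID (fun p : {set Y * Y} * {set Y1 * Y1} =>
  `[< ccl c tau (rset p.1) >] && (gclos p.1 p.2 \subset J))) /= [X in _ + X]big1 ?addr0; last first.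
  move=> p np; rewrite big_pred0 // => Q; apply/negP => /andP[/andP[_ QJ] /andP[cp /eqP gQ]].
  by move: np; rewrite cp gQ QJ.
apply: eq_big => [p|p]; first by rewrite gclos_sub // andbA.
rewrite -andbA => /and3P[cp pM pD].
rewrite (eq_bigl (pred1 (gclos p.1 p.2))) ?big_pred1_eq // => Q /=.
rewrite cp eq_sym; apply: andb_idl => /eqP->.
by rewrite gclos_clo gclos_sub // pD andbT.
Qed.

Definition colour Q (i : 'I_L.+1) : quo (cedge c id (rset Q)) := pi _ (tt, i).

Lemma colourP Q i j : clo Q -> (colour Q i == colour Q j) = cedge c id (rset Q) (tt, i) (tt, j).
Proof. by move=> /asboolP cQ; rewrite piE //; apply: cedge_equiv cQ.1. Qed.

Definition rkq Q := ((#|{: quo (cedge c id (rset Q))}|).+1 - #|{: quo (rset Q)}|)%N.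
Definition Prim Q := wgen_le (prg c (rset Q)) (cycword c) (rkq Q).

Lemma unit_merged Q : clo Q -> forall u, rset Q (u, ord0) (tt, ord0).
Proof. by move=> /asboolP cQ []; apply: (eqr_refl cQ.1). Qed.

Lemma rkqE Q : clo Q -> (rkq Q + #|{: quo (rset Q)}|)%N = (#|{: quo (cedge c id (rset Q))}|).+1.
Proof.
move=> hQ; have cQ := asboolW hQ; have [y [sy _]] := walk_gens (merged_conn cQ (unit_merged hQ)).
by rewrite /rkq subnK //; move: sy; rewrite cardsT => <-; apply: leq_addl.
Qed.

Lemma prg_grank Q : clo Q -> grank (prg c (rset Q)) (rkq Q).
Proof.
move=> hQ; have cQ := asboolW hQ.
apply: (grank_eq (fun g => iff_sym (prg_walk cQ g (unit_merged hQ)))).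
apply: folded_grank; [exact: qfold_org|exact: qfold_tgt| |exact: rkqE].
exact: merged_conn (unit_merged hQ).
Qed.

Lemma Prim_sub Q J : clo Q -> clo J -> Q \subset J -> Prim J -> Prim Q.
Proof.
move=> hQ hJ QJ PJ; apply: (wgen_sub (prg_grank hJ) PJ _ _ (prg_grank hQ)); last exact: prg_W.
apply: prg_min; [exact: prg_subgrp|exact: prg_W|move=> a b Qab; apply: prg_in].
exact: (subsetP QJ).
Qed.

Definition disc : {set Y1 * Y1} := [set p | p.1 == p.2].

Lemma rset_disc : rset disc = (fun a b => a == b).
Proof. by apply: funext => a; apply: funext => b; rewrite /rset inE. Qed.

Lemma disc_clo : clo disc.
Proof. by apply/asboolP; rewrite rset_disc; apply: ccl_eq. Qed.

Lemma disc_Prim : Prim disc.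
Proof.
rewrite /Prim /rkq rset_disc (card_quo_eq (cedge_eq cw)) card_quo_eq // subSnn.
exists [::]; split=> // g; split; last first.
  by apply: gen_min; [exact: prg_subgrp | move=> h; rewrite inE => /eqP->; exact: prg_W].
apply: prg_min; [exact: gen_subgrp | by apply: gen_in; rewrite inE |].
by move=> a b /eqP->; rewrite mulgV; apply: gen1.
Qed.

Definition Unif N : R := (\sum_(s : 'S_N.+1)
   #|[set h : {ffun X -> 'I_N.+1} | [forall x, h (tau x) == s (h x)]]|)%:R / (N.+1)`!%:R.

Lemma hol_pact Q (hQ : clo Q) N (a : {ffun quo (cedge c id (rset Q)) -> 'S_N.+1}) t :
  hol (qfold_org (asboolW hQ)) (qfold_tgt (asboolW hQ)) (pi _ (tt, ord0)) a (pre c t) =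
  pact c (colour Q) a t.
Proof.
have cQ := asboolW hQ; elim: t => [|t IHt]; first by rewrite /= hol1.
have w := @qwalk_pre _ _ c _ id (rset Q) cQ setT tt t (fun _ _ => in_setT _).
pose i : 'I_L.+1 := iter t (@ordS _) ord0.
have yi : iter t (cnext id) (tt, ord0) = (tt, i).
  by rewrite [LHS]surjective_pairing iter_cnext_ord; case: (iter t _ _).1.
rewrite yi in w; have o := qorg_pi cQ (tt, i); have t' := qtgt_pi cQ (tt, i).
have g := qgen_pi cQ (tt, i); rewrite /= -IHt -/i /act /colour.
move: o t' g; rewrite /corg /ctgt /cgen /=; case: (c i) => b [] /= o t' g.
  have := @hol_walkB _ _ _ _ _ _ (qfold_org (asboolW hQ)) (qfold_tgt (asboolW hQ)) _ (pi _ (tt, ord0)) a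
    (pi _ (tt, i)) (pre c t).
  by rewrite t' g -(fgl_linv (b, false)) => ->.
have := @hol_walkF _ _ _ _ _ _ (qfold_org (asboolW hQ)) (qfold_tgt (asboolW hQ)) _ (pi _ (tt, ord0)) a
  (pi _ (tt, i)) (pre c t).
by rewrite o g => ->.
Qed.

(** The word is a member of a basis of the loops of the quotient graph, so it takes uniform values
    under uniform labellings of the edges. *)
Lemma Phi_Prim Q N : clo Q -> Prim Q -> Phi (@colour Q) N = Unif N.
Proof.
move=> hQ [z [sz zP]]; have cQ := asboolW hQ; have [_ min _] := prg_grank hQ.
have sr : size (cycword c :: z) = rkq Q by apply/eqP; rewrite eqn_leq min // andbT.
pose y := fun i : 'I_(size (cycword c :: z)) => nth 1%g (cycword c :: z) i.
have yP g : qwalk (c := c) (tau := id) setT (pi (rset Q) (tt, ord0)) (pi (rset Q) (tt, ord0)) g <->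
    gens (codom y) g by rewrite codom_nth -zP; apply: iff_sym; apply: prg_walk (unit_merged hQ).
have cn := merged_conn cQ (unit_merged hQ).
have kE : (size (cycword c :: z) + #|{: quo (rset Q)}|)%N = (#|{: quo (cedge c id (rset Q))}|).+1.
  by rewrite sr rkqE.
pose F (s : 'S_N.+1) : R := #|[set h : {ffun X -> 'I_N.+1} | [forall x, h (tau x) == s (h x)]]|%:R.
have := folded_uniform (qfold_org (asboolW hQ)) (qfold_tgt (asboolW hQ)) cn yP F ord0 kE.
rewrite (eq_bigr (fun a => F (pact c (@colour Q) a L.+1))); last first.
  by move=> a _; rewrite -hol_pact.
rewrite card_Sn => e; rewrite /Phi /Unif !natr_sum.
have f0 m : (m`!)%:R != 0 :> R by rewrite pnatr_eq0 -lt0n fact_gt0.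
have fE : ((N.+1)`! ^ #|{: quo (cedge c id (rset Q))}|)%:R != 0 :> R.
  by rewrite natrX expf_neq0.
apply: (mulIf (f0 N.+1)); apply: (mulIf fE); rewrite mulrAC mulfVK // mulfVK //.
by rewrite !mulr_natr; exact: e.
Qed.

(** Induction on [Q]: the quotients contained in a primitive one are primitive, and in the sum over
    them the discrete one already accounts for the whole uniform average. *)
Lemma RQ_Prim : exists N1, forall N, (N1 <= N)%N -> forall Q, clo Q -> Prim Q ->
  RQ Q N = if Q == disc then Unif N else 0.
Proof.
have [N1 h] := Phi_sum; exists N1 => N NN; have {}h := h N NN.
have Qd Q : clo Q -> Q \subset disc -> Q = disc.
  move=> /asboolP cQ Qd; apply/eqP; rewrite eqEsubset Qd; apply/subsetP => -[a b].
  by rewrite inE /= => /eqP->; apply: (eqr_refl cQ.1).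
have dQ Q : clo Q -> disc \subset Q.
  by move=> /asboolP cQ; apply/subsetP => -[a b]; rewrite inE /= => /eqP->; apply: (eqr_refl cQ.1).
have Rd : RQ disc N = Unif N.
  rewrite -(Phi_Prim N disc_clo disc_Prim) (h _ _ disc disc_clo (fun i j => colourP i j disc_clo)).
  rewrite (eq_bigl (pred1 disc)) ?big_pred1_eq // => Q /=.
  apply/andP/eqP => [[cQ /(Qd _ cQ)]//|->]; split=> //; exact: disc_clo.
move=> Q; have [m] := ubnP #|Q|; elim: m Q => // m IHm Q; rewrite ltnS => Qm hQ PQ.
case: eqP => [->//|/eqP Qnd].
have := h _ _ Q hQ (fun i j => colourP i j hQ); rewrite (Phi_Prim N hQ PQ).
rewrite (bigD1 Q) /= ?hQ ?subxx // (bigD1 disc) /=; last first.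
  by rewrite disc_clo dQ //= eq_sym.
rewrite Rd [X in _ + (_ + X)]big1 ?addr0 => [|S /andP[/andP[/andP[hS SQ] SnQ] Snd]].
  by move=> e; apply: (addIr (Unif N)); rewrite add0r -e.
have PS := Prim_sub hS hQ SQ PQ.
rewrite (IHm S) ?(negPf Snd) //; apply: leq_trans Qm; apply: proper_card.
by rewrite properEneq SnQ.
Qed.

(** With [J] total the quotient is a bouquet of circles whose colours are the generators: this is
    the average over the free group itself. *)
Lemma Phi_top : exists N1, forall N, (N1 <= N)%N -> forall (C : finType) (e : 'I_L.+1 -> C),
  (forall i j, (e i == e j) = ((c i).1 == (c j).1)) ->
  Phi e N = Unif N + \sum_(Q | clo Q && ~~ `[< Prim Q >]) RQ Q N.
Proof.
have [N1 h] := Phi_sum; have [N2 hP] := RQ_Prim.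
exists (maxn N1 N2) => N; rewrite geq_max => /andP[n1 n2] C e eP.
have rT : rset [set: Y1 * Y1] = (fun _ _ => true).
  by apply: funext => a; apply: funext => b; rewrite /rset inE.
have cT : clo setT by apply/asboolP; rewrite rT; split.
rewrite (h N n1 C e setT cT) => [|i j]; last by rewrite rT /cedge andbT eP.
rewrite (bigID (fun Q => `[< Prim Q >])) /=; congr (_ + _); last first.
  by apply: eq_bigl => Q; rewrite subsetT andbT.
rewrite (bigD1 disc) /=; last by rewrite disc_clo subsetT /=; apply/asboolP/disc_Prim.
rewrite (hP N n2) ?eqxx ?disc_clo //; last exact: disc_Prim.
rewrite big1 ?addr0 // => Q /andP[/andP[/andP[hQ _] /asboolP PQ] Qd].
by rewrite (hP N n2) // (negPf Qd).
Qed.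

Variable n : nat.
Hypotheses (n1 : (1 < n)%N) (piW : pi_hyp n (cycword c)).

Lemma nonPrim_rkq Q : clo Q -> ~ Prim Q -> (n <= rkq Q)%N.
Proof.
move=> hQ nP; rewrite leqNgt; apply/negP => lt; apply: nP.
apply: piW => //; last exact: prg_W.
by have [[z [sz zP]] _ _] := prg_grank hQ; exists z; rewrite sz.
Qed.

Lemma wgen_Prim Q : clo Q -> wgen_le (prg c (rset Q)) (cycword c) n -> Prim Q.
Proof.
move=> hQ w; apply: contrapT => nP; have nr := nonPrim_rkq hQ nP; apply: nP.
exact: wgen_le_mono nr w.
Qed.

Definition pquot (p : Y1 * Y1) : freeGroup I := (pre c p.1.2 * (pre c p.2.2)^-1)%g.

Lemma gclos_gens M D z : (forall g, prg c (rset M) g <-> gens z g) ->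
  forall g, prg c (rset (gclos M D)) g <->
    gens (z ++ [seq pquot p | p <- enum D]) g.
Proof.
move=> zP g; rewrite rset_gclos; split.
  apply: prg_cclos; first exact: gen_subgrp.
    have : prg c (rset M) (cycword c) by apply: prg_W.
    by move/zP; apply: gen_sub => h hz; apply: gen_in; rewrite mem_cat hz.
  move=> a b [[x [y [Mxy -> ->]]]|Dab].
    have /zP := prg_in c Mxy.
    by apply: gen_sub => h hz; apply: gen_in; rewrite mem_cat hz.
  apply: gen_in; rewrite mem_cat; apply/orP; right; apply/mapP; exists (a, b) => //.
  by rewrite mem_enum.
apply: gen_min; first exact: prg_subgrp.
move=> h; rewrite mem_cat => /orP[hz|/mapP[[a b]]]; last first.
  rewrite mem_enum => Dab ->; apply: (@prg_in _ _ c _ _ a b); apply: cclos_in; by right.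
have : gens z h by apply: gen_in.
move/zP; apply: prg_min; [exact: prg_subgrp|exact: prg_W|move=> x y Mxy].
by apply: (@prg_in _ _ c _ _ (prj x) (prj y)); apply: cclos_in; left; exists x, y.
Qed.

Definition lmain Q M := [&& `[< ccl c tau (rset M) >], gclos M set0 == Q & ldef M == n.-1].

(** Each pair in [D] adds one generator. For a term of order below [n] other than a leading one,
    [prg M] has fewer than [n] generators, so the word is one of them; with the pairs of [D] added,
    [Q] would be primitive. *)
Lemma RQ_asymp Q : clo Q -> ~ Prim Q ->
  nuO (fun N => RQ Q N - #|[set M | lmain Q M]|%:R * nu R N ^+ n.-1) n.
Proof.
move=> hQ nP.
have E N : RQ Q N - #|[set M | lmain Q M]|%:R * nu R N ^+ n.-1 =
    \sum_(p : {set Y * Y} * {set Y1 * Y1} | `[< ccl c tau (rset p.1) >] && (gclos p.1 p.2 == Q))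
      (nu R N ^+ ldef p.1 * lexp p.1 p.2 N -
       (if (p.2 == set0) && (ldef p.1 == n.-1) then nu R N ^+ n.-1 else 0)).
  rewrite sumrB; congr (_ - _); rewrite -big_mkcondr /= mulr_natl -sumr_const.
  rewrite (reindex_onto (fun M => (M, set0)) (fun p : {set Y * Y} * {set Y1 * Y1} => p.1)) /=.
    by apply: eq_bigl => M; rewrite !inE !eqxx /= andbT /lmain andbA.
  by move=> [M D] /= /and3P[_ /eqP->].
apply: (nuO_eq (N0 := 0%N) (fun N _ => esym (E N))).
apply: nuO_sum => -[M D] /= /andP[/asboolP cM /eqP gQ].
have [N0 [_ hO h0]] := lexpP M.
case: (boolP ((D == set0) && (ldef M == n.-1))) => [/andP[/eqP-> /eqP->]|nmain].
  apply: (nuO_eq (f := fun N => nu R N ^+ n.-1 * (lexp M set0 N - 1)) (N0 := 0%N)).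
    by move=> N _; rewrite mulrBr mulr1.
  have -> : n = (n.-1 + 1)%N by move: n1; clear; case: (n) => // m; rewrite addn1.
  by rewrite addn1 /= -[n.-1.+1]addn1; apply: nuO_mul => //; apply: nuO_nu.
apply: (nuO_eq (f := fun N => nu R N ^+ ldef M * lexp M D N) (N0 := 0%N)).
  by move=> N _; rewrite subr0.
apply: nuO_mono (nuO_mul (nuO_nu R (ldef M)) (hO D)).
rewrite leqNgt; apply/negP => lt; apply: nP; apply: (wgen_Prim hQ).
have lM : (ldef M + 1 < n)%N.
  move: lt nmain; rewrite addn1; case: (eqVneq D set0) => [->|Dn0] lt nm.
    rewrite cards0 addn0 in lt.
    by rewrite ltn_neqAle lt andbT; apply/eqP => e; move: nm; rewrite -e /= eqxx.
  apply: leq_trans lt; rewrite ltnS -addn1 leq_add2l card_gt0 //.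
have [z [sz zP]] : wgen_le (prg c (rset M)) (cycword c) (ldef M + 1).
  apply: piW => //; last exact: prg_W.
  apply: (prg_gen_le cw cM); rewrite /ldef /lE /lV.
  by move: #|_| #|_|; clear; lia.
exists (z ++ [seq pquot p | p <- enum D]); split.
  rewrite size_cat size_map -cardE; apply: leq_trans lt.
  by rewrite ltnS leq_add2r; move: sz; rewrite addn1.
by move=> g; rewrite -gQ (gclos_gens D zP) cat_cons.
Qed.

End MainExpansion.

Definition invq (Z : finType) (rho : Z -> Z) (S : {set Z * Z}) :=
  `[< equivalence_rel (fun a b => (a, b) \in S) /\
      forall a b, ((a, b) \in S) = ((rho a, rho b) \in S) >].

(** * Lifts of leading order over a non-primitive quotient *)

Section SpecialCount.
Variables (I : choiceType) (L : nat) (c : 'I_L.+1 -> I * bool) (cw : cyc_reduced c).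
Variables (X : finType) (tau : X -> X).
Local Notation Y := (X * 'I_L.+1)%type.
Local Notation Y1 := (unit * 'I_L.+1)%type.
Implicit Types (M : {set Y * Y}) (Q : {set Y1 * Y1}) (S : {set option X * option X}).

(** The special quotient built from its data: [None] marks the class of base points whose copies are
    folded by [Q]. *)
Definition spec_set Q S : {set Y * Y} := [set p : Y * Y |
  (((Some p.1.1, Some p.2.1) \in S) && (p.1.2 == p.2.2)) ||
  [&& (Some p.1.1, None) \in S, (Some p.2.1, None) \in S & (prj p.1, prj p.2) \in Q]].

Section Fixed.
Variables (Q : {set Y1 * Y1}) (S : {set option X * option X}).
Hypotheses (cQ : ccl c id (rset Q)) (iS : invq (omap tau) S).
Let M := spec_set Q S.
Let eS : equivalence_rel (fun a b => (a, b) \in S). Proof. by case/asboolP: iS. Qed.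
Let vS a b : ((a, b) \in S) = ((omap tau a, omap tau b) \in S).
Proof. by case/asboolP: iS. Qed.

Lemma specE a b : rset M a b = (((Some a.1, Some b.1) \in S) && (a.2 == b.2)) ||
  [&& (Some a.1, None) \in S, (Some b.1, None) \in S & (prj a, prj b) \in Q].
Proof. by rewrite /rset inE. Qed.

Lemma spec_equiv : equivalence_rel (rset M).
Proof.
apply: equivalence_relT => [a|a b|b a d]; rewrite !specE.
- by rewrite eqxx andbT (eqr_refl eS (Some a.1)).
- rewrite (eqr_sym eS (Some a.1)) eq_sym andbCA; congr (_ || [&& _, _ & _]).
  exact: (eqr_sym cQ.1).
move=> /orP[/andP[s1 /eqP e1]|/and3P[n1 n2 q1]] /orP[/andP[s2 /eqP e2]|/and3P[n3 n4 q2]].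
- by rewrite e1 e2 eqxx andbT (eqr_trans eS s1 s2).
- apply/orP; right; rewrite n4 (eqr_trans eS s1 n3) /= .
  by move: q2; rewrite /prj e1.
- apply/orP; right; rewrite n1 /=; apply/andP; split; last by move: q1; rewrite /prj e2.
  by apply: (eqr_trans eS _ n2); rewrite (eqr_sym eS).
by apply/orP; right; rewrite n1 n4; apply: (eqr_trans cQ.1 q1 q2).
Qed.

Let none_org y : ((Some (corg c tau y).1, None) \in S) = ((Some y.1, None) \in S).
Proof.
have t x : ((Some (tau x), None) \in S) = ((Some x, None) \in S) by rewrite [RHS]vS.
by rewrite /corg /cnext; case: (c _).2 => //=; case: eqP; rewrite ?t.
Qed.

Let none_tgt y : ((Some (ctgt c tau y).1, None) \in S) = ((Some y.1, None) \in S).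
Proof.
have t x : ((Some (tau x), None) \in S) = ((Some x, None) \in S) by rewrite [RHS]vS.
by rewrite /ctgt /cnext; case: (c _).2 => //=; case: eqP; rewrite ?t.
Qed.

Let S_next (y y' : Y) : y.2 = y'.2 ->
  ((Some (cnext tau y).1, Some (cnext tau y').1) \in S) = ((Some y.1, Some y'.1) \in S).
Proof.
by move=> e; rewrite /cnext e /=; case: eqP => // _; rewrite [RHS]vS.
Qed.

Let pos_edge y y' : cgen c y = cgen c y' ->
  ((corg c tau y).2 == (corg c tau y').2) = (y.2 == y'.2).
Proof.
move=> g; have := cedge_eq cw (prj y) (prj y').
rewrite /cedge; have -> : cgen c (prj y) == cgen c (prj y') by apply/eqP.
by rewrite -!(prj_org c tau) /prj /= !xpair_eqE.
Qed.

Let pos_tgt y y' : cgen c y = cgen c y' ->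
  ((ctgt c tau y).2 == (ctgt c tau y').2) = (y.2 == y'.2).
Proof.
move=> g; rewrite -(pos_edge g); have /esym := (ccl_eq cw).2 (prj y) (prj y') g.
by rewrite -!(prj_org c tau) -!(prj_tgt c tau) /prj !xpair_eqE.
Qed.

Lemma spec_org y y' : cgen c y = cgen c y' -> rset M (corg c tau y) (corg c tau y') =
  (((Some y.1, Some y'.1) \in S) && (y.2 == y'.2)) ||
  [&& (Some y.1, None) \in S, (Some y'.1, None) \in S &
    (prj (corg c tau y), prj (corg c tau y')) \in Q].
Proof.
move=> g; rewrite specE !none_org pos_edge //; congr (_ || _).
case: eqP => [e|_]; rewrite ?andbF // !andbT.
by rewrite /corg e; case: (c _).2 => //; apply: S_next.
Qed.

Lemma spec_ccl : ccl c tau (rset M).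
Proof.
split; first exact: spec_equiv.
move=> y y' g; rewrite spec_org // specE !none_tgt pos_tgt //; congr (_ || [&& _, _ & _]).
  case: eqP => [e|_]; rewrite ?andbF // !andbT.
  by rewrite /ctgt e; case: (c _).2 => //; rewrite S_next.
by have := cQ.2 (prj y) (prj y') g; rewrite -!(prj_org c tau) -!(prj_tgt c tau).
Qed.

Variable x0 : X.
Hypothesis x0S : (Some x0, None) \in S.

(** The copies outside the marked class have as many vertex classes as edge classes, so they cancel
    in $\chi$. *)
Lemma spec_card : (lE c tau M - lV M)%N = (#|{: quo (cedge c id (rset Q))}| - #|{: quo (rset Q)}|)%N.
Proof.
pose f1 (y : Y1) : Y := (x0, y.2).
pose Z := {y : Y | (Some y.1, None) \notin S}; pose f2 (z : Z) : Y := val z.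
pose R2 : rel Z := fun a b => rset M (val a) (val b).
have eM := spec_equiv; have eE := cedge_equiv c tau eM.
have e2 : equivalence_rel R2.
  apply: equivalence_relT => [y|y y'|y y' y''].
  - exact: (eqr_refl eM (val y)).
  - exact: (eqr_sym eM).
  - exact: (eqr_trans eM).
have pf1 y : prj (f1 y) = y by case: y => [[] i].
have f1Q a b : rset Q a b = rset M (f1 a) (f1 b).
  rewrite specE /= x0S (eqr_refl eS (Some x0)) /= !pf1.
  by case: eqP => //= e; case: a b e => [[] i] [[] j] /= ->; apply: (eqr_refl cQ.1).
have cE a b : cedge c tau (rset M) a b = (cgen c a == cgen c b) &&
    ((((Some a.1, Some b.1) \in S) && (a.2 == b.2)) ||
    [&& (Some a.1, None) \in S, (Some b.1, None) \in S &
    (prj (corg c tau a), prj (corg c tau b)) \in Q]).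
  by rewrite /cedge; case: eqP => //= g; rewrite spec_org.
have f1E a b : cedge c id (rset Q) a b = cedge c tau (rset M) (f1 a) (f1 b).
  rewrite cE /cedge; congr (_ && _); rewrite /= x0S (eqr_refl eS (Some x0)) /= !prj_org !pf1.
  by case: eqP => //= e; case: a b e => [[] i] [[] j] /= ->; apply: (eqr_refl cQ.1).
have f2E a b : R2 a b = cedge c tau (rset M) (f2 a) (f2 b).
  rewrite cE /R2 specE -/(f2 a) -/(f2 b) (negPf (valP a)) /= !orbF.
  by case: eqP => [e|_]; rewrite ?andbF // !andbT /cgen e eqxx.
have dj a b : ~~ ((Some (f1 a).1, Some (f2 b).1) \in S).
  apply/negP => h; have /negP := valP b; apply.
  by apply: (eqr_trans eS _ x0S); rewrite (eqr_sym eS).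
have nb b : ((Some (f2 b).1, None) \in S) = false by apply/negbTE/(valP b).
have cov t : (exists a, rset M t (f1 a)) \/ (exists b, t = f2 b).
  have [tS|tS] := boolP ((Some t.1, None) \in S); last by right; exists (Sub t tS).
  left; exists (prj t); rewrite specE tS x0S pf1 /=.
  by apply/orP; right; exact: (eqr_refl cQ.1 (prj t)).
have covE t : (exists a, cedge c tau (rset M) t (f1 a)) \/ (exists b, t = f2 b).
  have [tS|tS] := boolP ((Some t.1, None) \in S); last by right; exists (Sub t tS).
  left; exists (prj t); rewrite cE tS x0S eqxx /= !prj_org pf1.
  by apply/orP; right; exact: (eqr_refl cQ.1 (corg c id (prj t))).
rewrite /lV (card_quo_split (f1 := f1) (f2 := f2) eM cQ.1 e2 f1Q (fun _ _ => erefl)); last first.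
- by move=> t; have [|[b ->]] := cov t; [left | right; exists b; apply: (eqr_refl eM)].
- by move=> a b; rewrite specE (negPf (dj a b)) nb /= andbF.
rewrite /lE (card_quo_split (f1 := f1) (f2 := f2) eE (cedge_equiv c id cQ.1) e2 f1E f2E); last first.
- by move=> t; have [|[b ->]] := covE t; [left | right; exists b; apply: (eqr_refl eE)].
- by move=> a b; rewrite cE (negPf (dj a b)) nb /= !andbF.
by rewrite subnDr.
Qed.

Lemma spec_gclos : gclos c M set0 = Q.
Proof.
have hQ : clo c Q by apply/asboolP.
apply/eqP; rewrite eqEsubset (gclos_sub _ _ hQ) sub0set andbT; apply/andP; split.
  apply/forall_inP => -[a b]; rewrite /= -/(rset M a b) specE.
  case/orP => [/andP[_ /eqP e]|/and3P[_ _ h]]; last exact: h.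
  by rewrite /prj e; apply: (eqr_refl cQ.1).
apply/subsetP => -[[[] i] [[] j]] qij; rewrite inE; apply: cclos_in; left.
exists (x0, i), (x0, j); split=> //; rewrite specE /= x0S /=.
by apply/orP; right; apply: qij.
Qed.

End Fixed.

Variable n : nat.
Hypotheses (n1 : (1 < n)%N) (piW : pi_hyp n (cycword c)) (W1 : cycword c != 1%g).
Hypothesis aper : forall k i : nat, (forall m : nat,
  c (iter (k + m + i)%N (@ordS _) ord0) = c (iter (k + m)%N (@ordS _) ord0)) -> (L.+1 %| i)%N.

Definition marked_invq : {set {set option X * option X}} :=
  [set S | invq (omap tau) S && [exists x, (Some x, None) \in S]].

Lemma lmain_special Q M : clo c Q -> ~ Prim c Q -> lmain c tau n Q M -> special tau (rset M).
Proof.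
move=> hQ nP /and3P[/asboolP cM /eqP gQ /eqP ld].
have [|w|//] := special_or_wgen cw n1 piW W1 aper cM.
  move: ld n1; rewrite /ldef /lE /lV; move: #|_| #|_|; clear; lia.
case: nP; apply: (wgen_Prim piW hQ); apply: wgen_le_eq w => g.
rewrite -gQ rset_gclos; split.
  apply: prg_min; [exact: prg_subgrp|exact: prg_W|move=> x y Mxy].
  by apply: (@prg_in _ _ c _ _ (prj x) (prj y)); apply: cclos_in; left; exists x, y.
apply: prg_cclos; [exact: prg_subgrp|exact: prg_W|].
by move=> a b [[x [y [Mxy -> ->]]]|]; [apply: (prg_in c Mxy) | rewrite inE].
Qed.

Lemma special_spec Q M : clo c Q -> ~ Prim c Q -> lmain c tau n Q M ->
  exists2 S, S \in marked_invq & M = spec_set Q S.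
Proof.
move=> hQ nP mM; have [y [fy sp]] := lmain_special hQ nP mM.
have /and3P[/asboolP cM /eqP gQ _] := mM; have eM := cM.1; have cQ := asboolW hQ.
(* [None] is placed at the fixed base point [y] of the special form. *)
pose f (z : option X) : Y := (odflt y z, ord0).
pose S : {set option X * option X} := [set p | rset M (f p.1) (f p.2)].
have nx x x' : rset M (x, ord0) (x', ord0) = rset M (tau x, ord0) (tau x', ord0).
  by rewrite -!(@iter_cycle L) (ccl_iter _ cM).
exists S.
  rewrite inE; apply/andP; split; last first.
    by apply/existsP; exists y; rewrite inE; apply: (eqr_refl eM).
  apply/asboolP; split.
    apply: equivalence_relT => [a|a b|b a d]; rewrite !inE /=.
    - exact: (eqr_refl eM).
    - exact: (eqr_sym eM).
    - exact: (eqr_trans eM).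
  have yy a : rset M (a, ord0) (y, ord0) = rset M (tau a, ord0) (y, ord0).
    rewrite nx; apply/idP/idP => h; apply: (eqr_trans eM h) => //.
    by rewrite (eqr_sym eM).
  move=> [a|] [b|]; rewrite !inE /f /=.
  - exact: nx.
  - exact: yy.
  - by rewrite ![rset M (y, _) _](eqr_sym eM) yy.
  - by rewrite !(eqr_refl eM).
have toy (a : Y) k : rset M (a.1, ord0) (y, ord0) -> rset M (a.1, k) (y, k).
  by rewrite (ccl_mark _ _ k cM).
have KE i j : rset M (y, i) (y, j) = (((tt, i), (tt, j)) \in Q).
  apply/idP/idP => [h|].
    by rewrite -gQ inE; apply: cclos_in; left; exists (y, i), (y, j).
  (* As [y] is fixed, [M] restricts on its copy to a folded congruence of the single cycle; it
     contains the projection of [M], hence its closure [Q]. *)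
  pose K : rel Y1 := fun a b => rset M (y, a.2) (y, b.2).
  have org (z : Y1) : rset M (corg c tau (y, z.2)) (y, (corg c id z).2).
    rewrite /corg /cnext /=; case: (c z.2).2 => /=; last exact: (eqr_refl eM).
    case: eqP => _; last exact: (eqr_refl eM).
    by rewrite (ccl_mark _ _ _ cM).
  have tgt (z : Y1) : rset M (ctgt c tau (y, z.2)) (y, (ctgt c id z).2).
    rewrite /ctgt /cnext /=; case: (c z.2).2 => /=; first exact: (eqr_refl eM).
    case: eqP => _; last exact: (eqr_refl eM).
    by rewrite (ccl_mark _ _ _ cM).
  have cK : ccl c id K.
    split=> [|z z' g].
      apply: equivalence_relT => [a|a b|b a d]; rewrite /K.
      - exact: (eqr_refl eM).
      - exact: (eqr_sym eM).
      - exact: (eqr_trans eM).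
    have := cM.2 (y, z.2) (y, z'.2) g; rewrite /K.
    have tr u u' v v' : rset M u v -> rset M u' v' -> rset M u u' = rset M v v'.
      move=> h h'; apply/idP/idP => k.
        apply: (eqr_trans eM _ h'); apply: (eqr_trans eM _ k).
        by rewrite (eqr_sym eM).
      by apply: (eqr_trans eM h); apply: (eqr_trans eM k); rewrite (eqr_sym eM).
    by rewrite (tr _ _ _ _ (org z) (org z')) (tr _ _ _ _ (tgt z) (tgt z')).
  rewrite -gQ inE => h; rewrite -[rset M _ _]/(K (tt, i) (tt, j)).
  apply: (cclos_min cK _ h) => {h} a b [[x [x' [Mx -> ->]]]|]; last by rewrite inE.
  rewrite /K /=; move: Mx; rewrite sp => /orP[/andP[_ /eqP->]|/and3P[]//].
  exact: (eqr_refl eM).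
apply/setP => -[a b]; rewrite inE -/(rset M a b) sp !inE /= /f /=.
by rewrite KE.
Qed.

Lemma spec_lmain Q S : clo c Q -> rkq c Q = n -> S \in marked_invq -> lmain c tau n Q (spec_set Q S).
Proof.
move=> hQ rk; rewrite inE => /andP[iS /existsP[x0 x0S]]; have cQ := asboolW hQ.
apply/and3P; split.
- by apply/asboolP; apply: spec_ccl.
- by apply/eqP; apply: (spec_gclos cQ x0S).
rewrite /ldef (spec_card cQ iS x0S); move: rk; rewrite /rkq; move: #|_| #|_|; clear; lia.
Qed.

(** A non-primitive [Q] is not discrete. Two distinct positions that it identifies detect which base
    points are marked, and equal positions detect the relation between base points. *)
Lemma spec_inj Q : clo c Q -> ~ Prim c Q -> {in marked_invq &, injective (spec_set Q)}.
Proof.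
move=> hQ nP S S'; rewrite !inE => /andP[iS _] /andP[iS' _] /setP E; have cQ := asboolW hQ.
have [[eS vS] [eS' vS']] := (asboolW iS, asboolW iS').
have Qnd : Q != disc L.
  by apply/eqP => e; apply: nP; rewrite e; apply: disc_Prim.
have [i [j [ij qij]]] : exists i j, i <> j /\ ((tt, i), (tt, j)) \in Q.
  apply: contrapT => no; case/negP: Qnd; rewrite eqEsubset; apply/andP; split; apply/subsetP.
    move=> [[[] i] [[] j]] qij; rewrite inE /=; apply/eqP; congr pair.
    by apply: contrapT => ij; apply: no; exists i, j.
  by move=> [a b]; rewrite inE /= => /eqP->; apply: (eqr_refl cQ.1).
have noneE x : ((Some x, None) \in S) = ((Some x, None) \in S').
  have := E ((x, i), (x, j)); rewrite !inE /= /prj /= qij.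
  have /negPf-> : i != j by apply/eqP.
  by rewrite !andbF /= !andbT !andbb.
have someE x x' : ((Some x, Some x') \in S) = ((Some x, Some x') \in S').
  have sub (T : {set option X * option X}) : equivalence_rel (fun a b => (a, b) \in T) ->
      ((Some x, Some x') \in T) = (((x, ord0), (x', ord0)) \in spec_set Q T).
    move=> eT; rewrite inE /= eqxx andbT; apply/idP/orP => [|[//|/and3P[h h' _]]]; first by left.
    by apply: (eqr_trans eT h); rewrite (eqr_sym eT).
  by rewrite (sub S eS) (sub S' eS') E.
apply/setP => -[[x|] [x'|]]; [exact: someE|exact: noneE| |].
  by rewrite (eqr_sym eS) (eqr_sym eS') noneE.
by rewrite (eqr_refl eS None) (eqr_refl eS' None).
Qed.

Lemma card_lmain Q : clo c Q -> ~ Prim c Q ->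
  #|[set M | lmain c tau n Q M]| = if rkq c Q == n then #|marked_invq| else 0%N.
Proof.
move=> hQ nP; case: eqP => [rk|nrk].
  rewrite -(card_in_imset (spec_inj hQ nP)); apply: eq_card => M; rewrite inE.
  apply/idP/imsetP => [/(special_spec hQ nP)[S SS ->]|[S SS ->]]; first by exists S.
  exact: spec_lmain.
apply/eqP; rewrite cards_eq0; apply/eqP/setP => M; rewrite !inE; apply/negP => mM.
have [S] := special_spec hQ nP mM; rewrite inE => /andP[iS /existsP[x0 x0S]] ME.
apply: nrk; have /and3P[_ _ /eqP] := mM.
rewrite ME /ldef (spec_card (asboolW hQ) iS x0S); have := rkqE hQ; move: n1; rewrite /rkq.
have := nonPrim_rkq piW hQ nP; rewrite /rkq.
by move: #|_| #|_|; clear; lia.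
Qed.

End SpecialCount.

(** * Asymptotics of the average over a cyclically reduced word *)

Section MainAsymptotics.
Local Open Scope ring_scope.
Variables (I : choiceType) (L : nat) (c : 'I_L.+1 -> I * bool) (cw : cyc_reduced c).
Variables (R : realFieldType) (X : finType) (tau : X -> X).
Hypothesis W1 : cycword c != 1%g.
Hypothesis aper : forall k i : nat, (forall m : nat,
  c (iter (k + m + i)%N (@ordS _) ord0) = c (iter (k + m)%N (@ordS _) ord0)) -> (L.+1 %| i)%N.
Variables (C : finType) (e : 'I_L.+1 -> C).
Hypothesis eP : forall i j, (e i == e j) = ((c i).1 == (c j).1).
Local Notation Y1 := (unit * 'I_L.+1)%type.

Definition critQ n : {set {set Y1 * Y1}} :=
  [set Q | [&& clo c Q, ~~ `[< Prim c Q >] & rkq c Q == n]].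

Lemma Phi_asymp n : (1 < n)%N -> pi_hyp n (cycword c) ->
  nuO (fun N => Phi c R tau e N - Unif R tau N -
    #|marked_invq tau|%:R * #|critQ n|%:R * nu R N ^+ n.-1) n.
Proof.
move=> n1 piW; have [N1 h] := Phi_top cw R tau W1.
pose A Q : R := #|[set M | lmain c tau n Q M]|%:R.
have AE : \sum_(Q | clo c Q && ~~ `[< Prim c Q >]) A Q = #|marked_invq tau|%:R * #|critQ n|%:R.
  rewrite (eq_bigr (fun Q => if rkq c Q == n then #|marked_invq tau|%:R else 0)).
    rewrite -big_mkcondr /= sumr_const mulr_natr; congr (_ *+ _).
    by apply: eq_card => Q; rewrite [LHS]unfold_in inE andbA.
  move=> Q /andP[hQ /asboolPn nP]; rewrite /A (card_lmain cw tau n1 piW W1 aper hQ nP).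
  by case: ifP.
apply: (@nuO_eq R (fun N => \sum_(Q | clo c Q && ~~ `[< Prim c Q >])
    (RQ c R tau Q N - A Q * nu R N ^+ n.-1)) _ n N1).
  move=> N NN; rewrite (h N NN C e eP) [Unif R tau N + _]addrC addrK sumrB -mulr_suml AE //.
apply: nuO_sum => Q /andP[hQ /asboolPn nP].
exact: (RQ_asymp cw R tau n1 piW hQ nP).
Qed.

Lemma Phi_exact : (forall n, pi_hyp n (cycword c)) -> exists N1, forall N, (N1 <= N)%N ->
  Phi c R tau e N = Unif R tau N.
Proof.
move=> piW; have [N1 h] := Phi_top cw R tau W1; exists N1 => N NN.
rewrite (h N NN C e eP) big_pred0 ?addr0 // => Q; apply/negP => /andP[hQ /asboolPn nP].
by have := nonPrim_rkq (piW (rkq c Q).+1) hQ nP; rewrite ltnn.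
Qed.

Lemma prgQ_inj Q Q' : clo c Q -> clo c Q' -> (forall g, prg c (rset Q) g -> prg c (rset Q') g) ->
  Q \subset Q'.
Proof.
move=> hQ hQ' QQ; apply/subsetP => -[[[] i] [[] j]] q.
have := QQ _ (@prg_in _ _ c _ (rset Q) (tt, i) (tt, j) q).
exact: (prg_merged_eq (asboolW hQ') (unit_merged hQ')).
Qed.

End MainAsymptotics.

(** * Equivariant maps, averages and the inner product *)

Section InvariantRelations.
Local Open Scope ring_scope.
Variables (R : realFieldType) (X : finType) (tau : X -> X).

Let c (i : 'I_1) : unit * bool := (tt, false).
Let Y := (X * 'I_1)%type.
Local Notation rsetY := (@rset 0 X).

Let corgE y : corg c tau y = y. Proof. by []. Qed.

(** The count of lifts is applied to a word of one letter. Vertex and edge classes then coincide, so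
    the falling factorials cancel and every lift contributes exactly 1. *)
Lemma Unif_count N : (#|X| <= N)%N -> Unif R tau N = #|[set S | invq tau S]|%:R.
Proof.
move=> XN; pose J : rel (unit * 'I_1) := fun _ _ => true.
have cJ : ccl c id J by [].
pose e (i : 'I_1) := tt.
have eP i j : (e i == e j) = cedge c id J (tt, i) (tt, j) by rewrite /cedge !eqxx.
have YN : (#|{: Y}| <= N.+1)%N by rewrite card_prod card_ord muln1 leqW.
have termE M : lift_ok c tau J M ->
   ((\prod_(q : quo (rsetY M)) (N.+1 - kV J q)) * \prod_a (N.+1 - edge_count c tau e M a)`!)%N = (N.+1)`!.
  move=> okM; rewrite -[RHS](expn1 _) -[X in (_ ^ X)%N]card_unit.
  rewrite -(prod_edge_count tau eP M YN) mulnC; congr (_ * _)%N.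
have f0 : ((N.+1)`!)%:R != 0 :> R by rewrite pnatr_eq0 -lt0n fact_gt0.
have := sum_lifts tau cJ eP N; rewrite (eq_bigr _ termE) sum_nat_const.
rewrite (reindex (fun s : 'S_N.+1 => [ffun _ : unit => s])) /=; last first.
  exists (fun f : {ffun unit -> 'S_N.+1} => f tt) => [s _|f _]; first by rewrite ffunE.
  by apply/ffunP => -[]; rewrite ffunE.
rewrite /act /= => sE.
rewrite /Unif (_ : (\sum_s _)%N = (#|[set S | invq tau S]| * (N.+1)`!)%N).
  by rewrite natrM mulfK.
rewrite (_ : #|[set S | invq tau S]| = #|[pred M | lift_ok c tau J M]|).
  by rewrite -sE; apply: eq_bigr => s _; apply: eq_card => h; rewrite !inE;
    apply: eq_forallb => x; rewrite ffunE mul1g.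
pose F (S : {set X * X}) : {set Y * Y} := [set p | (p.1.1, p.2.1) \in S].
have Fi : injective F.
  move=> S S' /setP E; apply/setP => -[a b].
  by have := E ((a, ord0), (b, ord0)); rewrite !inE.
have nx (y : Y) : cnext tau y = (tau y.1, ord0).
  by case: y => x i; rewrite /cnext [i]ord1 /=; congr pair; apply: ord_inj.
rewrite -(card_imset _ Fi); apply: eq_card => M; rewrite [RHS]inE; apply/imsetP/lift_okP.
  move=> [S]; rewrite inE => /asboolP[eS vS] ->; split=> //; split.
    apply: equivalence_relT => [a|a b|b a d]; rewrite /rset !inE.
    - exact: (eqr_refl eS).
    - exact: (eqr_sym eS).
    - exact: (eqr_trans eS).
  by move=> y y' _; rewrite !corgE /ctgt /= !nx /rset !inE /= -vS.
move=> [[eM cM] _]; exists [set p | rsetY M (p.1, ord0) (p.2, ord0)].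
  rewrite inE; apply/asboolP; split=> [|a b].
    apply: equivalence_relT => [a|a b|b a d]; rewrite !inE.
    - exact: (eqr_refl eM).
    - exact: (eqr_sym eM).
    - exact: (eqr_trans eM).
  rewrite !inE /=; have := cM (a, ord0) (b, ord0) erefl.
  by rewrite !corgE /ctgt /= !nx.
by apply/setP => -[[a i] [b j]]; rewrite !inE /= [i]ord1 [j]ord1.
Qed.

(** The invariant relations that leave [None] alone are those of [X]. *)
Lemma card_marked : (#|marked_invq tau| + #|[set S | invq tau S]|)%N =
  #|[set S | invq (omap tau) S]|.
Proof.
pose G (S : {set X * X}) : {set option X * option X} := [set p |
  match p with (Some a, Some b) => (a, b) \in S | (None, None) => true | _ => false end].
have Gi : injective G.
  move=> S S' /setP E; apply/setP => -[a b].
  by have := E (Some a, Some b); rewrite !inE.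
have GP S : invq tau S = invq (omap tau) (G S).
  apply/asboolP/asboolP => -[eS vS]; split.
  - apply: equivalence_relT => [[a|]|[a|] [b|]|[b|] [a|] [d|]]; rewrite ?inE //.
    + exact: (eqr_refl eS).
    + exact: (eqr_sym eS).
    + exact: (eqr_trans eS).
  - by move=> [a|] [b|]; rewrite !inE //=.
  - have K a b : ((a, b) \in S) = ((Some a, Some b) \in G S) by rewrite inE.
    apply: equivalence_relT => [a|a b|b a d]; rewrite !K.
    + exact: (eqr_refl eS).
    + exact: (eqr_sym eS).
    + exact: (eqr_trans eS).
  - by move=> a b; have := vS (Some a) (Some b); rewrite !inE.
rewrite -(card_imset _ Gi) -cardsUI.
rewrite [X in (_ + X)%N](_ : _ = 0%N) ?addn0; last first.
  apply/eqP; rewrite cards_eq0; apply/eqP/setP => T; rewrite !inE; apply/negP.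
  by move=> /andP[/andP[_ /existsP[x +]] /imsetP[S _ TG]]; rewrite TG inE.
apply: eq_card => T; rewrite !inE; apply/orP/idP => [[/andP[]//|/imsetP[S + ->]]|iT].
  by rewrite inE GP.
have [xT|xT] := boolP [exists x, (Some x, None) \in T]; [by left; rewrite iT | right].
have /asboolP[eT vT] := iT.
have nT x : ((Some x, None) \in T) = false by apply: contraNF xT => h; apply/existsP; exists x.
have TG : T = G [set p | (Some p.1, Some p.2) \in T].
  apply/setP => -[[a|] [b|]]; rewrite !inE //; first by rewrite (eqr_sym eT) nT.
  exact: (eqr_refl eT).
apply/imsetP; exists [set p | (Some p.1, Some p.2) \in T] => //.
by rewrite inE GP -TG.
Qed.

(** The total relation is marked; this is the positivity of the constant. *)
Lemma marked_gt0 : X -> (0 < #|marked_invq tau|)%N.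
Proof.
move=> x; apply/card_gt0P; exists setT; rewrite inE; apply/andP; split.
  by apply/asboolP; split=> [|a b]; rewrite ?inE //; move=> a b d; rewrite !inE.
by apply/existsP; exists x; rewrite inE.
Qed.

End InvariantRelations.

(** * Monomials as counts of equivariant maps *)

Section MarkFix.
Local Open Scope nat_scope.

Definition markfix (X : finType) (tau : X -> X) N (s : 'S_N) :=
  #|[set h : {ffun X -> 'I_N} | [forall x, h (tau x) == s (h x)]]|.

(** [None] goes to an arbitrary fixed point of [s], so adding a fixed base point is multiplication
    by $\xi_1$. *)
Lemma markfix_option (X : finType) (tau : X -> X) N (s : 'S_N) :
  markfix (omap tau) s = markfix tau s * #|[set i | s i == i]|.
Proof.
rewrite /markfix -cardsX.
pose F (p : {ffun X -> 'I_N} * 'I_N) : {ffun option X -> 'I_N} :=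
  [ffun z => if z is Some x then p.1 x else p.2].
have Fi : injective F.
  move=> [h i] [h' i'] /ffunP E; have := E None; rewrite !ffunE /= => ->; congr pair.
  by apply/ffunP => x; have := E (Some x); rewrite !ffunE.
rewrite -(card_imset _ Fi); apply: eq_card => f; rewrite inE.
apply/forallP/imsetP => [h|[[h i]]].
  exists ([ffun x => f (Some x)], f None).
    rewrite !inE /= eq_sym; apply/andP; split; last exact: (h None).
    by apply/forallP => x; rewrite !ffunE; apply: (h (Some x)).
  by apply/ffunP => -[x|]; rewrite !ffunE /= ?ffunE.
rewrite !inE /= => /andP[/forallP h1 /eqP h2] -> [x|]; rewrite !ffunE /=; first exact: h1.
by rewrite h2.
Qed.

Definition sum_map (X1 X2 : Type) (t1 : X1 -> X1) (t2 : X2 -> X2) (z : X1 + X2) : X1 + X2 :=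
  match z with inl x => inl (t1 x) | inr x => inr (t2 x) end.

Lemma markfix_sum (X1 X2 : finType) (t1 : X1 -> X1) (t2 : X2 -> X2) N (s : 'S_N) :
  markfix (sum_map t1 t2) s = markfix t1 s * markfix t2 s.
Proof.
rewrite /markfix -cardsX.
pose F (p : {ffun X1 -> 'I_N} * {ffun X2 -> 'I_N}) : {ffun X1 + X2 -> 'I_N} :=
  [ffun z => match z with inl x => p.1 x | inr x => p.2 x end].
have Fi : injective F.
  move=> [h i] [h' i'] /ffunP E; congr pair; apply/ffunP => x.
    by have := E (inl x); rewrite !ffunE.
  by have := E (inr x); rewrite !ffunE.
rewrite -(card_imset _ Fi); apply: eq_card => f; rewrite inE.
apply/forallP/imsetP => [h|[[h i]]].
  exists ([ffun x => f (inl x)], [ffun x => f (inr x)]).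
    rewrite !inE /=; apply/andP; split; apply/forallP => x; rewrite !ffunE.
      exact: (h (inl x)).
    exact: (h (inr x)).
  by apply/ffunP => -[x|x]; rewrite !ffunE /= ?ffunE.
rewrite !inE /= => /andP[/forallP h1 /forallP h2] -> [x|x]; rewrite !ffunE /=; first exact: h1.
exact: h2.
Qed.

Lemma markfix_void (tau : void -> void) N (s : 'S_N) : markfix tau s = 1.
Proof.
rewrite /markfix (eq_card (B := predT)) => [|h]; first by rewrite card_ffun card_void expn0.
by rewrite !inE; apply/forallP => -[].
Qed.

(** An equivariant map from a cycle is determined by the image of [ord0], and the cycle closes up
    when a power of [s] fixes it. *)
Lemma markfix_cycle k N (s : 'S_N) :
  markfix (@ordS k.+1) s = #|[set i | (s ^+ k.+1)%g i == i]|.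
Proof.
have sI t i : (s ^+ t.+1)%g i = s ((s ^+ t)%g i) by rewrite expgSr permM.
pose F (i : 'I_N) : {ffun 'I_k.+1 -> 'I_N} := [ffun j : 'I_k.+1 => (s ^+ j)%g i].
have Fi : injective F by move=> i i' /ffunP/(_ ord0); rewrite !ffunE /= !perm1.
rewrite /markfix -[RHS](card_imset _ Fi); apply: eq_card => h; rewrite inE.
apply/forallP/imsetP => [hc|[i]].
  have hE t (tk : t < k.+1) : h (Ordinal tk) = (s ^+ t)%g (h ord0).
    elim: t tk => [|t IHt] tk; first by rewrite perm1; congr (h _); apply: ord_inj.
    rewrite sI -(IHt (ltnW tk)) -(eqP (hc _)); congr (h _); apply: ord_inj.
    by rewrite /= modn_small.
  exists (h ord0); last by apply/ffunP => -[t tk]; rewrite ffunE /= hE.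
  rewrite inE sI -(hE k (ltnSn k)) -(eqP (hc _)); apply/eqP; congr (h _); apply: ord_inj.
  by rewrite /= modnn.
rewrite inE => /eqP si -> j; rewrite !ffunE -sI /=.
have [jk|jk] := eqVneq (nat_of_ord j) k; first by rewrite jk modnn si perm1.
by rewrite modn_small // ltnS ltn_neqAle jk -ltnS ltn_ord.
Qed.

Definition representable (f : forall N, 'S_N -> nat) :=
  exists (X : finType) (tau : X -> X), forall N (s : 'S_N), f N s = markfix tau s.

Lemma representable_prod k (f : nat -> forall N, 'S_N -> nat) :
  (forall i, representable (f i)) -> representable (fun N s => \prod_(i < k) f i N s).
Proof.
move=> fr; elim: k => [|k [X [tau IH]]].
  by exists void, id => N s; rewrite big_ord0 markfix_void.
have [X' [tau' h]] := fr k.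
by exists (X + X')%type, (sum_map tau tau') => N s; rewrite big_ord_recr /= IH h markfix_sum.
Qed.

Lemma representable_monomial k (a : 'I_k -> nat) : representable (fun N s =>
  \prod_(i < k) #|[set j | (s ^+ i.+1)%g j == j]| ^ a i).
Proof.
pose a' i := if insub i is Some j then a j else 0.
have r i : representable (fun N s => \prod_(m < a' i) #|[set j | (s ^+ i.+1)%g j == j]|).
  apply: (@representable_prod _ (fun _ N (s : 'S_N) => #|[set j | (s ^+ i.+1)%g j == j]|)) => _.
  by exists 'I_i.+1, (@ordS i.+1) => N s; rewrite markfix_cycle.
have [X [tau h]] := representable_prod k r; exists X, tau => N s; rewrite -h.
by apply: eq_bigr => i _; rewrite prod_nat_const card_ord /a' valK.
Qed.

End MarkFix.

(** * Cyclic reduction and conjugation of critical subgroups *)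

Section Conjugation.
Local Open Scope group_scope.
Variable I : choiceType.
Implicit Types (u v w g : freeGroup I) (H : classical_sets.set (freeGroup I)).

Lemma cyclic_reduction w : exists u v, w = u * v * u^-1 /\ (v = 1 \/
  exists L (c : 'I_L.+1 -> I * bool), fgword v = [seq c i | i <- enum 'I_L.+1] /\ cyc_reduced c).
Proof.
have [m] := ubnP (size (fgword w)); elim: m w => // m IHm w; rewrite ltnS => wm.
have done' : (fgword w = [::] \/ exists l t, fgword w = l :: t /\ l != linv (last l t)) ->
    exists u v, w = u * v * u^-1 /\ (v = 1 \/
  exists L (c : 'I_L.+1 -> I * bool), fgword v = [seq c i | i <- enum 'I_L.+1] /\ cyc_reduced c).
  move=> h; exists 1, w; rewrite mul1g invg1 mulg1; split=> //.
  case: h => [w0|[l [t [wE lt]]]]; first by left; apply: fgword_inj.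
  right; exists (size t), (fun i => nth l (l :: t) i).
  have -> : fgword w = [seq nth l (l :: t) (nat_of_ord i) | i <- enum 'I_(size t).+1].
    by rewrite wE -[LHS](mkseq_nth l) /mkseq -val_enum_ord -map_comp.
  split=> // i; have := ltn_ord i; rewrite ltnS leq_eqVlt => /orP[/eqP iL|iL].
    by rewrite iL [nat_of_ord _]/= iL modnn /= -last_nth.
  have -> : nat_of_ord (ordS i) = i.+1 by rewrite /= modn_small.
  by apply: reduced_nth => //; rewrite -wE; apply: (valP w).
case E: (fgword w) => [|l t]; first by apply: done'; left.
have [e|ne] := eqVneq l (linv (last l t)); last by apply: done'; right; exists l, t.
case: (lastP t) E e => [|t' l'] E.
  by rewrite /= => /(congr1 snd) /=; case: (l.2).
rewrite last_rcons => e; have rt' : reduced t'.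
  have : reduced (fgword w) by apply: (valP w).
  by rewrite E /reduced /= rcons_path => /andP[/path_sorted].
have [|u [v [vE h]]] := IHm (FreeGroup rt').
  by move: wm; rewrite E /= size_rcons; apply: ltn_trans.
exists (fgl l * u), v; split=> //.
rewrite [LHS]fg_prod E big_cons -cats1 big_cat big_seq1 /=.
have -> : fgl l' = (fgl l)^-1 by rewrite e fgl_linv invgK.
by rewrite -[X in _ * (X * _)]/(\prod_(j <- fgword (FreeGroup rt')) fgl j) -fg_prod vE invMg !mulgA.
Qed.

(** The periods [i] and [L.+1] combine into their greatest common divisor [d], and the word is then
    a power of its prefix of length [d]. *)
Lemma aperiodic_word v L (c : 'I_L.+1 -> I * bool) : cycword c = v -> non_power v ->
  forall k i : nat, (forall m : nat,
  c (iter (k + m + i)%N (@ordS _) ord0) = c (iter (k + m)%N (@ordS _) ord0)) -> (L.+1 %| i)%N.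
Proof.
move=> cv np k i h; pose ct t := c (iter t (@ordS _) ord0).
have ctm a b : a = b %[mod L.+1] -> ct a = ct b.
  by move=> e; congr c; apply: ord_inj; rewrite !val_iter_ordS !add0n.
have cti t : ct (t + i)%N = ct t.
  rewrite (ctm t (k + (t + k * L))%N); last first.
    by rewrite -(modnMDl k t L.+1); congr (_ %% _)%N; rewrite mulnS; ring.
  rewrite -[RHS]h; apply: ctm; rewrite -(modnMDl k (t + i) L.+1); congr (_ %% _)%N.
  by rewrite mulnS; ring.
have ctn t j : ct (t + j * i)%N = ct t.
  elim: j => [|j IHj]; first by rewrite mul0n addn0.
  by rewrite mulSn addnCA addnC cti.
case: (posnP i) => [->//|i0]; pose d := gcdn i L.+1.
have ctd t : ct (d + t)%N = ct t.
  have [a _ ab] := Bezoutr i (ltn0Sn L).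
  rewrite -(ctn _ a); apply: ctm; rewrite addnAC -modnDml.
  by move: ab; rewrite /dvdn => /eqP->.
have preD t : pre c (d + t)%N = pre c d * pre c t.
  elim: t => [|t IHt]; first by rewrite addn0 mulg1.
  by rewrite addnS /= IHt -mulgA -/(ct (d + t)%N) ctd.
have preM j : pre c (j * d)%N = pre c d ^+ j.
  by elim: j => // j IHj; rewrite mulSn preD IHj expgS.
have dL : (d %| L.+1)%N by apply: dvdn_gcdr.
have vE : v = pre c d ^+ (L.+1 %/ d)%N by rewrite -preM divnK.
have := np (pre c d) (L.+1 %/ d)%N; case: (L.+1 %/ d)%N (divnK dL) vE => [|[|m]] dE vE nv.
- by move: dE; rewrite mul0n.
- by rewrite -dE mul1n; apply: dvdn_gcdl.
by case: (nv isT vE).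
Qed.

Definition cj u H : classical_sets.set (freeGroup I) := fun g => H (u^-1 * g * u).

Lemma cjV u H : cj u^-1 (cj u H) = H.
Proof. by apply: funext => g; rewrite /cj invgK !mulgA mulVg mul1g -mulgA mulVg mulg1. Qed.

Lemma weval_conj (J : choiceType) (x : J -> freeGroup I) u z :
  weval (fun j => u * x j * u^-1) z = u * weval x z * u^-1.
Proof.
rewrite /weval; elim: (fgword z) => [|l s IHs]; first by rewrite !big_nil mulg1 mulgV.
rewrite !big_cons IHs /leval; case: l => j [] /=; rewrite ?invMg ?invgK !mulgA !mulgKV //.
Qed.

Lemma cj_basis (J : choiceType) (x : J -> freeGroup I) u H : is_basis x H ->
  is_basis (fun j => u * x j * u^-1) (cj u H).
Proof.
move=> /is_basisP[ix xP]; apply/is_basisP; split=> [z z'|g].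
  by rewrite !weval_conj => /mulIg/mulgI/ix.
rewrite /cj xP; split=> -[z zE]; exists z; rewrite ?weval_conj.
  by rewrite -zE !mulgA mulgV mul1g -mulgA mulgV mulg1.
by move: zE; rewrite weval_conj => ->; rewrite !mulgA mulVg mul1g mulgKV.
Qed.

Lemma cj_rank u H : rank (cj u H) = rank H.
Proof.
have K u' H' n : (exists x : 'I_n -> freeGroup I, is_basis x H') ->
    exists x : 'I_n -> freeGroup I, is_basis x (cj u' H').
  by move=> [x /(cj_basis u') hx]; exists (fun j => u' * x j * u'^-1).
rewrite /rank; congr nat_inf; apply: funext => n; apply: propext; split=> [/(K u^-1)|/(K u)//].
by rewrite cjV.
Qed.

Lemma cj_primitive u H v : primitive_in H v -> primitive_in (cj u H) (u * v * u^-1).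
Proof.
move=> [J [x [/(cj_basis u) xH [j _ xj]]]]; exists J, (fun j => u * x j * u^-1); split=> //.
by exists j => //; rewrite xj.
Qed.

Lemma cj_subgroup u H : is_subgroup H -> is_subgroup (cj u H).
Proof.
move=> /is_subgroupP[h1 hM hV]; apply/is_subgroupP; rewrite /cj; split.
- by rewrite mulg1 mulVg.
- move=> g h Hg Hh; have := hM _ _ Hg Hh; rewrite !mulgA -[X in X * h]mulgA.
  by rewrite mulgV mulg1.
by move=> g Hg; have := hV _ Hg; rewrite !invMg invgK mulgA.
Qed.

Definition crit_sub n v H :=
  [/\ is_subgroup H, rank H = n, H v & ~ primitive_in H v].

Lemma cj_crit n u v H : crit_sub n v H -> crit_sub n (u * v * u^-1) (cj u H).
Proof.
move=> [h1 h2 h3 h4]; split; [exact: cj_subgroup | by rewrite cj_rank | |].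
  by rewrite /cj !mulgA mulVg mul1g mulgKV.
move=> /(cj_primitive u^-1); rewrite cjV invgK !mulgA mulVg mul1g mulgKV.
exact: h4.
Qed.

Lemma cj_crit_eq n u v H : crit_sub n (u * v * u^-1) H -> crit_sub n v (cj u^-1 H).
Proof. by move=> /(cj_crit u^-1); rewrite invgK !mulgA mulVg mul1g mulgKV. Qed.

End Conjugation.

(** * Expansion of the average over word values *)

Section WordAverages.
Local Open Scope ring_scope.
Variables (R : realFieldType) (X : finType) (tau : X -> X).

Lemma markfix_conj N (p s : 'S_N) : markfix tau (p * s * p^-1)%g = markfix tau s.
Proof.
pose F (h : {ffun X -> 'I_N}) : {ffun X -> 'I_N} := [ffun x => p (h x)].
have Fi : injective F.
  by move=> h h' /ffunP E; apply/ffunP => x; have := E x; rewrite !ffunE => /perm_inj.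
rewrite /markfix -(card_imset _ Fi); apply: eq_card => h; rewrite [RHS]inE.
apply/imsetP/forallP => [[h']|hs].
  rewrite inE => /forallP hp -> x; rewrite !ffunE (eqP (hp x)) !permM permKV //.
exists [ffun x => (p^-1)%g (h x)]; last by apply/ffunP => x; rewrite !ffunE permKV.
by rewrite inE; apply/forallP => x; rewrite !ffunE (eqP (hs x)) !permM permKV.
Qed.

Definition word_avg r (w : freeGroup 'I_r) N : R :=
  (\sum_(s : {ffun 'I_r -> 'S_N.+1}) (markfix tau (weval s w))%:R) / #|{ffun 'I_r -> 'S_N.+1}|%:R.

Lemma word_avg_conj r (u v : freeGroup 'I_r) N : word_avg (u * v * u^-1)%g N = word_avg v N.
Proof.
rewrite /word_avg; congr (_ / _); apply: eq_bigr => s _.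
by rewrite !wevalM wevalV markfix_conj.
Qed.

Lemma weval_pact r L (c : 'I_L.+1 -> 'I_r * bool) N (s : {ffun 'I_r -> 'S_N.+1}) t :
  weval s (pre c t) = pact c (fun i => (c i).1) s t.
Proof.
elim: t => [|t IHt]; first by rewrite /= weval1.
by rewrite /= wevalM IHt weval_fgl.
Qed.

Lemma word_avg_Phi r L (c : 'I_L.+1 -> 'I_r * bool) N :
  word_avg (cycword c) N = Phi c R tau (fun i => (c i).1) N.
Proof.
rewrite /word_avg /Phi card_ffun card_Sn card_ord natr_sum; congr (_ / _).
by apply: eq_bigr => s _; rewrite /markfix /cycword weval_pact.
Qed.

Lemma prank_conj r (u v : freeGroup 'I_r) : primitivity_rank (u * v * u^-1)%g = primitivity_rank v.
Proof.
rewrite /primitivity_rank; congr nat_inf; apply: funext => n; apply: propext.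
split=> -[H hH]; first by exists (cj (u^-1)%g H); apply: (cj_crit_eq (n := Some n)).
by exists (cj u H); apply: (cj_crit (n := Some n)).
Qed.

Lemma word_avg_expansion r (w : freeGroup 'I_r) : non_power w ->
  (primitivity_rank w = None /\ exists N1, forall N, (N1 <= N)%N -> word_avg w N = Unif R tau N) \/
  exists n (T : finType) (F : T -> classical_sets.set (freeGroup 'I_r)), [/\ (1 < n)%N,
    primitivity_rank w = Some n, injective F, forall H, Crit w H <-> exists t, H = F t &
    nuO (fun N => word_avg w N - Unif R tau N - #|marked_invq tau|%:R * #|T|%:R * nu R N ^+ n.-1) n].
Proof.
move=> np; have [u [v [wE vP]]] := cyclic_reduction w.
have npv : non_power v.
  move=> x m m2 vx; apply: (np (u * x * u^-1)%g m m2); rewrite wE vx.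
  have -> : ((u * x * u^-1) ^+ m = u * x ^+ m * u^-1)%g; last by [].
  elim: m {m2 vx} => [|m IHm]; first by rewrite !expg0 mulg1 mulgV.
  by rewrite !expgS IHm !mulgA mulgKV.
have [v1|[L [c [vc cw]]]] := vP; first by case: (non_power_neq1 npv).
have cv := cycword_word vc.
have W1 : cycword c != 1%g by rewrite cv; apply/eqP; apply: non_power_neq1.
have aper := aperiodic_word cv npv.
have eP i j : (((c i).1 == (c j).1) = ((c i).1 == (c j).1)) by [].
have avgE N : word_avg w N = Phi c R tau (fun i => (c i).1) N.
  by rewrite wE word_avg_conj -cv word_avg_Phi.
have prE : primitivity_rank w = primitivity_rank v by rewrite wE prank_conj.
case E: (primitivity_rank v) => [n|]; rewrite E in prE; [right|left].
  have /nat_infP[[H0 [sH0 rH0 H0v nH0]] min] := E.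
  have pb : prim_bound n v.
    by move=> H m sH rH Hv nH; apply: min; exists H; split=> //; apply/is_subgroupP.
  have n1 : (1 < n)%N by apply: (prim_bound2 npv _ rH0 H0v nH0); apply/is_subgroupP.
  have piW : pi_hyp n (cycword c) by rewrite cv; apply: prim_bound_pi_hyp.
  (* The critical subgroups of [w] are the conjugates by [u] of those carried by the quotients in
     [critQ]; in particular they are finite in number. *)
  pose T := {Q | Q \in critQ c n}; pose F (t : T) := cj u (prg c (rset (val t))).
  have TP (t : T) : [/\ clo c (val t), ~ Prim c (val t) & rkq c (val t) = n].
    by have := valP t; rewrite inE => /and3P[h1 /asboolPn h2 /eqP h3].
  exists n, T, F; split=> //.
  - move=> t t' Ftt; have [[h1 _ _] [h1' _ _]] := (TP t, TP t').
    have e : prg c (rset (val t)) = prg c (rset (val t')).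
      by rewrite -(cjV u (prg c (rset (val t)))) -(cjV u (prg c (rset (val t')))) -/(F t) Ftt.
    apply: val_inj; apply/eqP; rewrite eqEsubset.
    by rewrite !(prgQ_inj h1 h1') ?(prgQ_inj h1' h1) // => g; rewrite e.
  - move=> H; have CE : Crit w H <-> crit_sub (Some n) w H by rewrite /Crit /crit_sub /= prE.
    rewrite CE; split=> [/[dup] cH|[t ->]].
      rewrite wE => /cj_crit_eq[/is_subgroupP sH' rH' H'v nH'].
      have [Q [cQ QP]] := crit_prg vc pb (grank_rank rH') H'v nH'.
      pose Qs := [set p | Q p.1 p.2].
      have QE : rset Qs = Q by apply: funext => a; apply: funext => b; rewrite /rset inE.
      have hQ : clo c Qs by apply/asboolP; rewrite QE.
      have HE : cj (u^-1)%g H = prg c (rset Qs).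
        by apply: funext => g; apply: propext; rewrite QE.
      have gr := prg_grank hQ.
      have rk : rkq c Qs = n by have := rank_grank gr; rewrite -HE rH' => -[].
      have crQ : Qs \in critQ c n.
        rewrite inE hQ rk eqxx andbT /=; apply/asboolPn => PQ; apply: nH'.
        by rewrite HE -cv; apply: (wgen_prim gr).
      exists (exist _ Qs crQ); rewrite /F /= -HE.
      by have := cjV (u^-1)%g H; rewrite invgK.
    have [h1 h2 h3] := TP t; rewrite wE; apply: cj_crit.
    have gr := prg_grank h1; split.
    - by apply/is_subgroupP; apply: prg_subgrp.
    - by rewrite (rank_grank gr) h3.
    - by rewrite -cv; apply: prg_W.
    by rewrite -cv => /(prim_wgen gr).
  - have := Phi_asymp cw R tau W1 aper eP n1 piW.
    apply: (nuO_eq (N0 := 0%N)) => N _; rewrite avgE; congr (_ - _ * _%:R * _).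
    by rewrite card_sig; apply: eq_card => Q; rewrite inE.
split=> //; have [|N1 h] := Phi_exact cw R tau W1 eP.
  move=> n; rewrite cv; apply: prim_bound_pi_hyp => H m sH rH Hv nH; exfalso.
  by apply: (nat_inf_None E (n := m)); exists H; split=> //; apply/is_subgroupP.
by exists N1 => N NN; rewrite avgE h.
Qed.

End WordAverages.

(* Loaded only here because it shadows [pi], [setT], [set0] and [set x | _]. *)
From mathcomp Require Import finmap.
From mathcomp Require Import all_classical all_reals all_analysis.
Import numFieldNormedType.Exports.
Local Open Scope classical_set_scope.
Local Open Scope ring_scope.

(** * Landau notation, the inner product and the conclusion *)

Lemma nearO (P : nat -> Prop) : (exists N0, forall N, (N0 <= N)%N -> P N) ->
  \forall N \near \oo, P N.
Proof. by move=> [N0 h]; exists N0 => // N /= /h. Qed.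

Lemma eqO_shift (R : realType) (f g h : nat -> R) p :
  (forall N, h N.+1 = nu R N ^+ p) -> nuO (fun N => f N.+1 - g N.+1) p ->
  (f : nat -> R^o) = (g : nat -> R^o) +O_ \oo (h : nat -> R^o).
Proof.
move=> hE [K [N0 fg]]; apply/eqaddOP/bigO_exP; exists (`|K| + 1); first by rewrite ltr_wpDl.
apply: nearO; exists N0.+1 => -[//|N]; rewrite ltnS => NN.
rewrite -[(f - g) _]/(f N.+1 - g N.+1) hE (ger0_norm (exprn_ge0 _ (nu_ge0 _ _))).
apply: le_trans (fg N NN) _; rewrite ler_wpM2r ?exprn_ge0 ?nu_ge0 //.
by rewrite (le_trans (ler_norm K)) // lerDl.
Qed.

Lemma card_fset_set_fin (T : finType) (G : choiceType) (F : T -> G) (A : set G) : injective F ->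
  (forall H, A H <-> exists t, H = F t) -> #|` fset_set A| = #|T|.
Proof.
move=> Fi AF; have -> : A = [set` [fset F t | t in T]%fset].
  apply/seteqP; split=> H /=.
    by move=> /AF[t ->]; apply/imfsetP; exists t.
  by move=> /imfsetP[t _ ->]; apply/AF; exists t.
by rewrite set_fsetK card_imfset //= -cardE.
Qed.

Section Monomials.
Variables (R : realType) (k : nat) (a : 'I_k -> nat).
Variables (X : finType) (tau : X -> X).
Hypothesis Xtau : forall N (s : 'S_N),
  (\prod_(i < k) #|[set j | (s ^+ i.+1)%g j == j]%SET| ^ a i)%N = markfix tau s.

Lemma xiE m N (s : 'S_N) : xi m s = #|[set j | (s ^+ m)%g j == j]%SET|%:R :> R.
Proof.
congr _%:R; apply: eq_card => j; rewrite [RHS]finset.inE.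
by apply/idP/idP => [/set_mem|h]; last exact/mem_set.
Qed.

Lemma xi_monomialE N (s : 'S_N) : xi_monomial a s = (markfix tau s)%:R :> R.
Proof. by rewrite -Xtau natr_prod; apply: eq_bigr => i _; rewrite natrX xiE. Qed.

Lemma E_unif_monomial N : E_unif (@xi_monomial R k a) N.+1 = Unif R tau N.
Proof.
rewrite /E_unif /Unif natr_sum; congr (_ / _).
by apply: eq_bigr => s _; rewrite xi_monomialE.
Qed.

Lemma E_word_monomial r (w : freeGroup 'I_r) N :
  E_word w (@xi_monomial R k a) N.+1 = word_avg R tau w N.
Proof. by congr (_ / _); apply: eq_bigr => s _; rewrite xi_monomialE. Qed.

(** Multiplication by $\xi_1$ adds a fixed base point, and subtracting the monomial discards the
    relations in which this point is alone. The marked relations remain, hence the equality of the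
    two constants. *)
Lemma inner_SN_monomial N : (#|{: option X}| <= N)%N ->
  inner_SN (@xi_monomial R k a) (fun N s => xi 1 s - 1) N.+1 = #|marked_invq tau|%:R.
Proof.
move=> XN; have -> : #|marked_invq tau|%:R = Unif R (omap tau) N - Unif R tau N.
  rewrite !Unif_count //; last by apply: leq_trans XN; rewrite card_option.
  by rewrite -card_marked natrD addrK.
rewrite /inner_SN /Unif !natr_sum -mulrBl -sumrB mulrC; congr (_ / _).
apply: eq_bigr => s _; rewrite xi_monomialE mulrBr mulr1; congr (_ - _).
by rewrite -[X in _ = X%:R]/(markfix (omap tau) s) markfix_option natrM xiE expg1.
Qed.

Lemma inner_monomial :
  inner (@xi_monomial R k a) (fun N s => xi 1 s - 1) = #|marked_invq tau|%:R.
Proof.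
have ev : \forall N \near \oo, inner_SN (@xi_monomial R k a) (fun N s => xi 1 s - 1) N =
    #|marked_invq tau|%:R.
  apply: nearO; exists #|{: option X}|.+1 => -[//|N]; rewrite ltnS.
  exact: inner_SN_monomial.
apply: xget_unique => // y /= evy; have [N [<- <-]] := filter_ex (filterI evy ev).
by [].
Qed.

Lemma marks_inhabited : (exists i, a i <> 0%N) -> inhabited X.
Proof.
move=> [i ai]; have [x _|X0] := pickP (fun _ : X => true); first by exists.
(* The identity on two points is the test: with [X] empty the count is 1, whereas a nonzero exponent
   brings a power of 2. *)
have := Xtau (1%g : 'S_2); rewrite /markfix.
rewrite (eq_card (B := predT)) => [|h]; last by rewrite !inE; apply/forallP => x; have := X0 x.
rewrite card_ffun (eq_card0 (A := X)) => [|x]; last by have := X0 x.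
rewrite expn0 (bigD1 i) //= => /eqP; rewrite muln_eq1 => /andP[+ _].
rewrite (eq_card (B := predT)) => [|j]; last by rewrite !inE expg1n perm1 eqxx.
rewrite (_ : #|_| = 2%N); last exact: card_ord.
by rewrite -[X in _ == X](expn0 2%N) eqn_exp2l // => /eqP.
Qed.

End Monomials.

Theorem theorem1p3 (R : realType) (r : nat) (r_ge1 : (1 <= r)%N)
    (w : freeGroup 'I_r) (w_np : non_power w)
    (k : nat) (k_ge1 : (1 <= k)%N)
    (a : 'I_k -> nat) (a_neq0 : exists i, a i <> 0%N) :
  exists C : nat,
    [/\ (1 <= C)%N,
        (E_word w (xi_monomial a) : nat -> R^o) =
          (fun N => E_unif (xi_monomial a) N +
             C%:R * (#|` fset_set (Crit w)|%:R *
                     powN (omap predn (primitivity_rank w)) N))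
          +O_ \oo (powN (primitivity_rank w) : nat -> R^o)
      & C%:R = inner (xi_monomial a) (fun N s => xi 1 s - 1) :> R].
Proof.
have [X [tau Xtau]] := representable_monomial a.
have [x] := marks_inhabited Xtau a_neq0.
exists #|marked_invq tau|; split; [exact: marked_gt0 | | by rewrite (inner_monomial R Xtau)].
have [[-> [N1 h]]|[n [T [F [n1 -> Fi FP O]]]]] := word_avg_expansion R tau w_np.
  apply/eqaddOP/bigO_exP; exists 1 => //; apply: nearO; exists N1.+1 => -[//|N]; rewrite ltnS => NN.
  rewrite -[(_ - _) _]/(_ - _) /= !mulr0 addr0 (E_word_monomial R Xtau) (E_unif_monomial R Xtau).
  by rewrite h // subrr normr0 mul1r.
apply: (eqO_shift (p := n)) => [N|]; first by rewrite /= /nu exprVn.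
apply: (nuO_eq (N0 := 0%N) _ O) => N _.
rewrite (E_word_monomial R Xtau) (E_unif_monomial R Xtau) (card_fset_set_fin Fi FP) /=.
by rewrite /nu exprVn opprD addrA mulrA.
Qed.
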